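(* Let $F$ be a number field with $r_1$ real and $r_2$ complex places. Let $n\ge1$ be an integer and $\mathbf a\in\mathbb Z^n_{>0}$, $|\mathbf a|=a_1+\cdots+a_n$. Let $(f_v:F_v^n-\{0\}\to\mathbb R_{>0})_{v\in M_F}$ be a quasi-toric family of $\mathbf a$-homogenous functions of weighted degree $|\mathbf a|$ and let $H$ be the resulting height on $[\mathscr P(\mathbf a)(F)]$. (1) There exists $C>0$ such that for every $B>0$ $$|\{\mathbf x\in[\mathscr P(\mathbf a)(F)]-[\mathscr T(\mathbf a)(F)]: H(\mathbf x)\le B\}|<C\,B^{\frac{|\mathbf a|-\min_ia_i}{|\mathbf a|}}\log\Big(2+B^{\frac{|\mathbf a|-\min_ia_i}{|\mathbf a|}}\Big)^{n^2(r_1+r_2)+n-1}.$$ (2) There exists $C>0$ such that for every $B>0$ $$|\{\mathbf x\in[\mathscr P(\mathbf a)(F)]: H(\mathbf x)\le B\}|<C\,B\log(2+B)^{n^2(r_1+r_2)+n-1}.$$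
   Context: $M_F$ is the set of places of $F$, $M_F^0$ the finite ones. For finite $v$, $\pi_v$ is a uniformizer of the valuation ring $\mathcal O_v$ and $|\pi_v|_v=[\mathcal O_v:\pi_v\mathcal O_v]^{-1}$; $|\cdot|_v$ is the usual absolute value for $v$ real and its square for $v$ complex. $\mathscr P(\mathbf a)=(\mathbb A^n-\{0\})/\mathbb G_m$ (stack quotient for $t\cdot\mathbf x=(t^{a_j}x_j)_j$), $\mathscr T(\mathbf a)=\mathbb G_m^n/\mathbb G_m$ is its open substack; $[\mathscr P(\mathbf a)(F)]=(F^n-\{0\})/F^\times$ and $[\mathscr T(\mathbf a)(F)]=(F^\times)^n/F^\times\subset[\mathscr P(\mathbf a)(F)]$ for this action. A function $f:F_v^n-\{0\}\to\mathbb R_{\ge 0}$ is $\mathbf a$-homogenous of weighted degree $d$ if $f(t\cdot\mathbf x)=|t|_v^d f(\mathbf x)$ for all $t\in F_v^\times$. The toric one of weighted degree $d$ is $\mathbf x\mapsto|\pi_v|_v^{-d\,r_v(\mathbf x)}$, $r_v(\mathbf x)=\sup_{j:x_j\ne0}\lceil -v(x_j)/a_j\rceil$, if $v$ is finite, and $\mathbf x\mapsto(\max_j|x_j|_v^{1/a_j})^d$ if $v$ is infinite. A quasi-toric family of (weighted) degree $d$ is a family $(f_v)_{v\in M_F}$ of continuous $\mathbf a$-homogenous functions of weighted degree $d$ such that $f_v$ is toric for almost all $v\in M_F^0$. Its height is $H(\mathbf x)=\prod_{v}f_v(\widetilde{\mathbf x})$ for any lift $\widetilde{\mathbf x}\in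 F^n-\{0\}$ of $\mathbf x$. *)

(* Defs.v *)
From HB Require Import structures.
From mathcomp Require Import all_boot all_order all_algebra all_field.
From mathcomp Require Import all_classical all_reals all_analysis.
From mathcomp Require Import generic_quotient complex.

Set Implicit Arguments.
Unset Strict Implicit.
Unset Printing Implicit Defensive.

Import Order.TTheory GRing.Theory Num.Theory.

Local Open Scope classical_set_scope.
Local Open Scope card_scope.
Local Open Scope quotient_scope.
Local Open Scope ring_scope.

(* Absolute values are taken in Artin's sense: the triangle inequality only
   holds up to a constant, because the normalized absolute value at a complex
   place is the square of the usual one. *)
Record is_absval (R : realType) (K : fieldType) (N : K -> R) : Prop := {
  absval_ge0 : forall x, 0 <= N x;
  absval_eq0 : forall x, N x = 0 <-> x = 0;
  absvalM : forall x y, N (x * y) = N x * N y;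
  absvalD : exists C : R, forall x y, N (x + y) <= C * Num.max (N x) (N y)
}.

Definition valring (R : realType) (K : fieldType) (N : K -> R) : set K :=
  [set x | N x <= 1].

(* A generator of the maximal ideal of the valuation ring, assumed nonzero. *)
Definition uniformizer (R : realType) (K : fieldType) (N : K -> R) (p : K) :=
  [/\ p != 0, N p < 1 &
      forall x, N x < 1 -> exists2 y, valring N y & x = p * y].

(* The set of cosets O / pO. *)
Definition residues (R : realType) (K : fieldType) (N : K -> R) (p : K) :
    set (set K) :=
  [set [set x + p * y | y in valring N] | x in valring N].

(* The index [O : pO] is computed in F; it is the same in the completion. *)
Definition finite_absval (R : realType) (F : fieldType) (N : F -> R) : Prop :=
  [/\ is_absval N,
      forall x y, N (x + y) <= Num.max (N x) (N y) &
      exists p q, [/\ uniformizer N p, residues N p #= `I_q & N p = q%:R^-1]].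

Definition real_absval (R : realType) (F : fieldType) (N : F -> R) : Prop :=
  exists s : {rmorphism F -> R}, forall x, N x = `|s x|.

Definition complex_absval (R : realType) (F : fieldType) (N : F -> R) : Prop :=
  exists s : {rmorphism F -> R[i]},
    (exists x, forall y : R, s x <> (y%:C)%C) /\
    forall x, ((N x)%:C)%C = `|s x| ^+ 2.

(* Each place of F is represented by its unique normalized absolute value. *)
Record place (R : realType) (F : fieldType) := Place {
  place_abs :> F -> R;
  placeP : [\/ finite_absval place_abs, real_absval place_abs
             | complex_absval place_abs]
}.

HB.instance Definition _ (R : realType) (F : fieldType) :=
  gen_eqMixin (place R F).
HB.instance Definition _ (R : realType) (F : fieldType) :=
  gen_choiceMixin (place R F).

(* A completion of F at v, which is unique up to a unique isometric
   F-isomorphism. *)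
Record completion (R : realType) (F : fieldType) (v : place R F) := Completion {
  cfield :> fieldType;
  cemb : {rmorphism F -> cfield};
  cabs : cfield -> R;
  cabsP : is_absval cabs;
  cabs_emb : forall x, cabs (cemb x) = v x;
  cemb_dense : forall x (e : R), 0 < e -> exists y, cabs (x - cemb y) < e;
  cabs_complete : forall u : nat -> cfield,
    (forall e : R, 0 < e -> exists m, forall i j, (m <= i)%N -> (m <= j)%N ->
       cabs (u i - u j) < e) ->
    exists l, forall e : R, 0 < e -> exists m, forall i, (m <= i)%N ->
       cabs (u i - l) < e
}.

Arguments cemb {R F v} c.
Arguments cabs {R F v} c _.

Section Weighted.
Variables (n : nat) (a : 'I_n -> nat).

Definition wact (K : fieldType) (t : K) (x : 'rV[K]_n) : 'rV[K]_n :=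
  \row_j (t ^+ a j * x 0 j).

Definition wsize : nat := \sum_j a j.

(* The default value wsize is an upper bound of the a_j, so this is the
   minimum of the a_j as soon as 0 < n. *)
Definition wmin : nat := \big[minn/wsize]_j a j.

Section Local.
Variables (R : realType) (F : fieldType) (v : place R F) (Fv : completion v).
Implicit Types (f : 'rV[Fv]_n -> R) (d : R).

(* Functions on Fv^n - {0} are represented by functions on Fv^n whose value at
   0 is irrelevant. *)
Definition homogeneous d f : Prop :=
  (forall x : 'rV[Fv]_n, x != 0 -> 0 <= f x) /\
  (forall (t : Fv) (x : 'rV[Fv]_n), t != 0 -> x != 0 ->
     f (wact t x) = cabs Fv t `^ d * f x).

Definition continuous_off0 f : Prop :=
  forall x : 'rV[Fv]_n, x != 0 -> forall e : R, 0 < e -> exists2 r : R, 0 < r &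
    forall y : 'rV[Fv]_n, y != 0 -> (forall j, cabs Fv (y 0 j - x 0 j) < r) ->
      `|f y - f x| < e.

Definition unif : Fv := xget 0 (uniformizer (cabs Fv)).

Definition valuation (x : Fv) : int :=
  xget 0 [set k : int | cabs Fv x = cabs Fv unif ^ k].

Definition toric_exponent (x : 'rV[Fv]_n) : R :=
  sup [set (Num.ceil (- (valuation (x 0 j))%:~R / (a j)%:R : R))%:~R
      | j in [set j | x 0 j != 0]].

(* Only used at finite places: quasi_toric requires nothing toric at infinite
   places. *)
Definition toric d (x : 'rV[Fv]_n) : R :=
  cabs Fv unif `^ (- d * toric_exponent x).

End Local.

Definition quasi_toric (R : realType) (F : fieldType)
    (Fv : forall v : place R F, completion v) (d : R)
    (f : forall v, 'rV[Fv v]_n -> R) : Prop :=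
  [/\ forall v, continuous_off0 (f v),
      forall v, homogeneous d (f v) &
      finite_set [set v : place R F | finite_absval v /\
        ~ (forall x : 'rV[Fv v]_n, x != 0 -> f v x = toric d x)]].

Section Points.
Variable F : fieldType.

Definition nzvec := {x : 'rV[F]_n | x != 0}.

Definition wequiv (x y : nzvec) : bool :=
  `[< exists2 t : F, t != 0 & val y = wact t (val x) >].

Lemma wequiv_refl : reflexive wequiv.
Proof.
move=> x; apply/asboolP; exists 1; first exact: oner_neq0.
by apply/rowP => j; rewrite mxE expr1n mul1r.
Qed.

Lemma wequiv_sym : symmetric wequiv.
Proof.
suff H x y : wequiv x y -> wequiv y x by move=> x y; apply/idP/idP; apply: H.
move=> /asboolP[t t0 yE]; apply/asboolP; exists t^-1; first by rewrite invr_eq0.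
apply/rowP => j; rewrite yE !mxE mulrA -exprMn mulVf // expr1n mul1r //.
Qed.

Lemma wequiv_trans : transitive wequiv.
Proof.
move=> y x z /asboolP[t t0 yE] /asboolP[u u0 zE]; apply/asboolP.
exists (u * t); first by rewrite mulf_neq0.
by apply/rowP => j; rewrite zE yE !mxE mulrA exprMn.
Qed.

Canonical wequiv_equiv :=
  EquivRel wequiv wequiv_refl wequiv_sym wequiv_trans.

(* [P(a)(F)] = (F^n - {0}) / F^* *)
Definition wpoints := {eq_quot wequiv_equiv}.

HB.instance Definition _ := Choice.on wpoints.
HB.instance Definition _ := EqQuotient.on wpoints.

Definition lift_pt (x : wpoints) : 'rV[F]_n := val (repr x).

(* [T(a)(F)] *)
Definition torus_points : set wpoints :=
  [set x | forall j, lift_pt x 0 j != 0].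

End Points.

(* The product over all places has finite support for a quasi-toric family of
   positive functions; its value does not depend on the lift when the weighted
   degree of the family is the same at all places, by the product formula. *)
Definition height (R : realType) (F : fieldType)
    (Fv : forall v : place R F, completion v)
    (f : forall v, 'rV[Fv v]_n -> R) (x : wpoints F) : R :=
  \big[*%R/1]_(v \in [set: place R F]) f v (map_mx (cemb (Fv v)) (lift_pt x)).

End Weighted.

(* Main.v *)
(* Every point of height at most B has a lift z whose coordinates are integral at all finite
   places and satisfy |z_j|_v <= T^(a_j deg v) at the infinite ones, where T^[F:Q] is
   proportional to B^(1/|a|): at each place, compactness gives h in F^* with
   |x_j|_v <= |h|_v^(a_j) and f_v(x) >= c_v |h|_v^|a|, with equality and c_v = 1 at the toric
   places, and Minkowski's theorem, proved by pigeonhole, yields one t in F^* compensating all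
   these h simultaneously.  A nonzero element that is integral at all finite places has
   absolute value at least 1 in the product over the infinite ones, so a coordinate z_j takes
   O(T^([F:Q] a_j)) values.  Multiplying over j gives O(B) lifts, and
   O(B^((|a| - min a)/|a|)) lifts with a vanishing coordinate. *)
Require Import Defs.
From HB Require Import structures.
From mathcomp Require Import all_boot all_order all_algebra all_field.
From mathcomp Require Import finmap.
From mathcomp Require Import all_classical all_reals all_analysis.
From mathcomp Require Import generic_quotient complex zify ring lra.

Set Implicit Arguments.
Unset Strict Implicit.
Unset Printing Implicit Defensive.

Import Order.TTheory GRing.Theory Num.Theory.

Local Open Scope classical_set_scope.
Local Open Scope card_scope.
Local Open Scope ring_scope.

(** * Absolute values *)

(** Places are bare absolute values on F, so two facts have to be drawn from their definition alone.
    The first is that an element integral at all finite places is integral over Z, so that its norm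
    is an integer. Its proof needs, for each non-integral element, a finite place where that element
    is large: a valuation ring comes from Zorn's lemma, and is shown to be discrete with finite
    residue field in order to carry a normalized absolute value. The second is that the product of
    |m|_v^-1 over finitely many finite places is at most m^[F:Q]. It comes from counting residues
    modulo primes after weak approximation; it shows that an element is a unit at almost all finite
    places, and that scaling by m costs nothing in the pigeonhole argument. These two inequalities
    stand in for the full product formula. *)

Section RealPowers.
Import numFieldNormedType.Exports.
Variable R : realType.

Lemma expr_lt_eps (r d : R) : 0 <= r -> r < 1 -> 0 < d ->
  exists K, forall k, (K <= k)%N -> r ^+ k < d.
Proof.
move=> r0 r1 d0; have /cvgrPdist_lt/(_ d d0)[K _ HK] : (r ^+ n @[n --> \oo] --> (0 : R))%classic.
  by apply: cvg_expr; rewrite ger0_norm.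
exists K => k Kk; have := HK k Kk.
by rewrite /= sub0r normrN ger0_norm // exprn_ge0.
Qed.

Lemma expr_gt_bound (r d : R) : 1 < r -> exists K, forall k, (K <= k)%N -> d < r ^+ k.
Proof.
move=> r1; have r0 : 0 < r by lra.
have [|||K HK] := @expr_lt_eps r^-1 (Num.max 1 d)^-1.
- by rewrite invr_ge0 ltW.
- by rewrite invf_lt1.
- by rewrite invr_gt0 lt_max ltr01.
exists K => k /HK.
rewrite exprVn ltf_pV2 ?posrE ?exprn_gt0 ?lt_max ?ltr01 //.
by rewrite gt_max => /andP[].
Qed.

End RealPowers.

Section AbsvalTheory.
Variables (R : realType) (K : fieldType) (N : K -> R).
Hypothesis hN : is_absval N.

Lemma absval0 : N 0 = 0. Proof. exact/(absval_eq0 hN). Qed.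

Lemma absval_gt0 x : (0 < N x) = (x != 0).
Proof.
rewrite lt_def (absval_ge0 hN) andbT; congr (~~ _).
by apply/eqP/eqP => /(absval_eq0 hN).
Qed.

Lemma absval1 : N 1 = 1.
Proof.
have N1 : N 1 != 0 by rewrite gt_eqF // absval_gt0 oner_neq0.
by apply: (mulfI N1); rewrite -(absvalM hN) !mulr1.
Qed.

Lemma absvalX x n : N (x ^+ n) = N x ^+ n.
Proof. by elim: n => [|n IH]; rewrite ?expr0 ?absval1 // !exprS (absvalM hN) IH. Qed.

Lemma absvalV x : N x^-1 = (N x)^-1.
Proof.
have [->|x0] := eqVneq x 0; first by rewrite invr0 absval0 invr0.
have Nx : N x != 0 by rewrite gt_eqF // absval_gt0.
by apply: (mulfI Nx); rewrite -(absvalM hN) !mulfV // absval1.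
Qed.

Lemma absvalZ x (k : int) : N (x ^ k) = N x ^ k.
Proof. by case: k => k; rewrite ?NegzE -?exprnN ?absvalV ?absvalX. Qed.

Lemma absvalN1 : N (-1) = 1.
Proof.
apply/eqP; rewrite -(@pexpr_eq1 _ _ 2) // ?(absval_ge0 hN) //.
by rewrite -absvalX sqrrN expr1n absval1.
Qed.

Lemma absvalN x : N (- x) = N x.
Proof. by rewrite -mulN1r (absvalM hN) absvalN1 mul1r. Qed.

Lemma absvalB x y : N (x - y) = N (y - x).
Proof. by rewrite -absvalN opprB. Qed.

Lemma absval_div x y : N (x / y) = N x / N y.
Proof. by rewrite (absvalM hN) absvalV. Qed.

Lemma absvalD_ge1 : exists2 C : R, 1 <= C &
  forall x y, N (x + y) <= C * Num.max (N x) (N y).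
Proof.
have [C HC] := absvalD hN; exists (Num.max 1 C); first by rewrite le_max lexx.
move=> x y; apply: le_trans (HC x y) _; apply: ler_wpM2r.
  by rewrite le_max (absval_ge0 hN).
by rewrite le_max lexx orbT.
Qed.

Hypothesis ultra : forall x y, N (x + y) <= Num.max (N x) (N y).

Lemma ultraB x y : N (x - y) <= Num.max (N x) (N y).
Proof. by rewrite -(absvalN y). Qed.

Lemma ultra_nat n : N n%:R <= 1.
Proof.
elim: n => [|n IH]; first by rewrite absval0 ler01.
by rewrite -addn1 natrD (le_trans (ultra _ _)) // ge_max IH absval1 lexx.
Qed.

Lemma ultra_int (m : int) : N m%:~R <= 1.
Proof.
by case: m => n; rewrite ?NegzE ?mulrNz ?absvalN; apply: ultra_nat.
Qed.

Lemma ultra_eq x y : N x < N y -> N (x + y) = N y.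
Proof.
move=> xy; apply/eqP; rewrite eq_le; apply/andP; split.
  by rewrite (le_trans (ultra _ _)) // ge_max lexx ltW.
rewrite leNgt; apply/negP => h.
have := ultraB (x + y) x; rewrite addrC addKr leNgt => /negP; apply.
by rewrite gt_max h.
Qed.

Lemma ultra_sum (I : Type) (r : seq I) (P : pred I) (F : I -> K) (B : R) :
  0 <= B -> (forall i, P i -> N (F i) <= B) -> N (\sum_(i <- r | P i) F i) <= B.
Proof.
move=> B0 HB; apply: (big_ind (fun x => N x <= B)) => //; first by rewrite absval0.
by move=> x y hx hy; rewrite (le_trans (ultra _ _)) // ge_max hx.
Qed.

(** If [N x > 1], solving the monic equation for its leading power would bound [N x ^+ k.+1] by
    [N x ^+ k], because integers have [N] at most 1. *)
Lemma ultra_root (p : {poly int}) x : p \is monic -> root (map_poly intr p) x -> N x <= 1.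
Proof.
move=> pm rx; rewrite leNgt; apply/negP => Nx1.
have x0 : x != 0 by rewrite -absval_gt0 (lt_trans ltr01).
have sp : (0 < size p)%N by rewrite lt0n size_poly_eq0 monic_neq0.
have e : x ^+ (size p).-1 = - \sum_(i < (size p).-1) (p`_i)%:~R * x ^+ i.
  apply/eqP; rewrite -addr_eq0; apply/eqP; move/rootP: rx.
  rewrite horner_coef size_map_poly_id0; last first.
    by rewrite (monicP pm) rmorph1 oner_neq0.
  rewrite -[in LHS](prednK sp) big_ord_recr /= coef_map /=.
  have -> : p`_(size p).-1 = 1 by exact/monicP.
  rewrite mul1r => h; rewrite addrC -[RHS]h; congr (_ + _).
  by apply: eq_bigr => i _; rewrite coef_map.
case E : (size p).-1 => [|k].
  by move: e; rewrite E big_ord0 expr0 oppr0 => /eqP; rewrite oner_eq0.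
have : N (x ^+ k.+1) <= N x ^+ k.
  rewrite -E e absvalN; apply: ultra_sum => [|i _].
    by rewrite exprn_ge0 ?(absval_ge0 hN).
  rewrite (absvalM hN) absvalX.
  rewrite -[leRHS]mul1r ler_pM ?ultra_int ?exprn_ge0 ?(absval_ge0 hN) //.
  rewrite ler_eXn2l // -ltnS -E; exact: ltn_ord.
rewrite absvalX exprS leNgt => /negP; apply.
by rewrite ltr_pMl ?exprn_gt0 ?(lt_trans ltr01).
Qed.

End AbsvalTheory.

(** * Valuation rings of a number field *)

Section Congruences.
Variable F : fieldExtType rat.

Lemma intF_eq0 (m : int) : (m%:~R == 0 :> F) = (m == 0).
Proof. by rewrite -(rmorph_int (in_alg F)) fmorph_eq0 intr_eq0. Qed.

Lemma natF_eq0 (m : nat) : (m%:R == 0 :> F) = (m == 0%N).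
Proof. exact: (intF_eq0 m). Qed.

(** By descent: the coefficients of an integer relation among the [u i] are all divisible by p, and
    dividing them by p leaves a relation, so they vanish. Clearing denominators extends this to
    rational relations. *)
Lemma le_dim_of_indep_modn (p k : nat) (u : 'I_k -> F) : (1 < p)%N ->
  (forall c : 'I_k -> int, (exists i, ~~ (p %| c i)%Z) ->
     \sum_i (c i)%:~R * u i != 0) -> (k <= \dim {:F})%N.
Proof.
move=> p1 hu.
have main (m : nat) : forall c : 'I_k -> int, \sum_i (c i)%:~R * u i = 0 ->
    forall i, (`|c i| <= m)%N -> c i = 0.
  elim: m => [|m IH] c c0 i ci.
    by apply/eqP; rewrite -absz_eq0 -leqn0.
  have pc j : (p %| c j)%Z.
    by apply: contraT => npc; have := hu c (ex_intro _ j npc); rewrite c0 eqxx.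
  pose c' j := (c j %/ p)%Z.
  have cE j : c j = (c' j * p)%R by rewrite divzK.
  have c'0 : \sum_j (c' j)%:~R * u j = 0.
    have pF : (p%:R : F) != 0 by rewrite natF_eq0 -lt0n (ltn_trans _ p1).
    apply: (mulfI pF); rewrite mulr0 -[RHS]c0 mulr_sumr; apply: eq_bigr => j _.
    by rewrite cE intrM mulrA; congr (_ * _); rewrite mulrC.
  have [ci0|ci0] := eqVneq (c i) 0; first exact: ci0.
  have := IH c' c'0 i; rewrite cE => -> //.
  have : (`|c' i| < `|c i|)%N.
    rewrite cE abszM absz_nat ltn_Pmulr // absz_gt0.
    by apply: contra ci0 => /eqP h; rewrite cE h mul0r.
  by move=> h; rewrite -ltnS; apply: leq_trans h ci.
have fr : free [tuple u i | i < k].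
  apply/freeP => q q0 i.
  pose d := \prod_j denq (q j).
  have d0 : d != 0 by apply/prodf_neq0 => j _; exact: denq_neq0.
  pose c j := numq (q j) * \prod_(l | l != j) denq (q l).
  have cE j : (c j)%:~R = d%:~R * q j :> rat.
    by rewrite /d (bigD1 j (P := predT)) //= /c !intrM numqE; ring.
  have c0 : \sum_j (c j)%:~R * u j = 0.
    have := congr1 (fun y => (d%:~R : rat) *: y) q0; rewrite scaler0 scaler_sumr => qd0.
    apply: etrans qd0; apply: eq_bigr => j _.
    by rewrite -tnth_nth tnth_mktuple scalerA -cE scaler_int mulrzl.
  have := main `|c i|%N c c0 i (leqnn _) => /(congr1 (fun z : int => z%:~R : rat)).
  rewrite cE => /eqP; rewrite mulf_eq0 intr_eq0 (negbTE d0) /= => /eqP //.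
by have := dimvS (subvf <<[tuple u i | i < k]>>); rewrite (eqP fr) size_tuple.
Qed.

Variable O : set F.
Hypothesis O0 : O 0.
Hypothesis OB : forall x y, O x -> O y -> O (x - y).

Let ON x : O x -> O (- x). Proof. by move=> Ox; rewrite -sub0r; apply: OB. Qed.

Let OD x y : O x -> O y -> O (x + y).
Proof. by move=> Ox Oy; rewrite -(opprK y); apply: OB => //; apply: ON. Qed.

Let OMn x n : O x -> O (x *+ n).
Proof. by move=> Ox; elim: n => [|n IH]; rewrite ?mulr0n // mulrS; apply: OD. Qed.

Let OMz x (m : int) : O x -> O (m%:~R * x).
Proof.
by move=> Ox; rewrite mulrzl; case: m => m; rewrite ?NegzE ?mulrNz;
   [|apply: ON]; apply: OMn.
Qed.

Let Osum k (c : 'I_k -> int) (u : 'I_k -> F) : (forall i, O (u i)) ->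
  O (\sum_i (c i)%:~R * u i).
Proof. by move=> Ou; apply: big_ind => // i _; apply: OMz. Qed.

(* A family of elements of O that is independent modulo p is independent over Q; so O/pO has
   dimension at most [F:Q] over F_p. *)
Lemma card_mod_prime (p : nat) (s : seq F) : prime p ->
  (forall x, x \in s -> O x) -> uniq s ->
  (forall x y, x \in s -> y \in s -> O ((x - y) / p%:R) -> x = y) ->
  (size s <= p ^ \dim {:F})%N.
Proof.
move=> pp Os us inj.
have p1 := prime_gt1 pp.
have p0 : (p%:R : F) != 0 by rewrite natF_eq0 -lt0n prime_gt0.
pose indep k (u : 'I_k -> F) := (forall i, O (u i)) /\
  forall c : 'I_k -> int, O ((\sum_i (c i)%:~R * u i) / p%:R) -> forall i, (p %| c i)%Z.
pose P k := `[< exists u, @indep k u >].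
have P0 : exists k, P k.
  by exists 0; apply/asboolP; exists (fun=> 0); split=> [[]|c _ []].
have Pb k : P k -> (k <= \dim {:F})%N.
  move=> /asboolP[u [Ou hu]]; apply: (@le_dim_of_indep_modn p k u p1) => c [i ci].
  apply: contra ci => /eqP c0; apply: hu; by rewrite c0 mul0r.
case: (ex_maxnP P0 Pb) => k Pk kmax; have /asboolP[u [Ou hu]] := Pk.
(* As k is maximal, [u] spans modulo p: every x in O is congruent to a combination with digits below
   p. *)
have red x : O x -> exists c : {ffun 'I_k -> 'I_p},
    O ((x - \sum_i (c i : nat)%:~R * u i) / p%:R).
  move=> Ox.
  have [c0 [c [nc0 Oc]]] : exists (c0 : int) (c : 'I_k -> int), ~~ (p %| c0)%Z /\
      O ((c0%:~R * x + \sum_i (c i)%:~R * u i) / p%:R).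
    (* Otherwise prepending x to [u] would give an independent family of k + 1 elements: the
       coefficient of x in a relation is a multiple of p, and removing it leaves a relation among
       the [u i]. *)
    apply: contrapT => hno; have : (k.+1 <= k)%N; last by rewrite ltnn.
    apply: kmax; apply/asboolP.
    exists (fun i => if unlift ord0 i is Some j then u j else x); split.
      by move=> i; case: (unlift _ _).
    move=> c; rewrite big_ord_recl unlift_none.
    under eq_bigr => i _ do rewrite liftK.
    move=> Oc; have pc0 : (p %| c ord0)%Z.
      by apply: contraT => nc; case: hno; exists (c ord0), (fun i => c (lift ord0 i)).
    move=> i; case: (unliftP ord0 i) => [j|] -> //.
    apply: (hu (fun i => c (lift ord0 i))); case/dvdzP: pc0 => e ce.
    rewrite (_ : _ / _ = ((c ord0)%:~R * x + \sum_(i < k) (c (lift ord0 i))%:~R * u i) / p%:R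
       - e%:~R * x); first by apply: OB => //; apply: OMz.
    rewrite ce intrM -pmulrn; set S := \sum_(_ < _) _; field; exact: p0.
  (* b inverts c0 modulo p, so multiplying the relation by b solves it for x modulo p. *)
  have [b [e be]] : exists b : int, exists e : int, b * c0 = 1 + p%:Z * e.
    have cop : coprimez c0 p by rewrite coprimez_sym coprimezE absz_nat prime_coprime.
    have [[b e] /= be] := coprimezP _ _ cop.
    by exists b, (- e); rewrite -be; ring.
  pose c' i := ((- b * c i) %% p)%Z.
  have c'0 i : 0 <= c' i < p.
    by rewrite modz_ge0 ?ltz_pmod // ?eqz_nat ?ltz_nat -?lt0n prime_gt0.
  have c'p i : (`|c' i| < p)%N by have /andP[h1 h2] := c'0 i; lia.
  exists [ffun i => Ordinal (c'p i)].
  have -> : (x - \sum_i (([ffun i => Ordinal (c'p i)] i : 'I_p) : nat)%:~R * u i) / p%:R =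
     b%:~R * ((c0%:~R * x + \sum_i (c i)%:~R * u i) / p%:R) - e%:~R * x
       + \sum_i ((- b * c i) %/ p)%Z%:~R * u i.
    under eq_bigr => i _ do rewrite ffunE /=.
    set S1 := \sum_(_ < _) _; set S2 := \sum_(_ < _) _; set S3 := \sum_(_ < _) _.
    have SE : - b%:~R * S2 = p%:R * S3 + S1.
      rewrite !mulr_sumr -big_split /=; apply: eq_bigr => i _.
      have /andP[/gez0_abs -> _] := c'0 i.
      rewrite !mulrA -mulrDl -mulrNz -intrM [in LHS](divz_eq (- b * c i) p).
      by rewrite intrD intrM -pmulrn [_ * p%:R]mulrC.
    have bF : b%:~R * c0%:~R = 1 + p%:R * e%:~R :> F.
      by rewrite -intrM be intrD intrM -pmulrn.
    transitivity ((b%:~R * c0%:~R * x + b%:~R * S2 - p%:R * e%:~R * x + p%:R * S3) / p%:R).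
      congr (_ / _); rewrite bF (_ : b%:~R * S2 = - (p%:R * S3 + S1)); [ring | by rewrite -SE mulNr opprK].
    by field.
  apply: OD; last exact: Osum.
  by apply: OB; apply: OMz.
have [g Hg] : exists g : F -> {ffun 'I_k -> 'I_p}, forall x, O x ->
    O ((x - \sum_i (g x i : nat)%:~R * u i) / p%:R).
  have [g Hg] : {g : F -> {ffun 'I_k -> 'I_p} & forall x, O x ->
    O ((x - \sum_i (g x i : nat)%:~R * u i) / p%:R)}.
    apply: (@choice _ _ (fun x (c : {ffun 'I_k -> 'I_p}) => O x ->
    O ((x - \sum_i (c i : nat)%:~R * u i) / p%:R))) => x.
    have [/red[c Hc]|nOx] := pselect (O x); first by exists c.
    by exists [ffun=> Ordinal (prime_gt0 pp)].
  by exists g.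
have gi : {in s &, injective g}.
  move=> x y xs ys gxy; apply: inj => //.
  rewrite (_ : _ / _ = (x - \sum_i (g x i : nat)%:~R * u i) / p%:R -
     (y - \sum_i (g y i : nat)%:~R * u i) / p%:R); first by apply: OB; apply: Hg; apply: Os.
  by rewrite gxy -mulrBl opprB addrA subrK.
rewrite -(size_map g); apply: leq_trans (_ : p ^ k <= _)%N; last first.
  by rewrite leq_pexp2l ?prime_gt0 // Pb.
rewrite -[p in (p ^ k)%N]card_ord -[k in (_ ^ k)%N]card_ord -card_ffun.
rewrite -(card_uniqP _) ?map_inj_in_uniq //; exact: max_card.
Qed.

End Congruences.

(** * Existence of valuation rings *)

Section Subrings.
Variable F : fieldType.
Implicit Types (V : set F) (p q : {poly F}).

Definition subring V :=
  [/\ V 1, forall x y, V x -> V y -> V (x - y) & forall x y, V x -> V y -> V (x * y)].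

Definition poly_in V p := forall i, V p`_i.

Section Closure.
Variable V : set F.
Hypothesis sV : subring V.

Lemma subring1 : V 1. Proof. by case: sV. Qed.
Lemma subringB x y : V x -> V y -> V (x - y). Proof. by case: sV => _ + _; apply. Qed.
Lemma subringM x y : V x -> V y -> V (x * y). Proof. by case: sV => _ _; apply. Qed.
Lemma subring0 : V 0. Proof. by rewrite -(subrr 1); apply: subringB; apply: subring1. Qed.
Lemma subringN x : V x -> V (- x).
Proof. by rewrite -sub0r; apply: subringB; apply: subring0. Qed.
Lemma subringD x y : V x -> V y -> V (x + y).
Proof. by move=> Vx Vy; rewrite -(opprK y); apply: subringB => //; apply: subringN. Qed.
Lemma subringX x n : V x -> V (x ^+ n).
Proof.
by move=> Vx; elim: n => [|n IH]; rewrite ?expr0 ?exprS; [apply: subring1|apply: subringM].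
Qed.
Lemma subring_sum (I : Type) (r : seq I) (P : pred I) (G : I -> F) :
  (forall i, P i -> V (G i)) -> V (\sum_(i <- r | P i) G i).
Proof. by apply: big_ind; [apply: subring0|apply: subringD]. Qed.
Lemma subring_nat n : V n%:R.
Proof. by elim: n => [|n IH]; [apply: subring0|rewrite -addn1 natrD; apply: subringD IH subring1]. Qed.
Lemma subring_int (m : int) : V m%:~R.
Proof.
by case: m => n; rewrite ?NegzE ?mulrNz; [|apply: subringN]; apply: subring_nat.
Qed.

Lemma poly_inC c : V c -> poly_in V c%:P.
Proof. by move=> Vc i; rewrite coefC; case: ifP => // _; apply: subring0. Qed.
Lemma poly_inXn n : poly_in V 'X^n.
Proof. by move=> i; rewrite coefXn; case: eqP => _ /=; [apply: subring1|apply: subring0]. Qed.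
Lemma poly_inB p q : poly_in V p -> poly_in V q -> poly_in V (p - q).
Proof. by move=> Vp Vq i; rewrite coefB; apply: subringB. Qed.
Lemma poly_inD p q : poly_in V p -> poly_in V q -> poly_in V (p + q).
Proof. by move=> Vp Vq i; rewrite coefD; apply: subringD. Qed.
Lemma poly_inM p q : poly_in V p -> poly_in V q -> poly_in V (p * q).
Proof. by move=> Vp Vq i; rewrite coefM; apply: subring_sum => j _; apply: subringM. Qed.
Definition adjoin x : set F := [set p.[x] | p in poly_in V].

Lemma adjoin_subring x : subring (adjoin x).
Proof.
split=> [|_ _ [p Vp <-] [q Vq <-]|_ _ [p Vp <-] [q Vq <-]].
- by exists 1%:P; [apply: poly_inC subring1|rewrite hornerC].
- by exists (p - q); [apply: poly_inB|rewrite hornerD hornerN].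
- by exists (p * q); [apply: poly_inM|rewrite hornerM].
Qed.

Lemma sub_adjoin x : V `<=` adjoin x.
Proof. by move=> c Vc; exists c%:P; [apply: poly_inC|rewrite hornerC]. Qed.

Lemma mem_adjoin x : adjoin x x.
Proof. by exists 'X^1; [apply: poly_inXn|rewrite hornerXn]. Qed.

End Closure.

Definition int_ring : set F := [set m%:~R | m in [set: int]].

Lemma int_ring_subring : subring int_ring.
Proof.
split=> [|_ _ [m _ <-] [l _ <-]|_ _ [m _ <-] [l _ <-]].
- by exists 1.
- by exists (m - l); rewrite ?intrD ?mulrNz.
- by exists (m * l); rewrite ?intrM.
Qed.

Lemma exprV_mulX (y : F) i n : y != 0 -> (i <= n)%N -> y^-1 ^+ i * y ^+ n = y ^+ (n - i).
Proof.
move=> y0 le; rewrite -{1}(subnKC le) exprD mulrA -exprMn mulVf //.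
by rewrite expr1n mul1r.
Qed.

Definition integralZ (x : F) := integralOver (intr : int -> F) x.

(** Multiplying [x = p.[x^-1]] by x^(n-1), where n is the size of p, gives a monic equation of
    degree n. Its coefficients lie in F as images of integers, hence the passage through
    [integral_root_monic]. *)
Lemma adjoin_inv_integral x : adjoin int_ring x^-1 x -> integralZ x.
Proof.
have [->|x0] := eqVneq x 0.
  by move=> _; exists 'X; [apply: monicX|rewrite map_polyX /root hornerX].
case=> p Vp px.
pose n := size p.
have n0 : (0 < n)%N.
  by rewrite lt0n size_poly_eq0; apply: contra x0 => /eqP p0; rewrite -px p0 horner0.
have pint i : integralZ p`_i by have [m _ <-] := Vp i; apply: mxpoly.integral_id.
apply: (@mxpoly.integral_root_monic _ _ (intr : {rmorphism int -> F}) x ('X^n - \poly_(i < n) p`_(n.-1 - i)%N)).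
- by rewrite monicE lead_coefDl ?lead_coefXn // size_polyN size_polyXn ltnS; exact: size_poly.
- rewrite /root hornerD hornerN hornerXn subr_eq0 horner_poly; apply/eqP.
  rewrite -[n in LHS](prednK n0) exprSr -{2}px horner_coef mulr_sumr.
  rewrite (reindex_inj rev_ord_inj) /=; apply: eq_bigr => i _.
  have lin : (i < n)%N := ltn_ord i.
  have le : (n - i.+1 <= n.-1)%N by rewrite -subn1 leq_sub2l.
  rewrite mulrCA [x ^+ _ * _]mulrC exprV_mulX //.
  have e1 : (n - i.+1 = n.-1 - i)%N by move: (n) lin => N; lia.
  have e2 : (n.-1 - (n - i.+1) = i)%N by move: (n) lin => N; lia.
  by rewrite e2 e1.
- set g := (_ - _); have gint i : integralZ g`_i.
    rewrite coefB coefXn coef_poly.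
    apply: (@mxpoly.integral_sub _ _ (intr : {rmorphism int -> F})); first exact: mxpoly.integral_nat.
    by case: ifP => _; [apply: pint|apply: (mxpoly.integral0 (intr : {rmorphism int -> F}))].
  by move: gint => /(proj1 (mxpoly.integral_poly (intr : {rmorphism int -> F}) g)).
Qed.

(* V is a subring maximal among those containing z^-1 but not z.  If it contained neither x
   nor x^-1, there would be relations 1 = z^-1 p(x) and 1 = z^-1 q(x^-1) over V; the shorter
   one serves to lower the degree of the longer, against minimality. *)
Lemma exists_valring (z : F) : ~ integralZ z ->
  exists V : set F, [/\ subring V, V z^-1, ~ V z & forall x, V x \/ V x^-1].
Proof.
move=> zint.
have z0 : z != 0.
  by apply: contra_notN zint => /eqP ->; apply: mxpoly.integral0.
pose good (A : set F) := [/\ subring A, A z^-1 & ~ A z].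
have good0 : good (adjoin int_ring z^-1).
  split; [exact: adjoin_subring int_ring_subring _| exact: mem_adjoin int_ring_subring _|].
  by move=> /adjoin_inv_integral.
have [|A [A0 Amax]] := @Zorn_bigcup F (fun A => A = set0 \/ good A).
  move=> C Cgood Ctot.
  have [[A0 [CA0 gA0]]|noC] := pselect (exists A, C A /\ good A); last first.
    left; rewrite -subset0 => x [A CA Ax]; have [A0|gA] := Cgood _ CA.
      by rewrite -A0.
    by apply: noC; exists A.
  right; split; last 2 first.
  - by exists A0 => //; case: gA0.
  - move=> [A CA Az]; have [A0'|[_ _]] := Cgood _ CA; last exact.
    by move: Az; rewrite A0'.
  have gC A x : C A -> A x -> good A.
    by move=> /Cgood[->|//].
  have up A B x y : C A -> C B -> A x -> B y -> exists D, [/\ C D, good D, D x & D y].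
    move=> CA CB Ax By; have [AB|BA] := Ctot _ _ CA CB.
      by exists B; split=> //; [apply: gC By|apply: AB].
    by exists A; split=> //; [apply: gC Ax|apply: BA].
  split.
  - by exists A0 => //; case: gA0 => -[].
  - move=> x y [A CA Ax] [B CB By]; have [D [CD [sD _ _] Dx Dy]] := up _ _ _ _ CA CB Ax By.
    by exists D => //; apply: subringB.
  - move=> x y [A CA Ax] [B CB By]; have [D [CD [sD _ _] Dx Dy]] := up _ _ _ _ CA CB Ax By.
    by exists D => //; apply: subringM.
have gA : good A.
  case: A0 => // A0; case: (Amax (adjoin int_ring z^-1)); last by right.
  by rewrite A0 properEneq; split=> //; apply/eqP => h; have [_] := good0; rewrite -h.
case: gA => sA Az nAz; set w := z^-1 in Az.
have adj x : ~ A x -> adjoin A x z.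
  move=> nAx; apply: contrapT => nz; apply: (Amax (adjoin A x)); last first.
    by right; split=> //; [apply: adjoin_subring|apply: sub_adjoin].
  rewrite properEneq; split; last exact: sub_adjoin.
  by apply/eqP => h; apply: nAx; rewrite h; apply: mem_adjoin.
have zw : z * w = 1 by rewrite /w mulfV.
(* Let y = 1 - w c. If y^-1 were not in A, maximality would put z in A[y^-1], so b = z y^k would be
   in A for some k. As y^k = 1 - w e with e in A, and z w = 1, this gives z = b + e in A. *)
have unit c : A c -> A (1 - w * c)^-1.
  move=> Ac; apply: contrapT => /adj[p Ap pz].
  set y := 1 - w * c in pz.
  have Ay : A y by apply: subringB (subringM sA Az Ac) => //; apply: subring1.
  have y0 : y != 0.
    by apply/eqP => y0; apply: nAz; rewrite -pz y0 invr0 horner_coef0.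
  have [k [b [Ab zE]]] : exists k b, A b /\ z * y ^+ k = b.
    exists (size p), (z * y ^+ size p); split=> //.
    rewrite -pz horner_coef mulr_suml; apply: subring_sum => // i _.
    rewrite -mulrA; apply: subringM => //.
    by rewrite exprV_mulX ?(ltnW (ltn_ord i)) //; apply: subringX.
  have [e [Ae yE]] : exists e, A e /\ y ^+ k = 1 - w * e.
    elim: (k) => [|j [e [Ae IH]]].
      by exists 0; split; [apply: subring0|rewrite mulr0 subr0].
    exists (c + e - w * c * e); split.
      by do ?[apply: subringM => // | apply: subringB => // | apply: subringD => //].
    by rewrite exprS IH /y; ring.
  apply: nAz; rewrite (_ : z = b + e); first exact: subringD.
  by rewrite -zE yE mulrBr mulr1 mulrA zw mul1r subrK.
exists A; split=> // x; apply: contrapT => /not_orP[nAx nAxV].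
pose J y n := `[< exists p, [/\ poly_in A p, (size p <= n)%N & 1 = w * p.[y]] >].
have Jex y : ~ A y -> exists n, J y n.
  move=> /adj[p Ap pz]; exists (size p); apply/asboolP; exists p; split=> //.
  by rewrite pz mulrC.
have main y n m : J y n -> (forall k, J y k -> (n <= k)%N) -> J y^-1 m -> (m <= n)%N -> y != 0 -> False.
  move=> /asboolP[p [Ap sp p1]] nmin /asboolP[q [Aq sq q1]] mn y0.
  set u := 1 - w * q`_0.
  have u0 : u != 0.
    rewrite subr_eq0; apply/eqP => /(congr1 ( *%R z)); rewrite mulr1 mulrA zw mul1r => zE.
    by apply: nAz; rewrite zE.
  have [m' mE] : exists m', m = m'.+2.
    case: m sq {mn} => [|[|m']] sq; last by exists m'.
      move: q1; move: sq; rewrite leqn0 size_poly_eq0 => /eqP ->.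
      by rewrite horner0 mulr0 => /eqP; rewrite oner_eq0.
    move: q1; rewrite (size1_polyC sq) hornerC => /(congr1 ( *%R z)).
    by rewrite mulrA zw mulr1 mul1r => zE; case: nAz; rewrite zE.
  (* The relation for y^-1, multiplied by y^(m'+1) and divided by u, which has absorbed the constant
     term of q and is a unit. *)
  have [g [Ag sg gE]] : exists g, [/\ poly_in A g, (size g <= m'.+1)%N & y ^+ m'.+1 = w * g.[y]].
    exists (u^-1 *: \poly_(i < m'.+1) q`_(m'.+1 - i)%N); split.
    - move=> i; rewrite coefZ coef_poly; apply: subringM => //; first exact: unit.
      by case: ifP => // _; apply: subring0.
    - by rewrite (leq_trans (size_scale_leq _ _)) ?size_poly.
    apply: (mulfI u0); rewrite hornerZ horner_poly [w * (_ * _)]mulrCA mulVKf //.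
    have -> : u = w * \sum_(i < m'.+1) q`_(i.+1) * y^-1 ^+ i.+1.
      move: q1; rewrite (horner_coef_wide _ sq) mE big_ord_recl expr0 mulr1 mulrDr => /eqP.
      by rewrite addrC -subr_eq => /eqP.
    rewrite -[LHS]mulrA; congr (_ * _); rewrite mulr_suml (reindex_inj rev_ord_inj) /=.
    apply: eq_bigr => i _; have lim : (i < m'.+1)%N := ltn_ord i.
    rewrite -mulrA exprV_mulX //; last by lia.
    by congr (q`_ _ * y ^+ _); lia.
  have nE : n = (n - m + m'.+2)%N by rewrite -mE subnK.
  have nE1 : n.-1.+1 = n by lia.
  (* The leading power y^(n-1) = y^(n-m) y^(m'+1) of p is replaced by w y^(n-m) g(y), of lower
     degree in y. *)
  have : (n <= n.-1)%N.
    apply: nmin; apply/asboolP.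
    exists (\poly_(i < n.-1) p`_i + (w * p`_n.-1) *: ('X^(n - m) * g)); split.
    - apply: poly_inD => //.
        by move=> i; rewrite coef_poly; case: ifP => // _; apply: subring0.
      move=> i; rewrite coefZ; apply: subringM; first by [].
        exact: subringM.
      by apply: poly_inM => //; apply: poly_inXn.
    - rewrite (leq_trans (size_polyD _ _)) // geq_max size_poly /=.
      rewrite (leq_trans (size_scale_leq _ _)) // (leq_trans (size_polyMleq _ _)) //.
      by rewrite size_polyXn; lia.
    - rewrite hornerD hornerZ hornerM hornerXn horner_poly.
      rewrite [w * p`_ _]mulrC -!mulrA [w * (_ * _)]mulrCA -gE -exprD.
      move: p1; rewrite (horner_coef_wide _ sp) -nE1 big_ord_recr /= => ->.
      by rewrite (_ : n.-1.+1 - m + m'.+1 = n.-1)%N //; lia.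
  by rewrite -{1}nE1 ltnn.
have x0 : x != 0 by apply: contra_notN nAx => /eqP ->; apply: subring0.
have [n Jn nmin] := ex_minnP (Jex _ nAx).
have [m Jm mmin] := ex_minnP (Jex _ nAxV).
have [mn|/ltnW nm] := leqP m n; first exact: (main x n m).
by apply: (main x^-1 m n); rewrite ?invrK ?invr_eq0.
Qed.

End Subrings.

Lemma root_map_polyE (A B : nzRingType) (f : A -> B) (q : {poly A}) x :
  root (map_poly f q) x -> \sum_(i < size q) f q`_i * x ^+ i = 0.
Proof. by move=> /rootP; rewrite horner_poly. Qed.

(** * Integral elements and valuation rings *)

Section IntegralMultiple.
Variable F : fieldExtType rat.

(** If d clears the denominators of the minimal polynomial, of degree n, then d x is a root of the
    monic integer polynomial obtained by multiplying its coefficient of index i by d^(n-i). *)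
Lemma integral_multiple (x : F) : exists2 m : nat, (0 < m)%N & integralZ (m%:R * x).
Proof.
have /polyOver1P[q qE] := minPolyOver 1 x.
have rq : root (map_poly (in_alg F) q) x by rewrite -qE root_minPoly.
have mq : q \is monic by rewrite -(map_monic (in_alg F)) -qE monic_minPoly.
have hq : \sum_(i < size q) (q`_i)%:A * x ^+ i = 0 by exact: (root_map_polyE rq).
have [r [d d0 rE]] := rat_poly_scale q.
have rE' : map_poly intr r = d%:~R *: q :> {poly rat}.
  by rewrite rE scalerA mulfV ?scale1r // intr_eq0.
have sr : size r = size q.
  by rewrite -(size_map_inj_poly (f := intr : int -> rat) (@intr_inj _)) // rE' size_scale // intr_eq0.
have sq : (0 < size q)%N by rewrite lt0n size_poly_eq0 monic_neq0.
set n := (size q).-1; have nE : size q = n.+1 by rewrite /n prednK.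
have rc i : (r`_i)%:~R = d%:~R * q`_i :> rat.
  by rewrite -(coef_map (intr : int -> rat)) rE' coefZ.
have rn : r`_n = d.
  by apply/eqP; rewrite -(eqr_int rat) rc -[q`_n]/(lead_coef q) (monicP mq) mulr1.
have dx : integralZ (d%:~R * x).
  pose P : {poly int} := 'X^n + \poly_(i < n) (r`_i * d ^+ (n - i.+1)).
  exists P.
    by rewrite monicE lead_coefDl ?lead_coefXn // size_polyXn ltnS size_poly.
  rewrite /root rmorphD /= map_polyXn hornerD hornerXn.
  have -> : map_poly (intr : int -> F) (\poly_(i < n) (r`_i * d ^+ (n - i.+1))) =
      \poly_(i < n) (r`_i * d ^+ (n - i.+1))%:~R.
    by apply/polyP => i; rewrite coef_map !coef_poly; case: ifP.
  rewrite horner_poly.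
  have [n0|n0] := posnP n.
    have q1 : q = 1 by rewrite [q]size1_polyC ?nE ?n0 // -[q`_0]/(q`_0%N); congr (_%:P);
      move/monicP: mq; rewrite lead_coefE nE n0.
    by move: rq; rewrite q1 rmorph1 rootC oner_eq0.
  have := congr1 (fun y => d%:~R ^+ n * y) hq.
  rewrite nE mulr0 mulr_sumr big_ord_recr /= => h.
  apply/eqP; apply: etrans h; rewrite addrC; congr (_ + _); last first.
    apply: eq_bigr => i _.
    have lin : (i < n)%N := ltn_ord i.
    rewrite intrM rmorphXn /= exprMn.
    have -> : (r`_i)%:~R = d%:~R * (q`_i)%:A :> F.
      by rewrite -[LHS](rmorph_int (in_alg F)) rc rmorphM rmorph_int.
    have -> : (d%:~R : F) ^+ n = d%:~R * d%:~R ^+ (n - i.+1) * d%:~R ^+ i.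
      by rewrite -exprS -exprD; congr (_ ^+ _); lia.
    by ring.
  rewrite -[q`_n]/(lead_coef q) (monicP mq) /= scale1r mul1r exprMn //.
exists `|d|%N; first by rewrite absz_gt0.
case: (intP d) dx => [|k|k] //; rewrite ?absz0 // ?abszN //= ?mulrNz ?mulNr //.
move=> /(mxpoly.integral_opp (RtoK := intr : {rmorphism int -> F})).
by rewrite opprK.
Qed.

(** If x is not in V, then x^-1 is, and dividing an equation of degree k + 1 by x^k writes x as an
    integer polynomial in x^-1. *)
Lemma valring_integral (V : set F) x : subring V -> (forall y, V y \/ V y^-1) ->
  integralZ x -> V x.
Proof.
move=> sV Vv [p mp rp]; apply: contrapT => nVx.
have Vx : V x^-1 by case: (Vv x).
have x0 : x != 0 by apply: contra_notN nVx => /eqP ->; apply: subring0.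
have sp : (0 < size p)%N by rewrite lt0n size_poly_eq0 monic_neq0.
set n := (size p).-1; have nE : size p = n.+1 by rewrite /n prednK.
apply: nVx; case nn : n => [|k].
  have p1 : p = 1.
    by rewrite [p]size1_polyC ?nE ?nn //; congr (_%:P); move/monicP: mp; rewrite lead_coefE nE nn.
  by move: rp; rewrite p1 rmorph1 rootC oner_eq0.
have := rp; rewrite /root horner_coef size_map_poly_id0; last first.
  by rewrite (monicP mp) rmorph1 oner_neq0.
rewrite nE big_ord_recr /= coef_map /=.
have -> : p`_n = 1 by exact/monicP.
rewrite mul1r nn. rewrite exprS => /eqP/(congr1 (fun y => y * x^-1 ^+ k)).
rewrite mul0r mulrDl -mulrA -exprMn mulfV // expr1n mulr1 mulr_suml => /eqP.
rewrite addrC addr_eq0 => /eqP ->; apply: subringN => //; apply: subring_sum => // i _.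
rewrite coef_map /= -mulrA; apply: subringM => //; first exact: subring_int.
have xV0 : x^-1 != 0 by rewrite invr_eq0.
have ik : (i <= k)%N by rewrite -ltnS; apply: ltn_ord.
by have := exprV_mulX xV0 ik; rewrite invrK => ->; apply: subringX.
Qed.

End IntegralMultiple.

(** * Discreteness and finite residue field *)

Section ValuationRing.
Variables (R : realType) (F : fieldExtType rat) (V : set F) (z : F).
Hypotheses (sV : subring V) (Vval : forall x, V x \/ V x^-1) (nVz : ~ V z).

Let V0 := subring0 sV.
Let V1 := subring1 sV.
Let VM := subringM sV.
Let VB := subringB sV.
Let VX := subringX sV.

Let nz x : ~ V x^-1 -> x != 0.
Proof. by move=> h; apply: contra_notN h => /eqP ->; rewrite invr0. Qed.

(** Either x / (1 - x) or its inverse is in V. The first gives 1 / (1 - x) = 1 + x / (1 - x); the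
    second gives x^-1 = (1 - x) / x + 1, which is excluded. *)
Lemma valring_unit1B x : V x -> ~ V x^-1 -> V (1 - x)^-1.
Proof.
move=> Vx nVx; have x0 := nz nVx.
have x1 : 1 - x != 0.
  by rewrite subr_eq0; apply/eqP => x1; apply: nVx; rewrite -x1 invr1.
case: (Vval (x / (1 - x))) => h.
  rewrite (_ : _^-1 = 1 + x / (1 - x)); first exact: subringD.
  by field.
case: nVx; rewrite (_ : x^-1 = (x / (1 - x))^-1 + 1); first exact: subringD.
by field; rewrite x1.
Qed.

(** If all primes were invertible in V, so would be all positive integers, and z, which has an
    integral multiple, would lie in V. *)
Lemma valring_prime : exists2 p : nat, prime p & ~ V p%:R^-1.
Proof.
apply: contrapT => hno.
have VV (m : nat) : (0 < m)%N -> V m%:R^-1.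
  elim/ltn_ind: m => m IH m0; have [m1|m1] := leqP m 1.
    by rewrite (_ : m = 1%N) ?invr1 //; apply/eqP; rewrite eqn_leq m1.
  have pp := pdiv_prime m1; set p := pdiv m in pp.
  have mE : m = (m %/ p * p)%N by rewrite divnK // pdiv_dvd.
  rewrite mE natrM invfM; apply: VM; last first.
    by apply: contrapT => h; apply: hno; exists p.
  by apply: IH; [rewrite ltn_Pdiv ?prime_gt1|rewrite divn_gt0 ?prime_gt0 // pdiv_leq].
have [m m0 /(valring_integral sV Vval) Vmz] := integral_multiple z.
apply: nVz; rewrite (_ : z = m%:R^-1 * (m%:R * z)); first by apply: VM => //; apply: VV.
by rewrite mulKf // natF_eq0 -lt0n.
Qed.

Section Prime.
Variable p : nat.
Hypotheses (pp : prime p) (nVp : ~ V p%:R^-1).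

Let p0 : (p%:R : F) != 0. Proof. exact: nz. Qed.

(** The first p^[F:Q] + 1 terms contradict [card_mod_prime]. This finiteness yields a generator of
    the maximal ideal, bounds the powers of it that divide p, and makes the residue field finite. *)
Lemma no_incongruent_seq (u : nat -> F) : (forall i, V (u i)) ->
  ~ (forall i j, (i < j)%N -> ~ V ((u j - u i) / p%:R)).
Proof.
move=> Vu inc.
have inj i j : V ((u j - u i) / p%:R) -> i = j.
  case: (ltngtP i j) => // ij h; first by case: (inc _ _ ij).
  case: (inc _ _ ij); rewrite -opprB mulNr; exact: subringN.
have := @card_mod_prime F V V0 VB p (mkseq u (p ^ \dim {:F}).+1) pp.
rewrite size_mkseq ltnn => H; suff : false by []; apply: H.
- by move=> _ /mapP[i _ ->].
- rewrite map_inj_uniq ?iota_uniq // => i j uij; apply: inj.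
  by rewrite uij subrr mul0r.
by move=> _ _ /mapP[i _ ->] /mapP[j _ ->] /inj ->.
Qed.

(* Otherwise some infinite sequence starting at p has strictly decreasing valuations, and its
   terms are pairwise incongruent modulo p. *)
Lemma exists_valring_generator : exists pi : F, [/\ V pi, ~ V pi^-1 &
  forall x, V x -> ~ V x^-1 -> V (x / pi)].
Proof.
apply: contrapT => hno.
have step x : exists y, V x -> ~ V x^-1 -> [/\ V y, ~ V y^-1 & ~ V (y / x)].
  have [[Vx nVx]|h] := pselect (V x /\ ~ V x^-1); last first.
    by exists 0 => Vx nVx; case: h.
  apply: contrapT => h; apply: hno; exists x; split=> // y Vy nVy.
  by apply: contrapT => h'; apply: h; exists y.
have [g Hg] := choice step.
pose u i := iter i g p%:R.
have uP i : V (u i) /\ ~ V (u i)^-1.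
  elim: i => [|i [h1 h2]]; first by split=> //; apply: subring_nat.
  by have [] := Hg _ h1 h2.
have u0 i : u i != 0 by have [_ /nz] := uP i.
have ustep i : ~ V (u i.+1 / u i).
  by have [h1 h2] := uP i; have [] := Hg _ h1 h2.
have uV i : V (u i / u i.+1).
  by have [h|] := Vval (u i.+1 / u i); [case: (ustep i)|rewrite invf_div].
have ulei i k : V (u i / u (i + k)%N).
  elim: k => [|k IH]; first by rewrite addn0 divff.
  rewrite addnS (_ : _ / _ = u i / u (i + k)%N * (u (i + k)%N / u (i + k).+1)); first exact: VM.
  by field; rewrite !u0.
have ult i j : (i < j)%N -> V (u i / u j) /\ ~ V (u j / u i).
  move=> ij; split; first by rewrite -(subnKC (ltnW ij)).
  move=> h; apply: (ustep i).
  rewrite (_ : _ / _ = u i.+1 / u j * (u j / u i)); last by field; rewrite !u0.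
  by apply: VM => //; rewrite -(subnKC ij).
apply: (@no_incongruent_seq (fun i => u i.+1)); first by move=> i; case: (uP i.+1).
move=> i j ij h.
have [Vij nVji] := ult i.+1 j.+1 ij.
(* The difference of two terms is the later one times a unit. If p divided it, p would divide the
   later term, whose valuation is strictly below that of [u 0], which is p; this is why the sequence
   is used from index 1 on. *)
have Vu := valring_unit1B Vij; rewrite invf_div in Vu; have {}Vu := Vu nVji.
have [_ /(_ _)] := ult 0 j.+1 isT; apply.
have i1 : 1 - u i.+1 / u j.+1 != 0.
  apply/eqP => h0; apply: nVji; rewrite -invf_div.
  by move/eqP: h0; rewrite subr_eq0 => /eqP <-; rewrite invr1.
have -> : u j.+1 / u 0 = (u j.+1 - u i.+1) / p%:R * (1 - u i.+1 / u j.+1)^-1.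
  have {}i1 : u j.+1 - u i.+1 != 0.
    by apply: contra i1; rewrite subr_eq0 => /eqP <-; rewrite divff ?subrr.
  by rewrite /u /= -/(u i) -/(u j) -[g (u i)]/(u i.+1) -[g (u j)]/(u j.+1); field; rewrite p0 i1 u0.
exact: VM.
Qed.

Variable pi : F.
Hypotheses (Vpi : V pi) (nVpi : ~ V pi^-1) (pigen : forall x, V x -> ~ V x^-1 -> V (x / pi)).

Let pi0 : pi != 0. Proof. exact: nz. Qed.

Lemma valring_pi_expN k : V (pi ^- k) -> k = 0%N.
Proof.
case: k => // k h; case: nVpi; rewrite (_ : pi^-1 = pi ^- k.+1 * pi ^+ k); first by apply: VM => //; apply: VX.
by rewrite exprS invfM mulfVK // expf_neq0.
Qed.

(** If every power of pi divided p, a congruence between pi^(i+1) and pi^(j+1) with i < j would make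
    pi^(i+2) divide pi^(i+1) times a unit; so the powers of pi would be pairwise incongruent modulo
    p. For general m, factors p are split off by induction, and an m prime to p is not divisible by
    pi, by Bezout. *)
Lemma exists_expn_notin_nat (m : nat) : (0 < m)%N -> exists k, ~ V (m%:R / pi ^+ k).
Proof.
have hp : exists k, ~ V (p%:R / pi ^+ k).
  apply: contrapT => hno.
  have Vk k : V (p%:R / pi ^+ k) by apply: contrapT => h; apply: hno; exists k.
  apply: (@no_incongruent_seq (fun i => pi ^+ i.+1)); first by move=> i; apply: VX.
  move=> i j ij h.
  have Vu : V (1 - pi ^+ (j - i))^-1.
    apply: valring_unit1B; first exact: VX.
    by move=> /valring_pi_expN/eqP; rewrite subn_eq0 leqNgt ij.
  apply: nVpi.
  have u0 : 1 - pi ^+ (j - i) != 0.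
    apply/eqP => /eqP; rewrite subr_eq0 => /eqP e.
    have /valring_pi_expN/eqP : V (pi ^- (j - i)) by rewrite -e invr1.
    by rewrite subn_eq0 leqNgt ij.
  have -> : pi^-1 = - ((pi ^+ j.+1 - pi ^+ i.+1) / p%:R * (1 - pi ^+ (j - i))^-1 * (p%:R / pi ^+ i.+2)).
    rewrite -(subnKC (ltnW ij)) addnC addnK -addnS !exprS exprD exprS.
    by field; rewrite u0 p0 pi0 expf_neq0.
  by apply: subringN => //; apply: VM (VM h Vu) (Vk _).
elim/ltn_ind: m => m IH m0.
have [k0 hk0 k0min] : exists2 k, ~ V (p%:R / pi ^+ k) & forall j, (j < k)%N -> V (p%:R / pi ^+ j).
  have ex : exists k, `[< ~ V (p%:R / pi ^+ k) >] by have [k hk] := hp; exists k; apply/asboolP.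
  case: (ex_minnP ex) => k /asboolP hk kmin; exists k => // j jk.
  by apply: contrapT => h; move: jk; rewrite ltnNge kmin //; apply/asboolP.
have [dp|ndp] := boolP (p %| m)%N.
  case: k0 hk0 k0min => [|k0] hk0 k0min.
    by case: hk0; rewrite expr0 divr1; apply: subring_nat.
  (* k0 is now the exact exponent of pi in p, so x is a unit. *)
  set x := p%:R / pi ^+ k0.
  have Vx : V x by exact: k0min.
  have Vx1 : V x^-1.
    apply: contrapT => nVx; apply: hk0.
    have := pigen Vx nVx; rewrite /x exprSr invfM mulrA //.
  case: (IH (m %/ p)%N) => [||k hk].
  - by rewrite ltn_Pdiv // prime_gt1.
  - by rewrite divn_gt0 ?prime_gt0 // dvdn_leq.
  exists (k0 + k)%N => h; apply: hk.
  rewrite (_ : _ / _ = x^-1 * (m%:R / pi ^+ (k0 + k))); first exact: VM.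
  rewrite -{2}(divnK dp) natrM exprD /x.
  by field; rewrite !expf_neq0 // p0.
exists 1%N => h.
have cop : coprimez p m by rewrite coprimezE !absz_nat prime_coprime.
have [[a b] /= ab] := coprimezP _ _ cop.
apply: nVpi.
have -> : pi^-1 = a%:~R * (p%:R / pi) + b%:~R * (m%:R / pi ^+ 1).
  rewrite expr1 !mulrA -mulrDl [p%:R]pmulrn [m%:R]pmulrn -!intrM -intrD ab; exact/esym/mul1r.
apply: subringD => //; apply: VM => //; try exact: subring_int.
by apply: pigen => //; apply: subring_nat.
Qed.

(** For y in V, an integral multiple m y^-1 shows that y divides m, so the powers of pi dividing y
    are bounded. Once the largest is removed the quotient is a unit, by [pigen]. *)
Lemma valringE x : x != 0 -> exists k : int, V (x / pi ^ k) /\ V (x / pi ^ k)^-1.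
Proof.
have main y : V y -> y != 0 -> exists k : nat, V (y / pi ^+ k) /\ V (y / pi ^+ k)^-1.
  move=> Vy y0.
  have [m m0 /(valring_integral sV Vval) Vm] := integral_multiple y^-1.
  have [l hl] := exists_expn_notin_nat m0.
  have ex : exists k, `[< ~ V (y / pi ^+ k) >].
    exists l; apply/asboolP => h; apply: hl.
    by rewrite (_ : _ / _ = m%:R * y^-1 * (y / pi ^+ l)); [apply: VM|field; rewrite y0 expf_neq0].
  case: (ex_minnP ex) => -[|k] /asboolP hk kmin.
    by case: hk; rewrite expr0 divr1.
  have Vyk : V (y / pi ^+ k).
    by apply: contrapT => h; have := kmin k; rewrite ltnn => /(_ (asboolT h)).
  exists k; split=> //; apply: contrapT => h; apply: hk.
  by have := pigen Vyk h; rewrite exprSr invfM mulrA.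
move=> x0; case: (Vval x) => Vx.
  by have [k hk] := main x Vx x0; exists k.
have [|k [h1 h2]] := main x^-1 Vx; first by rewrite invr_eq0.
exists (- k%:Z).
have e : x / pi ^ (- k%:Z) = (x^-1 / pi ^+ k)^-1.
  by rewrite -invr_expz invfM !invrK.
by rewrite e invrK; split.
Qed.

Lemma valring_pi_exp_le (k : int) : V (pi ^ k) -> 0 <= k.
Proof.
case: k => // k; rewrite NegzE -exprnN => /valring_pi_expN //.
Qed.

Definition valring_ord (x : F) : int := xget 0 [set k : int | V (x / pi ^ k) /\ V (x / pi ^ k)^-1].

Lemma valring_ordP x : x != 0 ->
  V (x / pi ^ valring_ord x) /\ V (x / pi ^ valring_ord x)^-1.
Proof.
move=> x0; rewrite /valring_ord.
by case: xgetP => [k _ //|no]; have [k hk] := valringE x0; case: (no k).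
Qed.

Lemma valring_ord_le x (k : int) : x != 0 -> V (x / pi ^ k) <-> k <= valring_ord x.
Proof.
move=> x0; have [h1 h2] := valring_ordP x0; set l := valring_ord x in h1 h2 *.
have pk (j : int) : pi ^ j != 0 by rewrite expfz_neq0.
have e : pi ^ (l - k) = pi ^ l / pi ^ k by rewrite expfzDr // -invr_expz.
split=> [h|kl].
  rewrite -subr_ge0; apply: valring_pi_exp_le.
  rewrite e (_ : _ / _ = (x / pi ^ l)^-1 * (x / pi ^ k)); first exact: VM.
  by rewrite invf_div mulrA mulfVK.
rewrite (_ : x / _ = x / pi ^ l * (pi ^ l / pi ^ k)); last by rewrite mulrA mulfVK.
apply: VM => //; move: kl; rewrite -e -subr_ge0.
by case: (l - k) => // j _; apply: VX.
Qed.

Lemma valring_ord_ge0 x : x != 0 -> V x <-> 0 <= valring_ord x.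
Proof. by move=> x0; rewrite -valring_ord_le // expr0z divr1. Qed.

Lemma valring_ord_eq x (k : int) : x != 0 -> V (x / pi ^ k) -> V (x / pi ^ k)^-1 ->
  valring_ord x = k.
Proof.
move=> x0 h1 h2; apply/eqP; rewrite eq_le; apply/andP; split; last exact/valring_ord_le.
have [g1 g2] := valring_ordP x0; set l := valring_ord x in g1 g2 *.
rewrite -subr_ge0; apply: valring_pi_exp_le.
have pk (j : int) : pi ^ j != 0 by rewrite expfz_neq0.
have -> : pi ^ (k - l) = (x / pi ^ k)^-1 * (x / pi ^ l).
  by rewrite expfzDr // -invr_expz invf_div mulrA mulfVK.
exact: VM.
Qed.

Lemma valring_ordM x y : x != 0 -> y != 0 ->
  valring_ord (x * y) = valring_ord x + valring_ord y.
Proof.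
move=> x0 y0; apply: valring_ord_eq; first exact: mulf_neq0.
  have [h1 _] := valring_ordP x0; have [g1 _] := valring_ordP y0.
  by rewrite expfzDr // invfM mulrACA; apply: VM.
have [_ h1] := valring_ordP x0; have [_ g1] := valring_ordP y0.
by rewrite expfzDr // [X in _ * X]invfM mulrACA invfM; apply: VM.
Qed.

Lemma valring_ord_pi : valring_ord pi = 1.
Proof. by apply: valring_ord_eq; rewrite // expr1z divff ?invr1. Qed.

Definition cosets : set (set F) := [set [set x + pi * y | y in V] | x in V].

Lemma coset_eq x y : V ((x - y) / pi) ->
  [set x + pi * t | t in V] = [set y + pi * t | t in V].
Proof.
move=> h; apply/seteqP; split=> _ [t Vt <-].
  by exists ((x - y) / pi + t); [apply: subringD|field].
by exists (t - (x - y) / pi); [apply: VB|field].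
Qed.

Lemma coset_inj x y : [set x + pi * t | t in V] = [set y + pi * t | t in V] ->
  V ((x - y) / pi).
Proof.
move=> e; have : [set x + pi * t | t in V] x by exists 0; rewrite ?mulr0 ?addr0.
rewrite e => -[t Vt <-]; by rewrite addrAC subrr add0r mulrAC divff ?mul1r.
Qed.

(** Representatives of infinitely many cosets would be incongruent modulo pi, hence modulo p, which
    pi divides. *)
Lemma finite_cosets : finite_set cosets.
Proof.
apply/finite_setPn => /pcard_leP[g].
have gV i : cosets (g i) by apply: funS.
have /choice[u Hu] i : exists x, V x /\ [set x + pi * t | t in V] = g i.
  by have [x Vx e] := gV i; exists x.
apply: (@no_incongruent_seq u); first by move=> i; case: (Hu i).
move=> i j ij h; have : i = j; last by move=> e; rewrite e ltnn in ij.
suff gij : g i = g j by apply: 'inj_g gij; rewrite inE.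
rewrite -(Hu i).2 -(Hu j).2; apply/esym/coset_eq.
rewrite (_ : _ / _ = (u j - u i) / p%:R * (p%:R / pi)); last by rewrite mulrA mulfVK.
by apply: VM => //; apply: pigen => //; apply: subring_nat.
Qed.

Lemma finite_absval_of_generator : exists N : F -> R,
  finite_absval N /\ forall x, V x <-> N x <= 1.
Proof.
have [q /card_set_bijP[g [gfun ginj gsurj]]] := finite_cosets.
have V1B : cosets [set 1 + pi * t | t in V] by exists 1.
have V0B : cosets [set 0 + pi * t | t in V] by exists 0.
have q1 : (1 < q)%N.
  rewrite ltnNge; apply/negP => ql.
  have gl c : cosets c -> g c = 0%N.
    by move=> /gfun /= h; apply/eqP; rewrite -leqn0 -ltnS; apply: leq_trans ql.
  have : [set 1 + pi * t | t in V] = [set 0 + pi * t | t in V].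
    by apply: ginj; rewrite ?inE // !gl.
  by move=> /coset_inj; rewrite subr0 div1r.
have qR : 1 < q%:R :> R by rewrite ltr1n.
have q0 : q%:R != 0 :> R by rewrite gt_eqF // (lt_trans ltr01).
(* The base q is imposed by [finite_absval]: N pi has to be the inverse of the number of cosets. *)
pose N (x : F) : R := if x == 0 then 0 else q%:R ^ (- valring_ord x).
have NV x : V x <-> N x <= 1.
  rewrite /N; have [->|x0] := eqVneq x 0; first by split.
  by rewrite valring_ord_ge0 // -oppr_le0 -(ler_eXz2l qR) expr0z.
have N_ge0 x : 0 <= N x.
  by rewrite /N; case: ifP => // _; rewrite exprz_ge0.
have ultraN x y : N (x + y) <= Num.max (N x) (N y).
  have [xy0|xy0] := eqVneq (x + y) 0; first by rewrite /N xy0 eqxx le_max N_ge0.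
  have [x0|x0] := eqVneq x 0; first by rewrite x0 add0r le_max lexx orbT.
  have [y0|y0] := eqVneq y 0; first by rewrite y0 addr0 le_max lexx.
  have key k : k <= valring_ord x -> k <= valring_ord y -> k <= valring_ord (x + y).
    rewrite -!valring_ord_le // => hx hy; rewrite mulrDl; exact: subringD.
  rewrite /N (negbTE xy0) (negbTE x0) (negbTE y0) le_max !ler_eXz2l // !lerN2.
  have [xy|/ltW yx] := leP (valring_ord x) (valring_ord y).
    by rewrite key.
  by rewrite (key (valring_ord y)) ?orbT.
have absN : is_absval N.
  split=> //.
  - move=> x; rewrite /N; have [->|x0] := eqVneq x 0; first by split.
    by split=> [/eqP|/eqP]; rewrite ?expfz_eq0 ?(negbTE q0) ?andbF // (negbTE x0).
  - move=> x y; rewrite /N mulf_eq0.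
    have [->|x0] := eqVneq x 0; first by rewrite ?eqxx /= mul0r.
    have [->|y0] := eqVneq y 0; first by rewrite ?eqxx ?orbT mulr0.
    by rewrite /= valring_ordM // opprD expfzDr.
  - by exists 1 => x y; rewrite mul1r.
have NVs : valring N = V by apply/seteqP; split=> x; rewrite /valring /= NV.
exists N; split=> //; split=> //.
exists pi, q; split.
- split=> //.
  + by rewrite /N (negbTE pi0) valring_ord_pi -invr_expz expr1z invf_lt1 // (lt_trans ltr01).
  + move=> x Nx; rewrite NVs; have [->|x0] := eqVneq x 0.
      by exists 0; rewrite ?mulr0.
    exists (x / pi); last by rewrite mulrC divfK.
    apply: pigen; first exact/NV/ltW.
    move/NV; rewrite leNgt => /negP; apply.
    by rewrite (absvalV absN) invf_gt1 // (absval_gt0 absN).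
- by rewrite /residues NVs; apply/card_set_bijP; exists g.
- by rewrite /N (negbTE pi0) valring_ord_pi -invr_expz expr1z.
Qed.

End Prime.

Lemma finite_absval_of_valring : exists N : F -> R,
  finite_absval N /\ forall x, V x <-> N x <= 1.
Proof.
have [p pp nVp] := valring_prime.
have [pi [Vpi nVpi pigen]] := exists_valring_generator pp nVp.
exact: finite_absval_of_generator pp nVp _ Vpi nVpi pigen.
Qed.

End ValuationRing.

(** The converse of [ultra_root]: integrality over the integers can be tested at the finite
    places. *)
Lemma exists_place_gt1 (R : realType) (F : fieldExtType rat) (z : F) : ~ integralZ z ->
  exists2 v : place R F, finite_absval v & 1 < v z.
Proof.
move=> /exists_valring[V [sV _ nVz Vval]].
have [N [fN NV]] := finite_absval_of_valring R sV Vval nVz.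
exists (Place (Or31 _ _ fN)) => //=.
by rewrite ltNge; apply/negP => /NV.
Qed.

(* The ball N <= A is covered by k pieces of diameter at most l; c x is the index of the piece
   containing x. *)
Definition net (R : realType) (K : fieldType) (N : K -> R) (A l : R) (k : nat) :=
  exists c : K -> nat, (forall x, N x <= A -> (c x < k)%N) /\
    forall x y, N x <= A -> N y <= A -> c x = c y -> N (x - y) <= l.

(** * Digit expansions at a finite place *)

Section FiniteAbsval.
Variables (R : realType) (F : fieldType) (N : F -> R).
Hypotheses (hN : is_absval N) (ultra : forall x y, N (x + y) <= Num.max (N x) (N y)).

Section Uniformizer.
Variables (p : F) (q : nat).
Hypotheses (up : uniformizer N p) (rq : residues N p #= `I_q) (Np : N p = q%:R^-1).

Let p0 : p != 0. Proof. by case: up. Qed.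
Let Np1 : N p < 1. Proof. by case: up. Qed.
Let Np0 : 0 < N p. Proof. by rewrite absval_gt0. Qed.

Let q_gt1 : (1 < q)%N.
Proof.
by move: Np1 Np0; rewrite Np; case: (q) => [|[|m]] //; rewrite ?invr0 ?ltxx // invr1 ltxx.
Qed.

Lemma uniformizer_le x : N x < 1 -> N x <= N p.
Proof.
case: up => _ _ H /H[y Vy ->]; rewrite (absvalM hN) ler_piMr // ltW //.
Qed.

(** For the largest k with [N y <= N p ^+ k], the value of y / p^k is above N p and at most 1, where
    [uniformizer_le] leaves only 1. *)
Lemma uniformizer_expn y : y != 0 -> N y <= 1 -> exists k : nat, N y = N p ^+ k.
Proof.
move=> y0 Ny; have Ny0 : 0 < N y by rewrite absval_gt0.
have [m Hm] := expr_lt_eps (ltW Np0) Np1 Ny0.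
have ex : exists k, N p ^+ k < N y by exists m; apply: Hm.
case: (ex_minnP ex) => -[|k] hk kmin; first by move: hk; rewrite expr0 ltNge Ny.
have Nyk : N y <= N p ^+ k by rewrite leNgt; apply/negP => /kmin; rewrite ltnn.
exists k; apply/eqP; rewrite eq_le Nyk /= leNgt; apply/negP => lt.
have e : N (y / p ^+ k) = N y / N p ^+ k by rewrite (absval_div hN) absvalX.
have : N (y / p ^+ k) <= N p.
  by apply: uniformizer_le; rewrite e ltr_pdivrMr ?exprn_gt0 // mul1r.
by rewrite e ler_pdivrMr ?exprn_gt0 // -exprS leNgt hk.
Qed.

Lemma uniformizer_exp x : x != 0 -> exists k : int, N x = N p ^ k.
Proof.
move=> x0; have [Nx|/ltW Nx] := leP (N x) 1.
  by have [k ->] := uniformizer_expn x0 Nx; exists k.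
have [||k hk] := @uniformizer_expn x^-1; first by rewrite invr_eq0.
  by rewrite absvalV // invf_le1 // absval_gt0.
by exists (- k%:Z); rewrite -invr_expz -exprnP -hk absvalV // invrK.
Qed.

Lemma residue_digits : exists r : nat -> F, [/\ forall i, N (r i) <= 1,
  forall i j, (i < q)%N -> (j < q)%N -> N (r i - r j) <= N p -> i = j &
  forall x, N x <= 1 -> exists2 i, (i < q)%N & N (x - r i) <= N p].
Proof.
have /card_set_bijP[g [gfun ginj gsurj]] := rq.
have /choice[r Hr] i : exists x, N x <= 1 /\
    ((i < q)%N -> g [set x + p * y | y in valring N] = i).
  (* The representative 0 beyond q keeps [N (r i) <= 1] valid for all i. *)
  have [iq|qi] := boolP (i < q)%N; last by exists 0; rewrite absval0.
  have [_ [x Vx <-] gi] := gsurj i iq; by exists x.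
have cin x : N x <= 1 -> residues N p [set x + p * y | y in valring N] by exists x.
have ceq x y : [set x + p * t | t in valring N] = [set y + p * t | t in valring N] <->
    N (x - y) <= N p.
  have coset_sub a b : N (a - b) <= N p ->
      [set a + p * t | t in valring N] `<=` [set b + p * t | t in valring N].
    move=> ab _ [t Vt <-]; exists ((a - b) / p + t); last by field.
    rewrite /valring /= (le_trans (ultra _ _)) // ge_max; apply/andP; split=> //.
    by rewrite (absval_div hN) ler_pdivrMr // mul1r.
  split=> [e|h].
    have : [set x + p * t | t in valring N] x.
      by exists 0; rewrite ?mulr0 ?addr0 // /valring /= absval0.
    rewrite e => -[t Vt <-].
    by rewrite addrAC subrr add0r (absvalM hN) ler_piMr // ltW.
  by apply/seteqP; split; apply: coset_sub; rewrite // absvalB.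
exists r; split.
- by move=> i; case: (Hr i).
- move=> i j iq jq /ceq e; have [_ /(_ iq) <-] := Hr i; have [_ /(_ jq) <-] := Hr j.
  by rewrite e.
move=> x Nx; have := gfun _ (cin x Nx); set i := g _ => iq; exists i => //.
apply/ceq; apply: ginj; rewrite ?inE; [exact: cin| |].
  by apply: cin; case: (Hr i).
by have [_ /(_ iq) ->] := Hr i.
Qed.

(** Truncated p-adic expansions: the base-q digits of the index select the residues, its lowest
    digit giving the constant term. *)
Lemma residue_expansion n : exists r : nat -> F, [/\ forall i, N (r i) <= 1,
  forall i j, (i < q ^ n)%N -> (j < q ^ n)%N -> N (r i - r j) <= N p ^+ n -> i = j &
  forall x, N x <= 1 -> exists2 i, (i < q ^ n)%N & N (x - r i) <= N p ^+ n].
Proof.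
have q0 : (0 < q)%N by apply: ltnW.
have [r [r1 rinj rsurj]] := residue_digits.
elim: n => [|n [s [s1 sinj ssurj]]].
  exists (fun=> 0); split; rewrite ?absval0 ?expn0 //.
  - by move=> [|i] [|j].
  - by move=> x Nx; exists 0%N; rewrite // subr0 expr0.
exists (fun i => r (i %% q)%N + p * s (i %/ q)%N); split.
- move=> i; rewrite (le_trans (ultra _ _)) // ge_max r1 /= (absvalM hN).
  by rewrite mulr_ile1 ?(absval_ge0 hN) // ltW.
- move=> i j iq jq; rewrite opprD addrACA -mulrBr exprS => h.
  have e : (i %% q = j %% q)%N.
    apply: rinj; rewrite ?ltn_mod //.
    rewrite -[_ - _](addrK (p * (s (i %/ q)%N - s (j %/ q)%N))).
    rewrite (le_trans (ultraB hN ultra _ _)) // ge_max; apply/andP; split.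
      by rewrite (le_trans h) // ler_piMr ?exprn_ile1 // ltW.
    rewrite (absvalM hN) ler_piMr ?(ltW Np0) //.
    by rewrite (le_trans (ultraB hN ultra _ _)) // ge_max !s1.
  rewrite (divn_eq i q) (divn_eq j q) e; congr (_ * _ + _)%N.
  apply: sinj; rewrite ?ltn_divLR // -?expnSr //.
  by move: h; rewrite e subrr add0r (absvalM hN) ler_pM2l.
move=> x Nx; have [i iq hi] := rsurj x Nx.
have [|j jq hj] := ssurj ((x - r i) / p).
  by rewrite (absval_div hN) ler_pdivrMr // mul1r.
exists (i + j * q)%N.
  by rewrite expnSr -ltn_divLR // addnC divnMDl // divn_small // addn0.
rewrite addnC modnMDl modn_small // divnMDl // divn_small // addn0.
rewrite (_ : x - _ = p * ((x - r i) / p - s j)); last by field.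
by rewrite (absvalM hN) exprS ler_pM2l.
Qed.

Lemma finite_net n : net N 1 (N p ^+ n) (q ^ n).
Proof.
have [r [r1 _ rsurj]] := residue_expansion n.
have /choice[c Hc] x : exists i, N x <= 1 -> (i < q ^ n)%N /\ N (x - r i) <= N p ^+ n.
  have [Nx|nx] := boolP (N x <= 1); last by exists 0%N.
  by have [i iq hi] := rsurj x Nx; exists i.
exists c; split=> [x /Hc[]//|x y /Hc[_ hx] /Hc[_ hy] e].
rewrite (_ : x - y = (x - r (c x)) - (y - r (c y))); last by rewrite e; ring.
by rewrite (le_trans (ultraB hN ultra _ _)) // ge_max hx.
Qed.

End Uniformizer.
End FiniteAbsval.

(** * Independence of the finite places *)

Section FinitePlaces.
Variables (R : realType) (F : fieldType).
Implicit Types v w : place R F.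

Lemma place_eq v w : place_abs v =1 place_abs w -> v = w.
Proof.
case: v w => [N hN] [M hM] /= /funext e; move: hN; rewrite e => hN.
by rewrite (Prop_irrelevance hN hM).
Qed.

(** If v x = 1 and w x > 1, a large power of x times p would contradict the inclusion; so v = 1
    implies w = 1, and w x depends only on the exponent of v x. Writing v s = (v p)^k and w p = (w
    s)^j gives j k = 1, with j > 0 as w p < 1. Both places then have the same valuation ring and the
    same cosets, thus the same q. *)
Lemma finite_place_le1 v w : finite_absval v -> finite_absval w ->
  (forall x, v x < 1 -> w x < 1) -> v = w.
Proof.
move=> [hv uv [p [q [up rq vp]]]] [hw uw [s [t [us rt ws]]]] vw.
have [p0 vp1 _] := up; have [s0 ws1 _] := us.
have wp0 : 0 < w p by rewrite absval_gt0.
have wp1 : w p < 1 := vw _ vp1.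
have vp0 : 0 < v p by rewrite absval_gt0.
have w_le1 x : v x = 1 -> w x <= 1.
  move=> vx; rewrite leNgt; apply/negP => wx.
  have [k Hk] := expr_gt_bound (w p)^-1 wx.
  have : w (x ^+ k * p) < 1 by apply: vw; rewrite (absvalM hv) absvalX // vx expr1n mul1r.
  rewrite (absvalM hw) absvalX // -ltr_pdivlMr // div1r ltNge ltW //; exact: Hk.
have w_eq1 x : v x = 1 -> w x = 1.
  move=> vx; apply/eqP; rewrite eq_le w_le1 //=.
  have := @w_le1 x^-1; rewrite absvalV // vx invr1 absvalV // => /(_ erefl).
  rewrite invf_le1 // absval_gt0 //; apply/eqP => x0.
  by move: vx; rewrite x0 absval0 // => /eqP; rewrite eq_sym oner_eq0.
have wE x (k : int) : x != 0 -> v x = v p ^ k -> w x = w p ^ k.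
  move=> x0 vx; have : v (x / p ^ k) = 1.
    by rewrite absval_div // absvalZ // vx divff // expfz_neq0 // gt_eqF.
  move/w_eq1; rewrite absval_div // absvalZ // => /(canRL (divfK _)).
  by rewrite expfz_neq0 ?gt_eqF // mul1r; apply.
have [k vs] := uniformizer_exp hv up s0.
have [j wpj] := uniformizer_exp hw us p0.
have ws0 : 0 < w s by rewrite absval_gt0.
have kj : j * k = 1.
  have := wE _ _ s0 vs; rewrite wpj exprz_exp => h.
  apply: (@ieexprIz _ (w s)); rewrite ?expr1z ?ws0 ?lt_eqF //.
have j1 : j = 1.
  have : 0 < j.
    rewrite ltNge; apply/negP => j0; move: wp1; rewrite wpj ltNge => /negP; apply.
    rewrite -[leLHS](expr0z (w s)).
    case: j j0 {kj wpj} => // [[|j]|j] //; rewrite ?expr0z // => _.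
    by rewrite NegzE -exprnN invf_ge1 ?exprn_gt0 // exprn_ile1 // ltW.
  move=> j0; have /eqP := congr1 absz kj; rewrite abszM muln_eq1 => /andP[/eqP j1 _].
  by rewrite -(gez0_abs (ltW j0)) j1.
have k1 : k = 1 by move: kj; rewrite j1 mul1r.
rewrite j1 expr1z in wpj; rewrite k1 expr1z in vs.
have wlt x : w x < 1 -> v x < 1.
  move=> wx; have [->|x0] := eqVneq x 0; first by rewrite absval0.
  have [l vx] := uniformizer_exp hv up x0; rewrite vx.
  move: wx; rewrite (wE _ _ x0 vx).
  case: l {vx} => [[|l]|l].
  - by rewrite !expr0z ltxx.
  - by rewrite -!exprnP => _; rewrite exprn_ilt1 // ltW.
  by rewrite NegzE -!exprnN invf_lt1 ?exprn_gt0 // ltNge exprn_ile1 // ltW.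
have eV : valring v = valring w.
  have vw1 (x : F) : x != 0 -> (v x <= 1) = (w x <= 1).
    move=> x0; apply/idP/idP; rewrite !leNgt; apply: contra => h.
      by rewrite -invf_lt1 -?absvalV ?absval_gt0 // wlt // absvalV // invf_lt1 // absval_gt0.
    by rewrite -invf_lt1 -?absvalV ?absval_gt0 // vw // absvalV // invf_lt1 // absval_gt0.
  apply/seteqP; split=> x; rewrite /valring /=;
   have [->|x0] := eqVneq x 0; rewrite ?absval0 ?ler01 // vw1 //.
have eR : residues v p = residues w s.
  have coset x : [set x + p * y | y in valring v] = [set x + s * y | y in valring w].
    rewrite eV; have wsp : w (s / p) = 1 by rewrite absval_div // wpj divff // gt_eqF.
    apply/seteqP; split=> _ [y Vy <-].
      exists (y / (s / p)); last by field; rewrite p0 s0.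
      by rewrite /valring /= absval_div // wsp divr1.
    exists (y * (s / p)); last by field.
    by rewrite /valring /= (absvalM hw) wsp mulr1.
  by apply/seteqP; split=> _ [x Vx <-]; rewrite ?coset -?coset; exists x;
    rewrite ?coset // ?eV // -eV.
have qt : q = t.
  apply/card_eq_II; apply: card_eq_trans rt; rewrite -eR; exact: card_esym.
have vwp : v p = w p by rewrite vp wpj ws qt.
apply: place_eq => x; have [->|x0] := eqVneq x 0; first by rewrite !absval0.
have [l vx] := uniformizer_exp hv up x0.
by rewrite (wE _ _ x0 vx) -vwp.
Qed.

End FinitePlaces.

Lemma eventually_all (T : eqType) (s : seq T) (P : T -> nat -> Prop) :
  (forall t, t \in s -> exists K, forall k, (K <= k)%N -> P t k) ->
  exists K, forall t, t \in s -> forall k, (K <= k)%N -> P t k.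
Proof.
elim: s => [|t s IH] H; first by exists 0%N.
have [K1 H1] := H t (mem_head _ _).
have [|K2 H2] := IH; first by move=> u us; apply: H; rewrite inE us orbT.
exists (maxn K1 K2) => u; rewrite inE => /predU1P[->|us] k; rewrite geq_max => /andP[k1 k2].
  exact: H1.
exact: H2.
Qed.

(** * Weak approximation at finite places *)

Section Approximation.
Variables (R : realType) (F : fieldType).
Implicit Types (v w : place R F) (S : seq (place R F)).

Lemma exists_separating v w : finite_absval v -> finite_absval w -> v != w ->
  exists x, v x < 1 /\ 1 < w x.
Proof.
move=> fv fw vw.
have half (u t : place R F) : finite_absval u -> finite_absval t -> u != t ->
    exists x, u x < 1 /\ 1 <= t x.
  move=> fu ft /eqP ut; apply: contrapT => hno; apply: ut; apply: finite_place_le1 => // x ux.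
  by rewrite ltNge; apply/negP => tx; apply: hno; exists x.
have [x [vx wx]] := half v w fv fw vw.
have [|y [wy vy]] := half w v fw fv; first by rewrite eq_sym.
have hv : is_absval v by case: fv.
have hw : is_absval w by case: fw.
have y0 : y != 0 by rewrite -(absval_gt0 hv) (lt_le_trans ltr01).
exists (x / y); rewrite !absval_div //; split.
  by rewrite ltr_pdivrMr ?absval_gt0 // mul1r (lt_le_trans vx).
by rewrite ltr_pdivlMr ?absval_gt0 // mul1r (lt_le_trans wy).
Qed.

(* Artin-Whaples: y^k / (1 + y^k) tends to 1 at the places where |y| > 1 and to 0 at those where
   |y| < 1. *)
Lemma exists_dominant v S : finite_absval v -> (forall w, w \in S -> finite_absval w) ->
  v \notin S -> exists y, 1 < v y /\ forall w, w \in S -> w y < 1.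
Proof.
move=> fv; have hv : is_absval v by case: fv.
have uv : forall x y, v (x + y) <= Num.max (v x) (v y) by case: fv.
elim: S => [|u S IH] fS nvS.
  have [_ _ [p [q [[p0 vp _] _ _]]]] := fv.
  exists p^-1; split=> //; by rewrite absvalV // invf_gt1 // absval_gt0.
move: nvS; rewrite inE negb_or => /andP[vu nvS].
have fu : finite_absval u by apply: fS; rewrite mem_head.
have hu : is_absval u by case: fu.
have uu : forall x y, u (x + y) <= Num.max (u x) (u y) by case: fu.
have {}fS w : w \in S -> finite_absval w by move=> wS; apply: fS; rewrite inE wS orbT.
have [y [vy Sy]] := IH fS nvS.
have [s [us vs]] := exists_separating fu fv (contra_neq (fun e => esym e) vu).
have s0 : s != 0 by rewrite -(absval_gt0 hv) (lt_trans ltr01).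
have hS w : w \in S -> is_absval w by move=> /fS[].
have evS : exists K, forall w, w \in S -> forall k, (K <= k)%N -> w s * w y ^+ k < 1.
  apply: (@eventually_all _ S (fun w k => w s * w y ^+ k < 1)) => w wS.
  have hw := hS w wS; have ws : 0 < w s by rewrite absval_gt0.
  have [|K HK] := @expr_lt_eps R (w y) (w s)^-1 (absval_ge0 hw y) (Sy w wS).
    by rewrite invr_gt0.
  by exists K => k /HK; rewrite -ltr_pdivlMl // mulr1.
have [K HK] := evS.
(* s separates the new place u from v, while y handles the others. If [u y > 1], powers of y would
   spoil the smallness of s at u, so y^K' is replaced by y^K' / (1 + y^K'), of value exactly 1 at u
   and at v. *)
have [uy|uy] := leP (u y) 1.
  exists (s * y ^+ K); split.
    rewrite (absvalM hv) absvalX // (lt_le_trans vs) // ler_peMr ?(ltW (lt_trans ltr01 vs)) //.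
    by rewrite exprn_ege1 // ltW.
  move=> w; rewrite inE => /predU1P[->|wS].
    rewrite (absvalM hu) absvalX // (le_lt_trans _ us) // ler_piMr ?(absval_ge0 hu) //.
    by rewrite exprn_ile1 // (absval_ge0 hu).
  by have hw := hS w wS; rewrite (absvalM hw) absvalX // HK.
pose K' := K.+1.
have big (w : place R F) : finite_absval w -> 1 < w y -> w (y ^+ K' / (1 + y ^+ K')) = 1.
  move=> [hw uw _] wy; have wyK : 1 < w (y ^+ K') by rewrite absvalX // exprn_egt1.
  have yK0 : 0 < w (y ^+ K') by rewrite (lt_trans ltr01).
  by rewrite absval_div // (ultra_eq hw uw) ?absval1 // divff // gt_eqF.
exists (s * (y ^+ K' / (1 + y ^+ K'))); split.
  by rewrite (absvalM hv) (big v) // mulr1.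
move=> w; rewrite inE => /predU1P[->|wS].
  by rewrite (absvalM hu) (big u) // mulr1.
have [hw uw _] := fS w wS.
rewrite (absvalM hw) absval_div // addrC (ultra_eq hw uw) absval1 //.
  by rewrite divr1 absvalX // HK.
by rewrite absvalX // exprn_ilt1 // ?(absval_ge0 hw) // Sy.
Qed.

Lemma exists_approx_delta v S : finite_absval v -> (forall w, w \in S -> finite_absval w) ->
  v \notin S -> exists e : nat -> F, forall d : R, 0 < d -> exists K, forall k, (K <= k)%N ->
    v (e k - 1) < d /\ forall w, w \in S -> w (e k) < d.
Proof.
move=> fv fS nvS; have [y [vy Sy]] := exists_dominant fv fS nvS.
have [hv uv _] := fv.
exists (fun k => y ^+ k.+1 / (1 + y ^+ k.+1)) => d d0.
have [K1 HK1] := @expr_gt_bound R (v y) d^-1 vy.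
have [K2 HK2] : exists K, forall w, w \in S -> forall k, (K <= k)%N -> w y ^+ k < d.
  apply: (@eventually_all _ S (fun w k => w y ^+ k < d)) => w wS.
  have [hw _ _] := fS w wS.
  exact: (@expr_lt_eps R (w y) d (absval_ge0 hw y) (Sy w wS)).
exists (maxn K1 K2) => k; rewrite geq_max => /andP[k1 k2]; split.
  have vyk : 1 < v (y ^+ k.+1) by rewrite absvalX // exprn_egt1.
  have e1 : v (1 + y ^+ k.+1) = v y ^+ k.+1.
    by rewrite (ultra_eq hv uv) ?absval1 // absvalX.
  have n0 : 1 + y ^+ k.+1 != 0.
    by rewrite -(absval_gt0 hv) e1 exprn_gt0 // (lt_trans ltr01).
  rewrite (_ : _ - 1 = - (1 + y ^+ k.+1)^-1); last by field.
  rewrite absvalN // absvalV // e1 -[d]invrK ltf_pV2 ?posrE ?invr_gt0 ?exprn_gt0 ?(lt_trans ltr01 vy) //.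
  by apply: HK1; rewrite (leq_trans k1).
move=> w wS; have [hw uw _] := fS w wS.
rewrite absval_div // addrC (ultra_eq hw uw) absval1 // ?divr1 ?absvalX //.
  by apply: HK2 => //; rewrite (leq_trans k2).
by rewrite exprn_ilt1 // ?(absval_ge0 hw) // Sy.
Qed.

End Approximation.

(** * Finiteness of the places where an element is not a unit *)

Section IndexBound.
Variables (R : realType) (F : fieldExtType rat).
Implicit Types (v w : place R F) (S : seq (place R F)).

Lemma finite_value_nat v x : finite_absval v -> x != 0 -> v x <= 1 ->
  exists k : nat, exists2 r : nat -> F, k%:R = (v x)^-1 &
   (forall i, v (r i) <= 1) /\
   forall i j, (i < k)%N -> (j < k)%N -> v (r i - r j) <= v x -> i = j.
Proof.
move=> [hv uv [p [q [up rq vp]]]] x0 vx.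
have [k xk] := uniformizer_expn hv up x0 vx.
have [r [r1 rinj _]] := residue_expansion hv uv up rq vp k.
exists (q ^ k)%N; exists r; first by rewrite xk vp exprVn invrK natrX.
by split=> // i j ik jk; rewrite xk; apply: rinj.
Qed.

(* Weak approximation combines representatives of the residues modulo x at each place of S; for
   x = p prime this bounds the sum of the local degrees above p by [F:Q]. *)
Lemma incongruent_family (x : F) S : x != 0 -> uniq S ->
  (forall v, v \in S -> finite_absval v /\ v x <= 1) ->
  exists X : seq F, [/\ uniq X, (size X)%:R = \prod_(v <- S) (v x)^-1,
    forall t v, t \in X -> v \in S -> v t <= 1 &
    forall s t, s \in X -> t \in X -> (forall v, v \in S -> v (s - t) <= v x) -> s = t].
Proof.
move=> x0; elim: S => [_ _|v S IH /= /andP[nvS uS] fS].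
  exists [:: 0]; rewrite big_nil; split=> // [s t]; rewrite !inE => /eqP -> /eqP -> //.
have [fv vx] := fS v (mem_head _ _).
have {}fS w : w \in S -> finite_absval w /\ w x <= 1.
  by move=> wS; apply: fS; rewrite inE wS orbT.
have [X [uX sX X1 Xinj]] := IH uS fS.
have [k [r kE [r1 rinj]]] := finite_value_nat fv x0 vx.
have [e He] := @exists_approx_delta R F v S fv (fun w wS => (fS w wS).1) nvS.
have [hv uv _] := fv.
pose pairs := [seq (t, i) | t <- X, i <- iota 0 k].
(* As e n tends to 1 at v and to 0 on S, t + e n (r i - t) tends to r i at v and to t on S. *)
pose good (ti : F * nat) n := v (ti.1 + e n * (r ti.2 - ti.1) - r ti.2) <= v x /\
   forall w, w \in S -> w (ti.1 + e n * (r ti.2 - ti.1) - ti.1) <= w x.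
have [K HK] : exists K, forall ti, ti \in pairs -> forall n, (K <= n)%N -> good ti n.
  apply: eventually_all => -[t i] _; rewrite /good /=.
  have [K1 HK1] : exists K, forall n, (K <= n)%N -> v ((e n - 1) * (r i - t)) <= v x.
    have [d0|d0] := eqVneq (r i - t) 0.
      by exists 0%N => n _; rewrite d0 mulr0 absval0 // (absval_ge0 hv).
    have [|K H] := He (v x / v (r i - t)); first by rewrite divr_gt0 ?absval_gt0.
    by exists K => n /H[h _]; rewrite (absvalM hv) -ler_pdivlMr ?absval_gt0 // ltW.
  have [K2 HK2] : exists K, forall w, w \in S -> forall n, (K <= n)%N -> w (e n * (r i - t)) <= w x.
    apply: (@eventually_all _ S (fun w n => w (e n * (r i - t)) <= w x)) => w wS.
    have [[hw _ _] _] := fS w wS.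
    have [d0|d0] := eqVneq (r i - t) 0.
      by exists 0%N => n _; rewrite d0 mulr0 absval0 // (absval_ge0 hw).
    have [|K H] := He (w x / w (r i - t)); first by rewrite divr_gt0 ?absval_gt0.
    by exists K => n /H[_ h]; rewrite (absvalM hw) -ler_pdivlMr ?absval_gt0 // ltW // h.
  exists (maxn K1 K2) => n; rewrite geq_max => /andP[n1 n2]; split.
    by rewrite (_ : _ - _ = (e n - 1) * (r i - t)); [apply: HK1|ring].
  by move=> w wS; rewrite (_ : _ - _ = e n * (r i - t)); [apply: HK2|ring].
pose h (ti : F * nat) := ti.1 + e K * (r ti.2 - ti.1).
have hv' ti : ti \in pairs -> v (h ti - r ti.2) <= v x.
  by move=> /HK/(_ _ (leqnn _))[].
have hw' ti w : ti \in pairs -> w \in S -> w (h ti - ti.1) <= w x.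
  by move=> /HK/(_ _ (leqnn _))[_]; apply.
have ultra3 (w : place R F) a b c d B : finite_absval w -> w (a - b) <= B -> w (c - d) <= B -> w (a - c) <= B ->
    w (b - d) <= B.
  move=> [hw uw _] h1 h2 h3; rewrite (_ : b - d = (c - d) + ((a - c) - (a - b))); last by ring.
  rewrite (le_trans (uw _ _)) // ge_max h2 /= (le_trans (ultraB hw uw _ _)) //.
  by rewrite ge_max h3.
have hinj ti sj : ti \in pairs -> sj \in pairs ->
    (forall w, w \in v :: S -> w (h ti - h sj) <= w x) -> ti = sj.
  move=> tiP sjP Hc.
  have : ti.1 = sj.1 /\ ti.2 = sj.2.
    have [[t1 t2] [s1 s2]] : (ti.1 \in X /\ (ti.2 < k)%N) /\ (sj.1 \in X /\ (sj.2 < k)%N).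
      move: tiP sjP => /allpairsP[[a b] /= [aX + ->]] /allpairsP[[c d] /= [cX + ->]] /=.
      by rewrite !mem_iota.
    split.
      apply: Xinj => // w wS; apply: (ultra3 w (h ti) _ (h sj)) => //.
      - by case: (fS w wS).
      - exact: hw'.
      - exact: hw'.
      by apply: Hc; rewrite inE wS orbT.
    apply: rinj => //; apply: (ultra3 v (h ti) _ (h sj)) => //.
    - exact: hv'.
    - exact: hv'.
    by apply: Hc; rewrite mem_head.
  by case: ti {tiP Hc} => ? ?; case: sj {sjP} => ? ? /= [-> ->].
exists (map h pairs); split.
- rewrite map_inj_in_uniq; first by apply: allpairs_uniq; rewrite ?iota_uniq // => -[? ?] [? ?] _ _ [-> ->].
  move=> ti sj tiP sjP e'; apply: hinj => // w; rewrite e' subrr inE => /predU1P[->|wS].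
    by rewrite absval0 // (absval_ge0 hv).
  by have [[hw _ _] _] := fS w wS; rewrite absval0 // (absval_ge0 hw).
- by rewrite size_map size_allpairs size_iota natrM sX kE big_cons mulrC.
- move=> _ w /mapP[ti tiP ->]; have t2 : ti.1 \in X.
    by move: tiP => /allpairsP[[a b] /= [aX _ ->]].
  rewrite inE => /predU1P[->|wS].
    rewrite -(subrK (r ti.2) (h ti)) (le_trans (uv _ _)) // ge_max r1 andbT.
    by rewrite (le_trans (hv' _ tiP)).
  have [[hw uw _] wx] := fS w wS.
  rewrite -(subrK ti.1 (h ti)) (le_trans (uw _ _)) // ge_max (X1 ti.1) // andbT.
  by rewrite (le_trans (hw' _ _ tiP wS)).
- by move=> _ _ /mapP[ti tiP ->] /mapP[sj sjP ->] H; rewrite (hinj ti sj).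
Qed.

Lemma prod_finite_prime (p : nat) S : prime p -> uniq S ->
  (forall v, v \in S -> finite_absval v) ->
  \prod_(v <- S) (v p%:R)^-1 <= p%:R ^+ \dim {:F}.
Proof.
move=> pp uS fS; have p0 : (p%:R : F) != 0 by rewrite natF_eq0 -lt0n prime_gt0.
have [|X [uX <- X1 Xinj]] := @incongruent_family p%:R S p0 uS.
  by move=> v /fS [hv uv h]; split=> //; apply: ultra_nat.
rewrite -natrX ler_nat.
apply: (@card_mod_prime F (fun x => forall v, v \in S -> v x <= 1)) => //.
- by move=> v /fS[hv _ _]; rewrite absval0 // ler01.
- move=> x y hx hy v vS; have [hv uv _] := fS v vS.
  by rewrite (le_trans (ultraB hv uv _ _)) // ge_max hx ?hy.
- by move=> x xX v vS; apply: X1.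
move=> x y xX yX H; apply: Xinj => // v vS; have [hv uv _] := fS v vS.
by have := H v vS; rewrite absval_div // ler_pdivrMr ?absval_gt0 // mul1r.
Qed.

Lemma prod_finite_nat (m : nat) S : (0 < m)%N -> uniq S ->
  (forall v, v \in S -> finite_absval v) ->
  \prod_(v <- S) (v m%:R)^-1 <= m%:R ^+ \dim {:F}.
Proof.
move=> m0 uS fS; elim/ltn_ind: m m0 => m IH m0.
have [m1|m1] := leqP m 1.
  have -> : m = 1%N by apply/eqP; rewrite eqn_leq m1.
  rewrite expr1n big_seq big1 // => v /fS[hv _ _]; by rewrite absval1 // invr1.
have pp := pdiv_prime m1; set p := pdiv m in pp.
have mE : m = (p * (m %/ p))%N by rewrite mulnC divnK // pdiv_dvd.
set l := (m %/ p)%N in mE.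
have -> : \prod_(v <- S) (v m%:R)^-1 =
    \prod_(v <- S) (v p%:R)^-1 * \prod_(v <- S) (v l%:R)^-1.
  rewrite -big_split /= !big_seq; apply: eq_bigr => v /fS[hv _ _].
  by rewrite mE natrM (absvalM hv) invfM.
have -> : (m%:R : R) = p%:R * l%:R by rewrite -natrM -mE.
rewrite exprMn; apply: ler_pM.
- by rewrite big_seq; apply: prodr_ge0 => v /fS[hv _ _]; rewrite invr_ge0 (absval_ge0 hv).
- by rewrite big_seq; apply: prodr_ge0 => v /fS[hv _ _]; rewrite invr_ge0 (absval_ge0 hv).
- exact: prod_finite_prime.
apply: IH; first by rewrite ltn_Pdiv ?prime_gt1.
by rewrite divn_gt0 ?prime_gt0 // pdiv_leq.
Qed.

Lemma finite_absval_le_half v x : finite_absval v -> v x < 1 -> v x <= 2^-1.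
Proof.
move=> [hv uv [p [q [up rq vp]]]] vx; apply: le_trans (uniformizer_le hv up vx) _.
have [p0 vp1 _] := up; have : 0 < v p by rewrite absval_gt0.
move: vp1; rewrite vp; case: (q) => [|[|m]]; rewrite ?invr0 ?ltxx // ?invr1 ?ltxx // => _ _.
by rewrite lef_pV2 ?posrE ?ltr0n // ler_nat.
Qed.

(** Each of these places contributes a factor at least 2 to a product that [prod_finite_nat] bounds
    by m^[F:Q]. *)
Lemma finite_places_nat (m : nat) : (0 < m)%N ->
  finite_set [set v : place R F | finite_absval v /\ v m%:R < 1].
Proof.
move=> m0; apply: contrapT => inf.
have [N HN] := @expr_gt_bound R 2 (m%:R ^+ \dim {:F}) (ltr1n _ 2).
have [B Bsub Bsize] := @infinite_set_fset _ _ N inf.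
have fB v : v \in enum_fset B -> finite_absval v /\ v m%:R < 1 by move=> vB; apply: Bsub.
have := @prod_finite_nat m (enum_fset B) m0 (fset_uniq B) (fun v vB => (fB v vB).1).
rewrite leNgt => /negP; apply; apply: lt_le_trans (HN _ Bsize) _.
elim: (enum_fset B) fB => [|v s IH] fB; first by rewrite big_nil expr0.
rewrite big_cons exprS; apply: ler_pM; rewrite ?exprn_ge0 //.
  have [fv vm] := fB v (mem_head _ _); have := finite_absval_le_half fv vm.
  have vm0 : 0 < v m%:R by have [hv _ _] := fv; rewrite absval_gt0 // natF_eq0 -lt0n.
  by rewrite -[2 in X in _ -> X]invrK lef_pV2 ?posrE ?invr_gt0.
by apply: IH => u us; apply: fB; rewrite inE us orbT.
Qed.

(** If m x and l x^-1 are integral, a finite place has |m| < 1 when |x| > 1, and |l| < 1 when |x| <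
    1. *)
Lemma finite_places_neq1 (x : F) : x != 0 ->
  finite_set [set v : place R F | finite_absval v /\ v x != 1].
Proof.
move=> x0; have [m m0 [f fm fr]] := integral_multiple x.
have [l l0 [g gm gr]] := integral_multiple x^-1.
apply: (@sub_finite_set _ _ ([set v : place R F | finite_absval v /\ v m%:R < 1] `|`
   [set v : place R F | finite_absval v /\ v l%:R < 1])).
  move=> v [fv vx]; have [hv uv _] := fv.
  have := ultra_root hv uv fm fr; have := ultra_root hv uv gm gr.
  rewrite !(absvalM hv) absvalV // => h1 h2.
  have vx0 : 0 < v x by rewrite absval_gt0.
  case: (ltgtP (v x) 1) vx => // vx _; [right|left]; split=> //; rewrite ltNge; apply/negP => h.
    by move: h1; rewrite ler_pdivrMr // mul1r leNgt (lt_le_trans vx).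
  by move: h2; rewrite leNgt (lt_le_trans vx) // ler_peMl // ltW.
by rewrite finite_setU; split; apply: finite_places_nat.
Qed.

End IndexBound.

(** * Infinite places and the product formula *)

Section PrimitiveElement.
Variable F : fieldExtType rat.

Definition is_primitive (u : F) (m : {poly rat}) :=
  [/\ m \is monic, size m = (\dim {:F}).+1, separable_poly m,
   forall p, horner_alg u p = 0 <-> m %| p &
   forall x, exists2 p : {poly rat}, (size p <= \dim {:F})%N & horner_alg u p = x].

Lemma exists_primitive : exists u m, is_primitive u m.
Proof.
have pchar0 : [pchar F] =i pred0.
  by move=> p; rewrite !inE natF_eq0; case: eqP => [->|_]; rewrite ?andbF.
have sep : separable 1%AS {:F}%AS.
  by apply/separableP => x _; apply: pcharf0_separable.
set u := separable_generator 1%AS {:F}%AS.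
have uE : fullv = <<1; u>>%VS by apply: eq_adjoin_separable_generator; rewrite ?subvf.
have /polyOver1P[m mE] := minPolyOver 1 u.
have deg : adjoin_degree 1 u = \dim {:F}.
  by have := dim_Fadjoin 1 u; rewrite dimv1 muln1 -uE.
exists u, m; split.
- by rewrite -(map_monic (in_alg F)) -mE monic_minPoly.
- by rewrite -(size_map_poly (in_alg F)) -mE size_minPoly deg.
- rewrite -(separable_map (in_alg F)) -mE.
  have := pcharf0_separable 1 pchar0 u; by [].
- move=> p; rewrite -(dvdp_map (in_alg F)) -mE; split=> [pu|].
    apply: minPoly_dvdp; first by apply/polyOver1P; exists p.
    by apply/rootP.
  case/dvdpP => q qE; have := congr1 (fun g : {poly F} => g.[u]) qE.
  by rewrite hornerM minPolyxx mulr0.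
move=> x; have xu : x \in <<1; u>>%VS by rewrite -uE memvf.
have /polyOver1P[p pE] := Fadjoin_polyOver 1 u x.
exists p; first by rewrite -(size_map_poly (in_alg F)) -pE -deg size_Fadjoin_poly.
by have := Fadjoin_poly_eq xu; rewrite pE.
Qed.

Variables (u : F) (m : {poly rat}).
Hypothesis um : is_primitive u m.

Lemma primitive_poly x : exists2 p : {poly rat}, (size p <= \dim {:F})%N & horner_alg u p = x.
Proof. by case: um. Qed.

Section Embedding.
Variables (L : numFieldType) (b : L).
Hypothesis rb : root (map_poly ratr m) b.

Definition embedding (x : F) : L := (map_poly ratr (s2val (cid2 (primitive_poly x)))).[b].

(** Two polynomials representing the same x differ by a multiple of m, which vanishes at b; so the
    choice made in [embedding] is immaterial. *)
Lemma embedding_horner (p : {poly rat}) : embedding (horner_alg u p) = (map_poly ratr p).[b].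
Proof.
rewrite /embedding; case: cid2 => q _ /= qp.
have : horner_alg u (q - p) = 0 by rewrite rmorphB; apply/eqP; rewrite subr_eq0; apply/eqP.
case: um => _ _ _ mdvd _ /mdvd; rewrite -(dvdp_map (ratr : {rmorphism rat -> L})) => /dvdpP[r].
rewrite rmorphB => /(congr1 (fun g => g.[b])); rewrite hornerD hornerN hornerM.
by rewrite (rootP rb) mulr0 => /eqP; rewrite subr_eq0 => /eqP.
Qed.

Lemma embedding_zmod : zmod_morphism embedding.
Proof.
move=> x y; have [p _ <-] := primitive_poly x; have [q _ <-] := primitive_poly y.
by rewrite -rmorphB !embedding_horner rmorphB hornerD hornerN.
Qed.

Lemma embedding_monoid : monoid_morphism embedding.
Proof.
split=> [|x y]; first by rewrite -(rmorph1 (horner_alg u)) embedding_horner rmorph1 hornerC.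
have [p _ <-] := primitive_poly x; have [q _ <-] := primitive_poly y.
by rewrite -rmorphM !embedding_horner rmorphM hornerM.
Qed.

HB.instance Definition _ := GRing.isZmodMorphism.Build F L embedding embedding_zmod.
HB.instance Definition _ := GRing.isMonoidMorphism.Build F L embedding embedding_monoid.

Lemma exists_embedding : exists s : {rmorphism F -> L}, s u = b.
Proof.
exists embedding.
have {1}-> : u = horner_alg u 'X by rewrite horner_algX.
by rewrite /= embedding_horner map_polyX hornerX.
Qed.

End Embedding.

Lemma rmorph_horner_alg (L : numFieldType) (s : {rmorphism F -> L}) p :
  s (horner_alg u p) = (map_poly ratr p).[s u].
Proof.
rewrite /horner_alg -horner_map -map_poly_comp /=; congr (_.[_]).
by apply: eq_map_poly => a; exact: (fmorph_eq_rat (s \o in_alg F) a).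
Qed.

Lemma embedding_root (L : numFieldType) (s : {rmorphism F -> L}) : root (map_poly ratr m) (s u).
Proof.
apply/rootP; rewrite -rmorph_horner_alg; case: um => _ _ _ mdvd _.
by have /mdvd -> := dvdpp m; rewrite rmorph0.
Qed.

Lemma rmorph_eq (L : numFieldType) (s t : {rmorphism F -> L}) : s u = t u -> s =1 t.
Proof.
by move=> st x; have [p _ <-] := primitive_poly x; rewrite !rmorph_horner_alg st.
Qed.

(* The Vandermonde matrix of the conjugates of u diagonalizes multiplication by z, whose matrix
   in the basis of powers of u is rational. *)
Lemma det_prod_embedding (L : numFieldType) (S : 'I_(\dim {:F}) -> {rmorphism F -> L}) z :
  injective (fun i => S i u) -> exists d : rat, \prod_i S i z = ratr d.
Proof.
move=> Sinj; set n := \dim {:F} in S Sinj *.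
have /choice[p Hp] (i : 'I_n) : exists p : {poly rat}, (size p <= n)%N /\ horner_alg u p = z * u ^+ i.
  by have [p sp pE] := primitive_poly (z * u ^+ i); exists p.
pose M : 'M[rat]_n := \matrix_(i, j) (p i)`_j.
pose a : 'rV[L]_n := \row_j S j u.
have MV : map_mx ratr M *m Vandermonde n a = Vandermonde n a *m diag_mx (\row_j S j z).
  apply/matrixP => i k; rewrite !mxE.
  under eq_bigr => j _ do rewrite !mxE.
  transitivity (S k (z * u ^+ i)).
    have [sp <-] := Hp i; rewrite rmorph_horner_alg (horner_coef_wide (n := n)); last first.
      exact: leq_trans (size_poly _ _) sp.
    by apply: eq_bigr => j _; rewrite coef_map.
  rewrite rmorphM rmorphXn (bigD1 k) //= big1 ?addr0.
    by rewrite !mxE eqxx mulr1n mulrC.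
  by move=> j jk; rewrite !mxE (negbTE jk) mulr0n mulr0.
exists (\det M); have V0 : \det (Vandermonde n a) != 0.
  rewrite det_Vandermonde; apply/prodf_neq0 => i _; apply/prodf_neq0 => j ij.
  rewrite subr_eq0 !mxE; apply: contraTneq ij => /Sinj ->; by rewrite ltnn.
have := congr1 determinant MV; rewrite !det_mulmx det_map_mx det_diag mulrC => /(mulfI V0) ->.
by apply: eq_bigr => i _; rewrite mxE.
Qed.

End PrimitiveElement.

(** The equation has integer coefficients, so it can be read in [algC], where rational algebraic
    integers are known to be integers. *)
Lemma integralZ_rat (L : numFieldType) (d : rat) : integralZ (ratr d : L) -> exists k : int, d = k%:~R.
Proof.
have ratr_intr (K : numFieldType) (p : {poly int}) :
    map_poly (ratr : rat -> K) (map_poly intr p) = map_poly intr p.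
  by rewrite -map_poly_comp; apply: eq_map_poly => k; rewrite /= ratr_int.
move=> [p pm]; rewrite -ratr_intr fmorph_root.
rewrite -(fmorph_root (ratr : {rmorphism rat -> algC})) ratr_intr => rd.
have : (ratr d : algC) \is a Num.int.
  apply: Cint_rat_Aint; first exact: Crat_rat.
  apply: root_monic_Aint rd _ _; first exact: monic_map.
  by apply/polyOverP => i; rewrite coef_map /=.
case/intrP => k kE; exists k; apply: (fmorph_inj (ratr : {rmorphism rat -> algC})).
by rewrite /= kE ratr_int.
Qed.

Section Modulus.
Variable R : realType.
Implicit Types (z w : R[i]) (a : R).
Local Open Scope complex_scope.

(** The norm of [R[i]] takes its values in [R[i]], whereas places are valued in R. *)
Definition modc z : R := complex.Re `|z|.

Lemma modcE z : (modc z)%:C = `|z|.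
Proof. by rewrite /modc RRe_real // normr_real. Qed.

Lemma modc_ge0 z : 0 <= modc z.
Proof. by rewrite -ler0c modcE. Qed.

Lemma modcM z w : modc (z * w) = modc z * modc w.
Proof. by apply: (@complexI R); rewrite rmorphM /= !modcE normrM. Qed.

Lemma modc_real a : modc a%:C = `|a|.
Proof. by rewrite /modc normc_def /= expr0n addr0 sqrtr_sqr. Qed.

Lemma modc_sqr z : modc z ^+ 2 = complex.Re z ^+ 2 + complex.Im z ^+ 2.
Proof. by apply: (@complexI R); rewrite rmorphXn /= modcE -add_Re2_Im2. Qed.

Lemma modc_eq0 z : (modc z == 0) = (z == 0).
Proof. by rewrite -(inj_eq (@complexI R)) modcE normr_eq0. Qed.

Lemma modcJ z : modc (z^* )%C = modc z.
Proof. by rewrite /modc normcJ. Qed.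

Lemma modc1 : modc 1 = 1.
Proof. by rewrite -[1]/(1%:C)%C modc_real normr1. Qed.

Lemma modc_prod (I : finType) (P : pred I) (f : I -> R[i]) :
  modc (\prod_(i | P i) f i) = \prod_(i | P i) modc (f i).
Proof. by apply: (big_morph _ modcM modc1). Qed.

Lemma modc_nat m : modc m%:R = m%:R.
Proof. by rewrite -(rmorph_nat (@real_complex R)) modc_real normr_nat. Qed.

(** Circles centred at 0 and at 1 meet in conjugate points. Applied to images of the primitive
    element, this recovers an embedding up to conjugation from its absolute value. *)
Lemma modc_inj z w : modc z = modc w -> modc (z - 1) = modc (w - 1) ->
  z = w \/ z = (w^* )%C.
Proof.
move=> e1 e2; have := congr1 (fun a => a ^+ 2) e1; have := congr1 (fun a => a ^+ 2) e2.
rewrite !modc_sqr {e1 e2}; case: z w => [a b] [c d] /= h1 h2.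
have ac : a = c by lra.
have : (b - d) * (b + d) = 0.
  by move: h2; rewrite ac => /addrI h; rewrite -subr_sqr h subrr.
rewrite ac => /eqP; rewrite mulf_eq0 subr_eq0 addr_eq0 => /orP[]/eqP ->; [left|right] => //.
Qed.

End Modulus.

Section InfinitePlaces.
Variables (R : realType) (F : fieldExtType rat).
Implicit Types v w : place R F.

(** The local degree at an infinite place; the value 1 at finite places is a default. *)
Definition place_degree v : nat := if `[< complex_absval v >] then 2 else 1.

Lemma infinite_place_nat v (m : nat) : real_absval v \/ complex_absval v ->
  v m%:R = m%:R ^+ place_degree v.
Proof.
rewrite /place_degree => hv; have [[s [_ sE]]|nc] := asboolP (complex_absval v).
  by apply: (@complexI R); rewrite sE rmorph_nat rmorphXn /= rmorph_nat normr_nat.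
by case: hv => // -[s sE]; rewrite sE rmorph_nat normr_nat expr1.
Qed.

Lemma exp2_inj (a b : nat) : (2 : R) ^+ a = 2 ^+ b -> a = b.
Proof. by rewrite -!natrX => /eqP; rewrite eqr_nat eqn_exp2l // => /eqP. Qed.

Variable Inf : seq (place R F).
Hypotheses (uInf : uniq Inf) (InfP : forall v, v \in Inf <-> real_absval v \/ complex_absval v).

(** The embeddings into [R[i]] correspond to the roots of the minimal polynomial of a primitive
    element. A real place comes from one of them, and a complex place from a conjugate pair, whose
    two moduli make up the normalized square. So the product is the absolute norm, and the norm is
    rational by [det_prod_embedding]. *)
Lemma prod_infinite_modc : exists S : 'I_(\dim {:F}) -> {rmorphism F -> R[i]},
  (forall z, exists d : rat, \prod_i S i z = ratr d) /\
  forall z, \prod_(v <- Inf) v z = \prod_i modc (S i z).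
Proof.
have [u [m um]] := exists_primitive F; set n := \dim {:F}.
have [rs rsE] := closed_field_poly_normal (map_poly ratr m : {poly R[i]}).
have [mm sm sepm _ _] := um.
have rsE' : map_poly ratr m = \prod_(z <- rs) ('X - z%:P) :> {poly R[i]}.
  by rewrite rsE lead_coef_map (monicP mm) rmorph1 scale1r.
have urs : uniq rs by rewrite -separable_prod_XsubC -rsE' separable_map.
have srs : size rs = n.
  by have := congr1 (fun p : {poly R[i]} => size p) rsE'; rewrite size_map_poly sm size_prod_XsubC => -[].
have rootE b : root (map_poly ratr m) b = (b \in rs) by rewrite rsE' root_prod_XsubC.
have /choice[S Su] (i : 'I_n) : exists s : {rmorphism F -> R[i]}, s u = rs`_i.
  by apply: (exists_embedding um); rewrite rootE mem_nth // srs.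
have Sinj : injective (fun i => S i u).
  by move=> i j; rewrite !Su => /eqP; rewrite nth_uniq ?srs // => /eqP/val_inj.
have Ssurj (s : {rmorphism F -> R[i]}) : exists i, S i =1 s.
  have : s u \in rs by rewrite -rootE; apply: (embedding_root um).
  move=> /(nthP 0)[k]; rewrite srs => kn ks; exists (Ordinal kn).
  by apply: (rmorph_eq um); rewrite Su.
exists S; split=> z; first exact: (det_prod_embedding um).
have S_real i : complex.Im (S i u) = 0 ->
    exists t : {rmorphism F -> R}, S i =1 @real_complex R \o t.
  move=> Si0; have [|t tu] := @exists_embedding _ _ _ um R (complex.Re (S i u)).
    have := embedding_root um (S i); rewrite -(fmorph_root (@real_complex R)) -map_poly_comp.
    rewrite [S i u]complexE Si0 rmorph0 mulr0 addr0.
    by congr (root _ _); apply: eq_map_poly => a; rewrite /= fmorph_rat.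
  exists t; apply: (rmorph_eq um).
  by rewrite [S i u]complexE Si0 rmorph0 mulr0 addr0 /= tu.
pose compat v i := `[< if complex.Im (S i u) == 0 then forall x, v x = modc (S i x)
   else forall x, v x = modc (S i x) ^+ 2 >].
have compat_deg v i : compat v i -> v 2%:R = 2 ^+ (if complex.Im (S i u) == 0 then 1 else 2).
  move=> /asboolP; case: ifP => _ ->; by rewrite rmorph_nat modc_nat ?expr1.
have fiber v : v \in Inf -> \prod_(i | compat v i) modc (S i z) = v z.
  move=> /InfP vinf; have v2 := infinite_place_nat 2 vinf.
  (* The value at 2 is 2 or 4 according to the degree, so a real place cannot match a non-real
     embedding, nor a complex place a real one. *)
  have deg i : compat v i -> (complex.Im (S i u) == 0) = ~~ `[< complex_absval v >].
    move=> /compat_deg; rewrite v2 => /exp2_inj; rewrite /place_degree.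
    by case: `[< _ >]; case: (_ == 0).
  have [cv|ncv] := pselect (complex_absval v); last first.
    case: vinf => // -[s sE].
    have [i0 Si0] := Ssurj (@real_complex R \o s).
    have im0 : complex.Im (S i0 u) == 0 by rewrite Si0.
    rewrite (big_pred1 i0); first by rewrite Si0 /= modc_real sE.
    move=> i; apply/idP/eqP => [ci|->]; last first.
      by apply/asboolP; rewrite im0 => x; rewrite Si0 /= modc_real sE.
    have := deg i ci; rewrite asboolF // => imi; apply: Sinj.
    move: ci => /asboolP; rewrite imi => ci.
    have h (x : F) : modc (S i x) = modc (S i0 x) by rewrite -ci Si0 /= modc_real sE.
    have [|//|->] := @modc_inj R (S i u) (S i0 u) (h u).
      by have := h (u - 1); rewrite !rmorphB !rmorph1.
    by move: im0; case: (S i0 u) => a b /= /eqP ->; rewrite oppr0.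
  have [s [[x0 sx0] sE]] := cv.
  have [i0 Si0] := Ssurj s.
  have [i1 Si1] := Ssurj (@conjc R \o s).
  have im0 : complex.Im (S i0 u) != 0.
    apply/eqP => /S_real[t tE]; apply: (sx0 (t x0)).
    by rewrite -Si0 tE.
  have i01 : i1 != i0.
    apply/eqP => e; move/eqP: im0; apply.
    have := Si1 u; rewrite e Si0 /=; case: (s u) => a b /= [/eqP].
    by rewrite -addr_eq0 -mulr2n mulrn_eq0 /= => /eqP.
  have sE' x : v x = modc (s x) ^+ 2.
    by apply: (@complexI R); rewrite sE rmorphXn /= modcE.
  have c0 : compat v i0 by apply/asboolP; rewrite (negbTE im0) => x; rewrite sE' Si0.
  have im1 : complex.Im (S i1 u) != 0.
    by rewrite Si1 /=; move: im0; rewrite Si0; case: (s u) => a b /=; rewrite oppr_eq0.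
  have c1 : compat v i1.
    by apply/asboolP; rewrite (negbTE im1) => x; rewrite sE' Si1 /= modcJ.
  rewrite (bigD1 i0) //= (big_pred1 i1); first by rewrite Si0 Si1 /= modcJ sE' expr2.
  move=> i; apply/andP/eqP => [[ci ii0]|->]; last by split.
  have := deg i ci; rewrite asboolT //= => imi.
  move: ci => /asboolP; rewrite imi => ci.
  have h (x : F) : modc (S i x) = modc (S i0 x).
    by apply/eqP; rewrite -(@eqrXn2 _ 2) ?modc_ge0 // -ci sE' Si0.
  have [| |] := @modc_inj R (S i u) (S i0 u) (h u).
  - by have := h (u - 1); rewrite !rmorphB !rmorph1.
  - by move=> /Sinj e; rewrite e eqxx in ii0.
  by move=> e; apply: Sinj; rewrite e Si1 Si0.
have unique i : exists2 v0, v0 \in Inf & forall v, v \in Inf -> compat v i = (v == v0).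
  have [v0 [v0I cv0]] : exists v0, v0 \in Inf /\ compat v0 i.
    have [im0|im0] := eqVneq (complex.Im (S i u)) 0.
      have [t e] := S_real i im0.
      have rt : real_absval (fun x => `|t x|) by exists t.
      exists (Place (Or32 _ _ rt)); split; first by apply/InfP; left.
      by apply/asboolP; rewrite im0 eqxx => x; rewrite e /= modc_real.
    have rt : complex_absval (fun x => modc (S i x) ^+ 2).
      exists (S i); split; last by move=> x; rewrite rmorphXn /= modcE.
      by exists u => y e; move: im0; rewrite e /= eqxx.
    exists (Place (Or33 _ _ rt)); split; first by apply/InfP; right.
    by apply/asboolP; rewrite (negbTE im0).
  exists v0 => // v vI; apply/idP/eqP => [cv|->//].
  apply: place_eq => x; move: cv cv0 => /asboolP + /asboolP.
  by case: ifP => _ -> ->.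
(* Each embedding is compatible with exactly one place, so exchanging the products collapses the
   inner one. *)
transitivity (\prod_(v <- Inf) \prod_(i | compat v i) modc (S i z)).
  by rewrite !big_seq; apply: eq_bigr => v vI; rewrite fiber.
rewrite (exchange_big_dep predT) //=; apply: eq_bigr => i _.
have [v0 v0I Hv0] := unique i.
rewrite big_seq_cond (eq_bigl (fun v => (v \in Inf) && (v == v0))); last first.
  by move=> v; case vI : (v \in Inf) => //=; rewrite Hv0.
by rewrite -big_seq_cond -big_filter filter_pred1_uniq // big_seq1.
Qed.

(** Obtained by evaluating [prod_infinite_modc] at 2. *)
Lemma sum_place_degree : (\sum_(v <- Inf) place_degree v)%N = \dim {:F}.
Proof.
have [S [_ HS]] := prod_infinite_modc.
have := HS 2%:R.
under [in RHS]eq_bigr => i _ do rewrite rmorph_nat modc_nat.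
rewrite prodr_const card_ord.
have -> : \prod_(v <- Inf) v 2%:R = 2%:R ^+ (\sum_(v <- Inf) place_degree v)%N.
  rewrite -prodrXr big_seq [RHS]big_seq; apply: eq_bigr => v /InfP; exact: infinite_place_nat.
exact: exp2_inj.
Qed.

(** The product is the modulus of the norm, which is rational, integral over Z by
    [exists_place_gt1], and nonzero: a nonzero integer. *)
Lemma prod_infinite_ge1 z : z != 0 ->
  (forall v, finite_absval v -> v z <= 1) -> 1 <= \prod_(v <- Inf) v z.
Proof.
move=> z0 zint; have [S [Srat ->]] := prod_infinite_modc.
have [p mp rp] : integralZ z.
  apply: contrapT => /(@exists_place_gt1 R)[v fv]; by rewrite ltNge zint.
have [d dE] := Srat z; rewrite -modc_prod dE.
have : integralZ (ratr d : R[i]).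
  rewrite -dE; apply: (big_ind (fun y => integralZ y)).
  - exact: (mxpoly.integral1 (intr : {rmorphism int -> R[i]})).
  - by move=> x y; apply: (@mxpoly.integral_mul _ _ (intr : {rmorphism int -> R[i]})).
  move=> i _; exists p => //; rewrite -(fmorph_root (S i)) -map_poly_comp in rp.
  by move: rp; congr (root _ _); apply: eq_map_poly => k; rewrite /= rmorph_int.
move=> /integralZ_rat[k dk].
have k0 : k != 0.
  apply/eqP => k0; have : \prod_i S i z != 0.
    by apply/prodf_neq0 => i _; rewrite fmorph_eq0.
  by rewrite dE dk k0 rmorph0 eqxx.
rewrite dk ratr_int -(rmorph_int (@real_complex R)) modc_real -intr_norm ler1z.
by rewrite -gtz0_ge1 normr_gt0.
Qed.

End InfinitePlaces.

(** * A pigeonhole form of Minkowski's theorem *)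

Section Nets.
Variable R : realType.

Definition grid (A l x : R) : nat := Num.truncn ((x + A) / l).

Lemma grid_lt (A l x : R) : 0 < l -> `|x| <= A -> (grid A l x < (Num.truncn (2 * A / l)).+1)%N.
Proof.
move=> l0; rewrite ler_norml => /andP[h1 h2]; rewrite ltnS /grid le_truncn //.
by rewrite ler_pM2r ?invr_gt0 //; lra.
Qed.

Lemma grid_eq (A l x y : R) : 0 < l -> `|x| <= A -> `|y| <= A -> grid A l x = grid A l y ->
  `|x - y| <= l.
Proof.
move=> l0; rewrite !ler_norml => /andP[h1 h2] /andP[g1 g2] e.
have pos z : - A <= z -> 0 <= (z + A) / l by move=> ?; rewrite divr_ge0 ?(ltW l0) // -lerBlDr sub0r.
have /andP[x1 x2] := truncn_itv (pos x h1); have /andP[y1 y2] := truncn_itv (pos y g1).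
rewrite -/(grid A l x) e in x1 x2; rewrite -/(grid A l y) in y1 y2.
rewrite ler_pdivlMr // in x1; rewrite ler_pdivlMr // in y1.
rewrite ltr_pdivrMr // in x2; rewrite ltr_pdivrMr // in y2.
rewrite -natr1 mulrDl mul1r in x2 y2.
move: x1 x2 y1 y2; set g := (grid A l y)%:R * l => x1 x2 y1 y2; apply/andP; split; lra.
Qed.

Lemma grid_size (A l : R) : 0 < l -> l <= A ->
  ((Num.truncn (2 * A / l)).+1)%:R <= 3 * A / l.
Proof.
move=> l0 lA; have Al : 1 <= A / l by rewrite ler_pdivlMr // mul1r.
rewrite -!mulrA in Al *; have A0 : 0 <= 2 * (A / l) by lra.
have /andP[h _] := truncn_itv A0; rewrite -natr1; lra.
Qed.

Variable F : fieldType.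

(** A grid of step l needs at most 3 A / l cells; 36 is the constant of the complex case, so that
    both kinds of places share one bound. *)
Lemma real_net (N : F -> R) (A l : R) : real_absval N -> 0 < l -> l <= A ->
  exists2 k, net N A l k & k%:R <= 36 * A / l.
Proof.
move=> [s sE] l0 lA; exists (Num.truncn (2 * A / l)).+1.
  exists (grid A l \o s); split=> [x|x y]; rewrite !sE; first exact: grid_lt.
  by rewrite rmorphB; apply: grid_eq.
apply: le_trans (grid_size l0 lA) _.
by rewrite ler_pM2r ?invr_gt0 // ler_wpM2r ?ler_nat // (le_trans (ltW l0)).
Qed.

(** The normalized absolute value is the squared modulus. Squares of side d = sqrt(l) / 2 have
    squared diameter l / 2, and (3 sqrt(A) / d)^2 = 36 A / l of them suffice. *)
Lemma complex_net (N : F -> R) (A l : R) : complex_absval N -> 0 < l -> l <= A ->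
  exists2 k, net N A l k & k%:R <= 36 * A / l.
Proof.
move=> [s [_ sE]] l0 lA; have A0 : 0 < A by apply: lt_le_trans lA.
have NE x : N x = modc (s x) ^+ 2.
  by apply: (@complexI R); rewrite sE rmorphXn /= modcE.
set B := Num.sqrt A; set d := Num.sqrt l / 2.
have B0 : 0 < B by rewrite sqrtr_gt0.
have d0 : 0 < d by rewrite divr_gt0 // sqrtr_gt0.
have B2 : B ^+ 2 = A by rewrite sqr_sqrtr // ltW.
have d2 : d ^+ 2 = l / 4 by rewrite expr_div_n sqr_sqrtr ?ltW // -natrX.
have dB : d <= B.
  have : Num.sqrt l <= B by rewrite ler_sqrt // ltW.
  have : 0 <= Num.sqrt l by exact: sqrtr_ge0.
  by rewrite /d; lra.
have bd x : N x <= A -> `|complex.Re (s x)| <= B /\ `|complex.Im (s x)| <= B.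
  rewrite NE -B2 modc_sqr => h.
  have sq (t : R) : t ^+ 2 <= B ^+ 2 -> `|t| <= B.
    by rewrite -real_normK ?num_real // ler_pXn2r ?nnegrE // ltW.
  by split; apply: sq; apply: le_trans h; rewrite ?lerDl ?lerDr sqr_ge0.
set k := (Num.truncn (2 * B / d)).+1.
exists (k * k)%N; last first.
  have k3 : k%:R <= 3 * B / d by exact: grid_size.
  rewrite natrM; apply: le_trans (ler_pM _ _ k3 k3) _; rewrite ?ler0n //.
  have -> : 3 * B / d * (3 * B / d) = 9 * B ^+ 2 / d ^+ 2 by field; rewrite gt_eqF.
  by rewrite B2 d2 (_ : 9 * A / (l / 4) = 36 * A / l) //; field; rewrite gt_eqF.
exists (fun x => (grid B d (complex.Re (s x)) + grid B d (complex.Im (s x)) * k)%N); split.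
  move=> x /bd[h1 h2]; have := grid_lt d0 h1; have := grid_lt d0 h2.
  rewrite -/k; move: (grid B d _) (grid B d _) => i j; nia.
move=> x y /bd[x1 x2] /bd[y1 y2] e.
have kx := grid_lt d0 x1; have ky := grid_lt d0 y1; rewrite -/k in kx ky.
have e1 : grid B d (complex.Re (s x)) = grid B d (complex.Re (s y)).
  by have := congr1 (fun i => i %% k)%N e; rewrite ![(grid _ _ _ + _)%N]addnC !modnMDl !modn_small.
have e2 : grid B d (complex.Im (s x)) = grid B d (complex.Im (s y)).
  by have := congr1 (fun i => i %/ k)%N e;
    rewrite ![(grid _ _ _ + _)%N]addnC !divnMDl // !divn_small // !addn0.
have := grid_eq d0 x1 y1 e1; have := grid_eq d0 x2 y2 e2.
rewrite NE modc_sqr rmorphB -!raddfB /=.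
case: (s x) (s y) => a b [a' b'] /=.
move=> h1 h2.
have sq t : `|t| <= d -> t ^+ 2 <= l / 4.
  by move=> h; rewrite -d2 -[t ^+ 2]ger0_norm ?sqr_ge0 // normrX lerXn2r ?nnegrE // ltW.
have := sq _ h1; have := sq _ h2; lra.
Qed.

Lemma net_seq (s : seq (place R F)) (A l : place R F -> R) (k : place R F -> nat) :
  (forall v, v \in s -> net v (A v) (l v) (k v)) ->
  exists c : F -> nat, (forall x, (forall v, v \in s -> v x <= A v) ->
      (c x < \prod_(v <- s) k v)%N) /\
    forall x y, (forall v, v \in s -> v x <= A v) -> (forall v, v \in s -> v y <= A v) ->
      c x = c y -> forall v, v \in s -> v (x - y) <= l v.
Proof.
elim: s => [|v s IH] Hs; first by exists (fun=> 0%N); split=> // x _; rewrite big_nil.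
have [c [c1 c2]] := IH (fun w ws => Hs w (mem_behead (s := v :: s) ws)).
have [b [b1 b2]] := Hs v (mem_head _ _).
have hd x : (forall w, w \in v :: s -> w x <= A w) -> v x <= A v by apply; exact: mem_head.
have tl x : (forall w, w \in v :: s -> w x <= A w) -> forall w, w \in s -> w x <= A w.
  by move=> h w ws; apply: h; rewrite inE ws orbT.
exists (fun x => (b x + c x * k v)%N); split=> [x hx|x y hx hy e].
  have := b1 x (hd x hx); have := c1 x (tl x hx); rewrite big_cons.
  move: (\prod_(_ <- _) _)%N (b x) (c x) (k v) => p i j q; nia.
have bx := b1 x (hd x hx); have by_ := b1 y (hd y hy).
have eb : b x = b y.
  have := congr1 (fun i => i %% k v)%N e; by rewrite ![(b _ + _)%N]addnC !modnMDl !modn_small.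
have ec : c x = c y.
  have k0 : (0 < k v)%N by apply: leq_trans bx.
  have := congr1 (fun i => i %/ k v)%N e; by rewrite ![(b _ + _)%N]addnC !divnMDl // !divn_small // !addn0.
move=> w; rewrite inE => /predU1P[->|ws]; first by apply: b2 eb; apply: hd.
by apply: c2 ec _ ws; apply: tl.
Qed.

Lemma size_le_net (s : seq (place R F)) (A l : place R F -> R) (k : place R F -> nat) (X : seq F) :
  (forall v, v \in s -> net v (A v) (l v) (k v)) -> uniq X ->
  (forall x v, x \in X -> v \in s -> v x <= A v) ->
  (forall x y, x \in X -> y \in X -> (forall v, v \in s -> v (x - y) <= l v) -> x = y) ->
  (size X <= \prod_(v <- s) k v)%N.
Proof.
move=> /net_seq[c [c1 c2]] uX XA Xinj.
have ci : {in X &, injective c}.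
  by move=> x y xX yX e; apply: Xinj => //; apply: c2 e => v; apply: XA.
rewrite -(size_map c) -[leqRHS](size_iota 0); apply: uniq_leq_size.
  by rewrite map_inj_in_uniq.
by move=> _ /mapP[x xX ->]; rewrite mem_iota add0n /=; apply: c1 => v; apply: XA.
Qed.

End Nets.

Lemma infinite_place_absval (R : realType) (F : fieldType) (v : place R F) :
  real_absval v \/ complex_absval v -> is_absval v.
Proof.
move=> [[s E]|[s [_ sE]]].
  split=> [x|x|x y|]; rewrite ?E //.
  - by split=> [/eqP|->]; rewrite ?rmorph0 ?normr0 // normr_eq0 fmorph_eq0 => /eqP.
  - by rewrite rmorphM normrM.
  exists (2 : R) => x y; rewrite !E rmorphD (le_trans (ler_normD _ _)) //.
  by rewrite mulr_natl mulr2n lerD // le_max lexx ?orbT.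
have E x : v x = modc (s x) ^+ 2.
  by apply: (@complexI R); rewrite sE rmorphXn /= modcE.
split=> [x|x|x y|]; rewrite ?E ?sqr_ge0 //.
- split=> [/eqP|->]; last by rewrite rmorph0 -[X in modc X]/(0%:C)%C modc_real normr0 expr0n.
  by rewrite sqrf_eq0 modc_eq0 fmorph_eq0 => /eqP.
- by rewrite rmorphM modcM exprMn.
exists (4 : R) => x y; rewrite !E rmorphD.
have tri : modc (s x + s y) <= modc (s x) + modc (s y).
  by rewrite -lecR rmorphD /= !modcE ler_normD.
have q0 := modc_ge0 (s x); have r0 := modc_ge0 (s y); have p0 := modc_ge0 (s x + s y).
move: tri q0 r0 p0; set p := modc (s x + s y); set q := modc (s x); set r := modc (s y).
move=> tri q0 r0 p0.
have pq : p ^+ 2 <= (q + r) ^+ 2 by apply: lerXn2r; rewrite ?nnegrE ?addr_ge0.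
have [qr|rq] := leP (q ^+ 2) (r ^+ 2).
  have qr' : q <= r by rewrite -(ler_pXn2r (n := 2)).
  (* This product is 4 r^2 - (q + r)^2. *)
  have : 0 <= (r - q) * (3 * r + q) by rewrite mulr_ge0 ?subr_ge0 ?addr_ge0 ?mulr_ge0.
  lra.
have rq' : r <= q by rewrite -(ler_pXn2r (n := 2)) ?nnegrE // ltW.
have : 0 <= (q - r) * (3 * q + r) by rewrite mulr_ge0 ?subr_ge0 ?addr_ge0 ?mulr_ge0.
lra.
Qed.

(** * Counting integral elements and finding small ones *)

Section Minkowski.
Variables (R : realType) (F : fieldExtType rat).
Implicit Types v w : place R F.
Variable Inf : seq (place R F).
Hypotheses (uInf : uniq Inf) (InfP : forall v, v \in Inf <-> real_absval v \/ complex_absval v).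

Lemma infinite_net v (A l : R) : v \in Inf -> 0 < l -> l <= A ->
  exists2 k, net v A l k & k%:R <= 36 * A / l.
Proof. by move=> /InfP[]; [apply: real_net|apply: complex_net]. Qed.

Lemma dim_gt0 : (0 < \dim {:F})%N.
Proof.
rewrite lt0n dimv_eq0; apply/eqP => h0.
by have := memvf (1 : F); rewrite h0 memv0 oner_eq0.
Qed.

Lemma Inf_neq_nil : Inf != [::].
Proof.
apply/eqP => h; have := sum_place_degree uInf InfP; rewrite h big_nil => D0.
by have := dim_gt0; rewrite -D0.
Qed.

(** Two elements in the same cells of nets of precision 1/2 differ by an element integral at the
    finite places and of value at most 1/2 at every infinite one; it vanishes by
    [prod_infinite_ge1], [Inf] being nonempty. The constant is 72 = 36 / (1/2). *)
Lemma count_integral (A : place R F -> R) (X : seq F) : (forall v, v \in Inf -> 1 <= A v) ->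
  uniq X -> (forall x v, x \in X -> finite_absval v -> v x <= 1) ->
  (forall x v, x \in X -> v \in Inf -> v x <= A v) ->
  (size X)%:R <= \prod_(v <- Inf) (72 * A v).
Proof.
move=> A1 uX Xfin XA.
have /choice[k Hk] v : exists k, v \in Inf -> net v (A v) (2^-1) k /\ k%:R <= 72 * A v.
  have [vI|//] := boolP (v \in Inf); last by exists 0%N.
  have [||k nk hk] := infinite_net (A := A v) (l := 2^-1) vI; first by rewrite invr_gt0.
    by rewrite (le_trans _ (A1 v vI)) // invf_le1 // ler1n.
  by exists k => _; split=> //; move: hk; lra.
have sX : (size X <= \prod_(v <- Inf) k v)%N.
  apply: (@size_le_net _ _ Inf A (fun=> 2^-1)) => // [v vI|x y xX yX H].
    by case: (Hk v vI).
  apply/eqP; rewrite -subr_eq0; apply: contraT => z0.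
  have := prod_infinite_ge1 uInf InfP z0.
  have fin v : finite_absval v -> v (x - y) <= 1.
    move=> fv; have [hv uv _] := fv.
    by rewrite (le_trans (ultraB hv uv _ _)) // ge_max !Xfin.
  move=> /(_ fin).
  case: (Inf) Inf_neq_nil H (fun v => proj1 (InfP v)) => // v s _ H Hinf.
  rewrite leNgt => /negP; case.
  have pos w : w \in v :: s -> 0 <= w (x - y).
    by move=> /Hinf/infinite_place_absval hw; apply: absval_ge0.
  rewrite big_cons; apply: (@le_lt_trans _ _ (2^-1 * 1)); last by rewrite mulr1 invf_lt1 // ltr1n.
  apply: ler_pM; rewrite ?pos ?mem_head ?H ?mem_head //.
    by rewrite big_seq; apply: prodr_ge0 => w ws; apply: pos; rewrite inE ws orbT.
  rewrite big_seq; apply: prodr_ile1 => w ws; have ws' : w \in v :: s by rewrite inE ws orbT.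
  by rewrite pos //= (le_trans (H w ws')) // invf_le1 // ler1n.
apply: le_trans (_ : (\prod_(v <- Inf) k v)%N%:R <= _); first by rewrite ler_nat.
rewrite natr_prod !big_seq; apply: ler_prod => v vI.
by rewrite ler0n /=; case: (Hk v vI).
Qed.

Lemma infinite_bound v n (w : 'I_n -> F) : v \in Inf -> exists2 K : R, 1 <= K &
  forall (Q : nat) (c : 'I_n -> int), (forall i, `|c i| <= Q%:Z) ->
    v (\sum_i (c i)%:~R * w i) <= K * Q%:R ^+ place_degree v.
Proof.
move=> /InfP; rewrite /place_degree; case: asboolP => [[s [_ sE]] _|ncv [[s sE]|//]].
  have E x : v x = modc (s x) ^+ 2.
    by apply: (@complexI R); rewrite sE rmorphXn /= modcE.
  have S0 : 0 <= \sum_i modc (s (w i)) by apply: sumr_ge0 => i _; apply: modc_ge0.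
  exists ((1 + \sum_i modc (s (w i))) ^+ 2); first by rewrite exprn_ege1 // lerDl.
  move=> Q c cQ; rewrite E -exprMn ler_pXn2r ?nnegrE ?modc_ge0 ?mulr_ge0 ?addr_ge0 //.
  apply: (@le_trans _ _ ((\sum_i modc (s (w i))) * Q%:R)); last by rewrite ler_wpM2r ?ler0n // lerDr.
  rewrite rmorph_sum -lecR modcE; apply: le_trans (ler_norm_sum _ _ _) _.
  rewrite mulr_suml rmorph_sum /=; apply: ler_sum => i _.
  rewrite rmorphM rmorph_int -modcE modcM lecR mulrC ler_wpM2l ?modc_ge0 //.
  by rewrite -(rmorph_int (@real_complex R)) modc_real -intr_norm -[Q%:R]/(Q%:Z%:~R) ler_int.
have S0 : 0 <= \sum_i `|s (w i)| by apply: sumr_ge0.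
exists (1 + \sum_i `|s (w i)|); first by rewrite lerDl.
move=> Q c cQ; rewrite expr1 sE.
apply: (@le_trans _ _ ((\sum_i `|s (w i)|) * Q%:R)); last by rewrite ler_wpM2r ?ler0n // lerDr.
rewrite rmorph_sum; apply: le_trans (ler_norm_sum _ _ _) _.
rewrite mulr_suml; apply: ler_sum => i _.
rewrite rmorphM rmorph_int normrM mulrC ler_wpM2l //.
by rewrite -intr_norm -[Q%:R]/(Q%:Z%:~R) ler_int.
Qed.

Lemma integral_basis : exists w : 'I_(\dim {:F}) -> F, (forall i, integralZ (w i)) /\
  forall c : 'I_(\dim {:F}) -> int, \sum_i (c i)%:~R * w i = 0 -> forall i, c i = 0.
Proof.
set D := \dim {:F}; pose b := vbasis {:F}.
have bfree : free b by apply: basis_free (vbasisP _).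
have /choice[m Hm] (i : 'I_D) : exists m, (0 < m)%N /\ integralZ (m%:R * b`_i).
  by have [m m0 hm] := integral_multiple b`_i; exists m.
exists (fun i => (m i)%:R * b`_i); split=> [i|c c0 i]; first by case: (Hm i).
have m0 : (m i != 0)%N by rewrite -lt0n; case: (Hm i).
move/freeP: bfree => /(_ (fun i => (c i * m i)%:~R)) H.
have /eqP : ((c i * m i)%:~R : rat) = 0.
  apply: H; rewrite -[RHS]c0; apply: eq_bigr => j _.
  by rewrite scaler_int -mulrzl intrM mulrA.
by rewrite intr_eq0 mulf_eq0 (negbTE (m0 : (m i)%:Z != 0)) orbF => /eqP.
Qed.

(** If l p^-1 is integral, then |l|_v <= |p|_v < 1, so a power of l is small at v, while it stays at
    most 1 at the other places of S. *)
Lemma exists_small_nat (S : seq (place R F)) (B : place R F -> R) :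
  (forall v, v \in S -> finite_absval v /\ 0 < B v) ->
  exists2 m : nat, (0 < m)%N & forall v, v \in S -> v m%:R <= B v.
Proof.
elim: S => [|v S IH] HS; first by exists 1%N.
have [|m m0 Hm] := IH; first by move=> w wS; apply: HS; rewrite inE wS orbT.
have [fv Bv] := HS v (mem_head _ _).
have [hv uv [p [q [[p0 vp _] _ _]]]] := fv.
have [l l0 [f fm fr]] := integral_multiple p^-1.
have vl : v l%:R < 1.
  have := ultra_root hv uv fm fr; rewrite absval_div // ler_pdivrMr ?absval_gt0 // mul1r.
  by move=> h; apply: le_lt_trans h vp.
have [k Hk] := expr_lt_eps (absval_ge0 hv _) vl Bv.
exists (m * l ^ k)%N; first by rewrite muln_gt0 m0 expn_gt0 l0.
move=> w; rewrite inE => /predU1P[->|wS].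
  rewrite natrM natrX (absvalM hv) absvalX // -[B v]mul1r ler_pM ?exprn_ge0 ?(absval_ge0 hv) //.
    exact: ultra_nat.
  by apply/ltW/Hk.
have [[hw uw _] _] : finite_absval w /\ 0 < B w by apply: HS; rewrite inE wS orbT.
rewrite natrM (absvalM hw) -[B w]mulr1 ler_pM ?(absval_ge0 hw) //; first exact: Hm.
exact: ultra_nat.
Qed.

Lemma finite_place_net v x : finite_absval v -> x != 0 -> v x <= 1 ->
  exists2 k, net v 1 (v x) k & k%:R = (v x)^-1.
Proof.
move=> fv x0 vx; have [hv uv [p [q [up rq vp]]]] := fv.
have [k ->] := uniformizer_expn hv up x0 vx.
exists (q ^ k)%N; first exact: (finite_net hv uv up rq vp).
by rewrite vp exprVn invrK natrX.
Qed.

(* Two of the combinations of an integral basis with coefficients in [0, Q], Q large, are close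
   at all the places at once.  Scaling by the natural number m makes the g v integral;
   it is divided out at the end. *)
Theorem exists_small_element : exists2 C : R, 0 < C &
  forall (S : seq (place R F)) (g : place R F -> F) (l : place R F -> R),
  uniq S -> (forall v, v \in S -> finite_absval v /\ g v != 0) ->
  (forall v, v \in Inf -> 0 < l v) ->
  C <= \prod_(v <- Inf) l v * \prod_(v <- S) v (g v) ->
  exists2 t : F, t != 0 & [/\ forall v, v \in S -> v t <= v (g v),
     forall v, finite_absval v -> v \notin S -> v t <= 1 &
     forall v, v \in Inf -> v t <= l v].
Proof.
have [w [wint wfree]] := integral_basis; set D := \dim {:F} in w wint wfree.
have /choice[K HK] v : exists K : R, v \in Inf -> 1 <= K /\
    forall (Q : nat) (c : 'I_D -> int), (forall i, `|c i| <= Q%:Z) ->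
    v (\sum_i (c i)%:~R * w i) <= K * Q%:R ^+ place_degree v.
  have [vI|] := boolP (v \in Inf); last by exists 0.
  by have [K K1 HK] := infinite_bound w vI; exists K.
have K1 v : v \in Inf -> 1 <= K v by move=> /HK[].
exists (\prod_(v <- Inf) (36 * K v)).
  by rewrite big_seq; apply: prodr_gt0 => v vI; rewrite mulr_gt0 // (lt_le_trans _ (K1 v vI)).
move=> S0 g0 l uS0 S0P l0 Cle.
have [|m m0 mS0] := @exists_small_nat S0 (fun v => (v (g0 v))^-1).
  by move=> v /S0P[fv gv]; split=> //; have [hv _ _] := fv; rewrite invr_gt0 absval_gt0.
have /finite_seqP[s sE] := @finite_places_nat R F m m0.
have mF0 : (m%:R : F) != 0 by rewrite natF_eq0 -lt0n.
(* The places where m is not a unit are added with g = 1, so that dividing by m at the end leaves t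
   integral there. *)
pose S := S0 ++ undup [seq v <- s | v \notin S0].
pose g v := if v \in S0 then g0 v else 1.
have sP v : v \in s -> finite_absval v /\ v m%:R < 1.
  by move=> vs; have : [set` s] v by []; rewrite -sE.
have SP v : v \in S -> finite_absval v.
  rewrite mem_cat => /orP[/S0P[]//|]; rewrite mem_undup mem_filter => /andP[_ /sP[]] //.
have Sm v : finite_absval v -> v \notin S -> v m%:R = 1.
  move=> fv; rewrite mem_cat negb_or mem_undup mem_filter => /andP[vS0].
  rewrite vS0 /= => vs; have [hv uv _] := fv.
  apply/eqP; rewrite eq_le ultra_nat //= leNgt; apply/negP => vm.
  by move/negP: vs; apply; have : [set` s] v by rewrite -sE.
have uS : uniq S.
  rewrite cat_uniq uS0 undup_uniq andbT; apply/hasPn => v.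
  by rewrite mem_undup mem_filter => /andP[].
have gS v : v \in S -> m%:R * g v != 0 /\ v (m%:R * g v) <= 1.
  move=> vS; have [hv uv _] := SP v vS; rewrite (absvalM hv) /g.
  case: ifP => vS0; last by rewrite mulr1 absval1 // mulr1; split=> //; apply: ultra_nat.
  have [_ gv] := S0P v vS0; rewrite mulf_neq0 //; split=> //.
  by rewrite -ler_pdivlMr ?absval_gt0 // mul1r mS0.
have prodg : \prod_(v <- S) v (g v) = \prod_(v <- S0) v (g0 v).
  rewrite big_cat /= [X in _ * X]big_seq [X in _ * X]big1 ?mulr1; last first.
    move=> v; rewrite /g mem_undup mem_filter => /andP[/negbTE -> /sP[[hv _ _] _]].
    exact: absval1.
  by rewrite !big_seq; apply: eq_bigr => v vS0; rewrite /g vS0.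
have infabs v : v \in Inf -> is_absval v by move=> /InfP/infinite_place_absval.
have SInf v : v \in S -> v \notin Inf.
  move=> /SP[hv uv _]; apply/negP => /InfP vI; have := infinite_place_nat 2 vI.
  have := ultra_nat hv uv 2 => + e; rewrite e leNgt => /negP; apply.
  by rewrite exprn_egt1 ?ltr1n // /place_degree; case: ifP.
have vm0 v : v \in Inf -> 0 < v m%:R by move=> /infabs hv; rewrite absval_gt0.
(* Q is so large that the precision required at each infinite place is at most the size of the box,
   as [infinite_net] demands. *)
have [Q [Q0 HQ]] : exists Q : nat, (0 < Q)%N /\ forall v, v \in Inf ->
    v m%:R * l v <= K v * Q%:R ^+ place_degree v.
  have [k Hk] : exists k, forall v, v \in Inf -> forall j, (k <= j)%N -> v m%:R * l v <= j%:R.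
    apply: (@eventually_all _ Inf (fun v j => v m%:R * l v <= j%:R)) => v vI.
    have pos : 0 <= v m%:R * l v by rewrite mulr_ge0 // ltW ?vm0 ?l0.
    exists (Num.truncn (v m%:R * l v)).+1 => j kj.
    have /andP[_ /ltW h] := truncn_itv pos; by rewrite (le_trans h) // ler_nat.
  exists k.+1; split=> // v vI; apply: le_trans (Hk v vI k.+1 (leqnSn k)) _.
  rewrite -[leLHS]mul1r ler_pM ?ler0n // ?K1 //.
  by rewrite /place_degree; case: ifP => _; rewrite ?expr1 // ler_eXnr // ler1n.
pose A v : R := if v \in Inf then K v * Q%:R ^+ place_degree v else 1.
pose d v : R := if v \in Inf then v m%:R * l v else v (m%:R * g v).
pose kb v : R := if v \in Inf then 36 * (K v * Q%:R ^+ place_degree v) / (v m%:R * l v)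
   else (v (m%:R * g v))^-1.
have /choice[k Hk] v : exists k, v \in S ++ Inf -> net v (A v) (d v) k /\ k%:R <= kb v.
  have [vL|//] := boolP (v \in S ++ Inf); last by exists 0%N.
  rewrite /A /d /kb; move: vL; rewrite mem_cat => /orP[vS|vI].
    have [g1 g2] := gS v vS; have [k nk kE] := finite_place_net (SP v vS) g1 g2.
    by exists k; rewrite (negbTE (SInf v vS)) kE.
  have [||k nk kE] := @infinite_net v (K v * Q%:R ^+ place_degree v) (v m%:R * l v) vI.
  - by rewrite mulr_gt0 ?vm0 ?l0.
  - exact: HQ.
  by exists k; rewrite vI.
pose h (c : {ffun 'I_D -> 'I_Q.+1}) : F := \sum_i ((c i : nat)%:Z)%:~R * w i.
have hinj : injective h.
  move=> c1 c2 e; apply/ffunP => i; apply/val_inj.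
  have cc0 : \sum_i ((c1 i : nat)%:Z - (c2 i : nat)%:Z)%:~R * w i = 0.
    under eq_bigr => j _ do rewrite intrB mulrBl.
    by rewrite sumrB -/(h c1) -/(h c2) e subrr.
  have /eqP := wfree (fun i => (c1 i : nat)%:Z - (c2 i : nat)%:Z) cc0 i.
  by rewrite subr_eq0 eqz_nat => /eqP.
pose X := [seq h c | c : {ffun 'I_D -> 'I_Q.+1}].
have uX : uniq X by rewrite map_inj_uniq ?enum_uniq.
have hfin c v : finite_absval v -> v (h c) <= 1.
  move=> [hv uv _]; apply: (ultra_sum hv uv) => // i _.
  rewrite (absvalM hv) mulr_ile1 ?(absval_ge0 hv) ?ultra_int //.
  by have [f fm fr] := wint i; apply: ultra_root fr.
have hinf c v : v \in Inf -> v (h c) <= K v * Q%:R ^+ place_degree v.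
  move=> vI; have [_ H] := HK v vI; apply: H => i.
  by rewrite /= lez_nat -ltnS ltn_ord.
have [x [y [xX yX xy close]]] : exists x y, [/\ x \in X, y \in X, x != y &
    forall v, v \in S ++ Inf -> v (x - y) <= d v].
  apply: contrapT => hno.
  have : (size X <= \prod_(v <- S ++ Inf) k v)%N.
    apply: (@size_le_net _ _ _ A d) => // [v /Hk[]//|_ v /mapP[c _ ->]|x y xX yX close].
      rewrite /A mem_cat => /orP[vS|vI]; last by rewrite vI; apply: hinf.
      by rewrite (negbTE (SInf v vS)); apply/hfin/SP.
    by apply/eqP; apply: contraT => xy; case: hno; exists x, y.
  (* There are (Q + 1)^D combinations for at most Q^D cells. *)
  rewrite size_map -cardE card_ffun !card_ord -(ler_nat R) leNgt => /negP; apply.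
  apply: (@le_lt_trans _ _ (Q%:R ^+ D)); last first.
    by rewrite natrX ltr_pXn2r ?nnegrE ?ltr_nat // dim_gt0.
  rewrite natr_prod; apply: (@le_trans _ _ (\prod_(v <- S ++ Inf) kb v)).
    by rewrite !big_seq; apply: ler_prod => v /Hk[_ ->]; rewrite ler0n.
  rewrite big_cat /=.
  have -> : \prod_(v <- S) kb v = (\prod_(v <- S) (v m%:R)^-1) * (\prod_(v <- S0) v (g0 v))^-1.
    rewrite -prodg -prodfV -big_split /= big_seq [RHS]big_seq; apply: eq_bigr => v vS.
    have [hv _ _] := SP v vS.
    by rewrite /kb (negbTE (SInf v vS)) (absvalM hv) invfM.
  have -> : \prod_(v <- Inf) kb v = \prod_(v <- Inf) (36 * K v) * Q%:R ^+ D *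
      ((m%:R ^+ D)^-1 * (\prod_(v <- Inf) l v)^-1).
    have -> : D = (\sum_(v <- Inf) place_degree v)%N by rewrite sum_place_degree.
    rewrite -!prodrXr -!prodfV -!big_split /=.
    rewrite big_seq [RHS]big_seq; apply: eq_bigr => v vI.
    by rewrite /kb vI -(infinite_place_nat m (proj1 (InfP v) vI)) invfM mulrA.
  have pS : 0 < \prod_(v <- S0) v (g0 v).
    rewrite big_seq; apply: prodr_gt0 => v /S0P[[hv _ _] gv]; by rewrite absval_gt0.
  have pl : 0 < \prod_(v <- Inf) l v by rewrite big_seq; apply: prodr_gt0.
  have mD : 0 < (m%:R : R) ^+ D by rewrite exprn_gt0 // ltr0n.
  (* Scaling by m multiplies the number of cells by at most m^D at the finite places and divides it
     by m^D at the infinite ones. *)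
  have := prod_finite_nat m0 uS SP; rewrite -/D.
  move: Cle pS pl mD; set c1 := \prod_(v <- Inf) (36 * K v); set c2 := \prod_(v <- Inf) l v.
  set c3 := \prod_(v <- S0) _; set c4 := \prod_(v <- S) _; set c5 := m%:R ^+ D; set c6 := Q%:R ^+ D.
  move=> Cle pS pl mD c45.
  have -> : c4 / c3 * (c1 * c6 * (c5^-1 / c2)) = (c4 / c5) * (c1 / (c2 * c3)) * c6.
    by move: c1 c2 c3 c4 c5 c6 pS pl mD {Cle c45} => c1 c2 c3 c4 c5 c6 *; field; rewrite !gt_eqF.
  rewrite -[leRHS]mul1r ler_wpM2r ?exprn_ge0 ?ler0n //.
  have c40 : 0 <= c4.
    by rewrite /c4 big_seq; apply: prodr_ge0 => v /SP[hv _ _]; rewrite invr_ge0 (absval_ge0 hv).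
  have c10 : 0 <= c1.
    rewrite /c1 big_seq; apply: prodr_ge0 => v vI; by rewrite mulr_ge0 // (le_trans _ (K1 v vI)).
  apply: mulr_ile1; rewrite ?divr_ge0 ?mulr_ge0 ?(ltW pS) ?(ltW pl) ?(ltW mD) //.
    by rewrite ler_pdivrMr // mul1r.
  by rewrite ler_pdivrMr ?mulr_gt0 // mul1r.
exists ((x - y) / m%:R); first by rewrite mulf_neq0 ?invr_eq0 // subr_eq0.
split=> [v vS0|v fv vS0|v vI].
- have vS : v \in S by rewrite mem_cat vS0.
  have [hv _ _] := SP v vS; have := close v; rewrite mem_cat vS => /(_ isT).
  rewrite /d (negbTE (SInf v vS)) /g vS0 (absvalM hv) absval_div //.
  by rewrite ler_pdivrMr ?absval_gt0 // mulrC.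
- have [hv uv _] := fv; rewrite absval_div //.
  have [vS|vS] := boolP (v \in S).
    have := close v; rewrite mem_cat vS => /(_ isT).
    rewrite /d (negbTE (SInf v vS)) /g (negbTE vS0) mulr1.
    by rewrite ler_pdivrMr ?absval_gt0 // mul1r.
  rewrite (Sm v fv vS) divr1 (le_trans (ultraB hv uv _ _)) // ge_max.
  by move: xX yX => /mapP[c _ ->] /mapP[c' _ ->]; rewrite !hfin.
have hv := infabs v vI; have := close v; rewrite mem_cat vI orbT => /(_ isT).
by rewrite /d vI absval_div // ler_pdivrMr ?vm0 // mulrC.
Qed.

End Minkowski.

(** * Local heights *)

Section PlaceNets.
Variables (R : realType) (F : fieldType).

Lemma net_scale (N : F -> R) (A l : R) k t : is_absval N -> t != 0 ->
  net N A l k -> net N (A * N t) (l * N t) k.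
Proof.
move=> hN t0 [c [c1 c2]]; have Nt : 0 < N t by rewrite absval_gt0.
exists (fun x => c (x / t)); split=> [x hx|x y hx hy e].
  by apply: c1; rewrite absval_div // ler_pdivrMr.
have := c2 (x / t) (y / t); rewrite -mulrBl !absval_div // !ler_pdivrMr //; exact.
Qed.

Lemma net_weaken (N : F -> R) (A A' l l' : R) k : A' <= A -> l <= l' ->
  net N A l k -> net N A' l' k.
Proof.
move=> hA hl [c [c1 c2]]; exists c; split=> [x hx|x y hx hy e].
  by apply: c1; apply: le_trans hA.
by apply: le_trans hl; apply: c2 => //; apply: le_trans hA.
Qed.

Lemma place_net (v : place R F) (A l : R) : 0 < l -> exists k, net v A l k.
Proof.
move=> l0; case: (placeP v) => [fv|rv|cv].
- have [hv uv [p [q [up rq vp]]]] := fv; have [p0 vp1 _] := up.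
  have pV : 1 < v p^-1 by rewrite absvalV // invf_gt1 // absval_gt0.
  have [K HK] := @expr_gt_bound R (v p^-1) A pV.
  have vt : 0 < v (p^-1 ^+ K) by rewrite absval_gt0 // expf_neq0 // invr_eq0.
  have lt0 : 0 < l / v (p^-1 ^+ K) by rewrite divr_gt0.
  have [n Hn] := expr_lt_eps (absval_ge0 hv p) vp1 lt0.
  exists (q ^ n)%N.
  have := net_scale hv (expf_neq0 K (invr_neq0 p0)) (finite_net hv uv up rq vp n).
  apply: net_weaken; first by rewrite mul1r absvalX // ltW // HK.
  by rewrite -ler_pdivlMr // ltW // Hn.
- have lA : l <= Num.max A l by rewrite le_max lexx orbT.
  have [k nk _] := @real_net R F v (Num.max A l) l rv l0 lA.
  by exists k; apply: net_weaken nk; rewrite ?le_max lexx.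
have lA : l <= Num.max A l by rewrite le_max lexx orbT.
have [k nk _] := @complex_net R F v (Num.max A l) l cv l0 lA.
by exists k; apply: net_weaken nk; rewrite ?le_max lexx.
Qed.

End PlaceNets.

(** * Compactness in a completion *)

Section Completion.
Variables (R : realType) (F : fieldType) (v : place R F) (Fv : completion v).

Lemma place_absval : is_absval v.
Proof.
have [h0 h1 h2 [C h3]] := cabsP Fv.
split=> [x|x|x y|]; rewrite -?(cabs_emb Fv) ?rmorphM //.
  by rewrite h1; split=> [/eqP|->]; rewrite ?rmorph0 // fmorph_eq0 => /eqP.
by exists C => x y; rewrite -!(cabs_emb Fv) rmorphD.
Qed.

Let hv := place_absval.
Let hc : is_absval (cabs Fv). Proof. exact: cabsP. Qed.

(** x is coded by the cell of a nearby element of F. Comparing two such x takes a sum of three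
    terms, so two uses of the weak triangle inequality, hence the precision l / C / C. *)
Lemma completion_net (A l : R) : 0 < l -> exists k, net (cabs Fv) A l k.
Proof.
move=> l0; have [C C1 HC] := absvalD_ge1 hc.
have C0 : 0 < C by apply: lt_le_trans C1.
have d0 : 0 < l / C / C by rewrite !divr_gt0.
have [k [c [c1 c2]]] := place_net v (C * Num.max A (l / C / C)) d0.
have /choice[y Hy] (x : Fv) : exists y, cabs Fv (x - cemb Fv y) < l / C / C by apply: cemb_dense.
have yA x : cabs Fv x <= A -> v (y x) <= C * Num.max A (l / C / C).
  move=> xA; rewrite -(cabs_emb Fv) -[cemb Fv _](subrK x) addrC.
  rewrite (le_trans (HC _ _)) // ler_pM2l // ge_max !le_max xA /=.
  by rewrite absvalB // (ltW (Hy x)) orbT.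
exists k, (c \o y); split=> [x /yA/c1//|x z xA zA e].
have h := c2 _ _ (yA x xA) (yA z zA) e.
have HC' a b e' : cabs Fv a <= e' / C -> cabs Fv b <= e' / C -> cabs Fv (a + b) <= e'.
  move=> ha hb; apply: le_trans (HC _ _) _.
  by rewrite -ler_pdivlMl // mulrC ge_max ha hb.
rewrite (_ : x - z = (x - cemb Fv (y x)) + (cemb Fv (y x - y z) + (cemb Fv (y z) - z))); last first.
  by rewrite rmorphB; ring.
apply: (HC').
  rewrite (le_trans (ltW (Hy x))) // ler_pdivrMr // ler_peMr // ltW // divr_gt0 //.
apply: (HC'); first by rewrite cabs_emb.
by rewrite absvalB // ltW.
Qed.

Section Compactness.
Variables (n : nat) (f : 'rV[Fv]_n -> R) (eta : R).
Hypotheses (f_cont : continuous_off0 f) (f_gt0 : forall x, x != 0 -> 0 < f x).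
Hypothesis eta0 : 0 < eta.

(* Every nonzero vector has a multiple here under the F_v^* action, for a suitable eta. *)
Let shell : set 'rV[Fv]_n :=
  [set x | (forall j, cabs Fv (x 0 j) <= 1) /\ exists j, eta <= cabs Fv (x 0 j)].

Let bad (S : set 'rV[Fv]_n) := forall c : R, 0 < c -> exists x, [/\ shell x, S x & f x < c].

(** [bad] says that f has no positive lower bound on the part of the shell in S. One of the finitely
    many cells inherits this, since otherwise the minimum of their lower bounds would serve for
    S. *)
Let bad_refine S (e : R) : 0 < e -> bad S -> exists S', [/\ bad S', S' `<=` S &
  forall x y, shell x -> shell y -> S' x -> S' y -> forall j, cabs Fv (x 0 j - y 0 j) <= e].
Proof.
move=> e0 badS; have [k [c [c1 c2]]] := completion_net 1 e0.
pose code (x : 'rV[Fv]_n) : {ffun 'I_n -> 'I_k.+1} := [ffun j => inord (c (x 0 j))].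
have codeE x y : shell x -> shell y -> code x = code y ->
    forall j, cabs Fv (x 0 j - y 0 j) <= e.
  move=> [sx _] [sy _] /ffunP exy j; apply: c2 => //.
  have := exy j; rewrite !ffunE => /(congr1 val); rewrite /= !inordK //.
    by rewrite ltnS ltnW // c1.
  by rewrite ltnS ltnW // c1.
have [[t bt]|nbt] := pselect (exists t, bad (S `&` [set x | code x = t])).
  exists (S `&` [set x | code x = t]); split=> [//|x []//|x y sx sy [_ xt] [_ yt]].
  by apply: codeE => //; rewrite xt yt.
exfalso.
have /choice[b Hb] (t : {ffun 'I_n -> 'I_k.+1}) : exists b : R, 0 < b /\
    forall x, shell x -> S x -> code x = t -> b <= f x.
  apply: contrapT => hno; apply: nbt; exists t => b b0.
  apply: contrapT => hx; apply: hno; exists b; split=> // x sx Sx xt.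
  by rewrite leNgt; apply/negP => fx; apply: hx; exists x.
have [|x [sx Sx]] := badS (\big[Num.min/1]_t b t).
  by apply: (big_ind (fun z => 0 < z)) => [//|p q p0 q0|t _]; [rewrite lt_min p0|case: (Hb t)].
rewrite ltNge => /negP; apply.
have [_ /(_ x sx Sx erefl)] := Hb (code x).
by move=> h; apply: le_trans h; apply: bigmin_le_cond.
Qed.

(** Otherwise refinement gives nested bad sets, of diameter at most 1 / (i + 1) within the shell,
    with points x_i where f is below 1 / (i + 1). They converge to some y, nonzero because each x_i
    has a coordinate of size at least [eta]; continuity then contradicts [f y > 0]. *)
Lemma shell_lower_bound : exists2 c : R, 0 < c & forall x : 'rV[Fv]_n,
  (forall j, cabs Fv (x 0 j) <= 1) -> (exists j, eta <= cabs Fv (x 0 j)) -> c <= f x.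
Proof.
apply: contrapT => hno.
have bad0 : bad setT.
  move=> c c0; apply: contrapT => hx; apply: hno; exists c => // x h1 h2.
  by rewrite leNgt; apply/negP => fx; apply: hx; exists x.
have inv0 i : 0 < (i.+1%:R)^-1 :> R by rewrite invr_gt0 ltr0n.
have /choice[g Hg] (Si : set 'rV[Fv]_n * nat) : exists S', bad Si.1 -> [/\ bad S', S' `<=` Si.1 &
  forall x y, shell x -> shell y -> S' x -> S' y ->
    forall j, cabs Fv (x 0 j - y 0 j) <= (Si.2.+1%:R)^-1].
  have [bS|nb] := pselect (bad Si.1); last by exists setT.
  by have [S' HS'] := bad_refine (inv0 Si.2) bS; exists S'.
pose S := fix S i := if i is i'.+1 then g (S i', i') else setT.
have badS i : bad (S i) by elim: i => [|i IH] //=; have [] := Hg (S i, i) IH.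
have subS i j : (i <= j)%N -> S j `<=` S i.
  move=> /subnK <-; elim: (j - i)%N => [|m IH] //; apply: subset_trans IH.
  by have [] := Hg (S (m + i)%N, (m + i)%N) (badS _).
have /choice[x Hx] i : exists x, [/\ shell x, S i.+1 x & f x < (i.+1%:R)^-1].
  exact: badS.
have close i j : (i <= j)%N -> forall l, cabs Fv (x i 0 l - x j 0 l) <= (i.+1%:R)^-1.
  move=> ij; have [_ _ H] := Hg (S i, i) (badS i).
  have [si Si _] := Hx i; have [sj Sj _] := Hx j.
  by apply: H => //; apply: (subS i.+1 j.+1).
have inv_small (e : R) : 0 < e -> exists m : nat, forall i, (m <= i)%N -> (i.+1%:R)^-1 < e.
  move=> e0; exists (Num.truncn e^-1) => i mi.
  have e1 : 0 <= e^-1 by rewrite invr_ge0 ltW.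
  have /andP[_ h] := truncn_itv e1.
  rewrite -[e]invrK ltf_pV2 ?posrE ?invr_gt0 ?ltr0n // (lt_le_trans h) // ler_nat.
  by rewrite ltnS.
have [C C1 HC] := absvalD_ge1 hc; have C0 : 0 < C by apply: lt_le_trans C1.
have /choice[l Hl] (j : 'I_n) : exists l, forall e : R, 0 < e -> exists m, forall i, (m <= i)%N ->
    cabs Fv (x i 0 j - l) < e.
  apply: cabs_complete => e e0.
  have [m Hm] := inv_small (e / C) (divr_gt0 e0 C0); exists m => i i' mi mi'.
  have le12 := close _ _ mi j; have le13 := close _ _ mi' j.
  rewrite (_ : _ - _ = (x i 0 j - x m 0 j) + (x m 0 j - x i' 0 j)); last by ring.
  apply: le_lt_trans (HC _ _) _; rewrite -ltr_pdivlMl // mulrC gt_max.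
  by rewrite absvalB // !(le_lt_trans _ (Hm m (leqnn m))).
pose y := \row_j l j.
have Hy (e : R) : 0 < e -> exists m, forall i, (m <= i)%N -> forall j, cabs Fv (x i 0 j - y 0 j) < e.
  move=> e0.
  have [K HK] : exists K, forall j, j \in enum 'I_n -> forall k, (K <= k)%N ->
      cabs Fv (x k 0 j - y 0 j) < e.
    apply: (@eventually_all _ (enum 'I_n) (fun j k => cabs Fv (x k 0 j - y 0 j) < e)) => j _.
    by have [m Hm] := Hl j e e0; exists m => k mk; rewrite mxE; apply: Hm.
  by exists K => i Ki j; apply: HK => //; rewrite mem_enum.
have y0 : y != 0.
  apply/eqP => y0; have [m Hm] := Hy eta eta0.
  have [[_ [j hj]] _ _] := Hx m; move: hj; rewrite leNgt => /negP; apply.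
  by have := Hm m (leqnn m) j; rewrite y0 mxE subr0.
have fy := f_gt0 y0; have fy2 : 0 < f y / 2 by rewrite divr_gt0.
have [r r0 Hr] := f_cont y0 fy2.
have [m Hm] := Hy r r0; have [m' Hm'] := inv_small (f y / 2) fy2.
have [sx _ fx] := Hx (maxn m m').
have xn0 : x (maxn m m') != 0.
  have [_ [j hj]] := sx; apply/eqP => h; move: hj; rewrite h mxE absval0 // leNgt eta0 //.
have := Hr _ xn0 (Hm _ (leq_maxl m m')).
have := Hm' _ (leq_maxr m m').
rewrite ltr_norml => h1 /andP[h2 _]; have h4 := lt_trans fx h1.
by move: h2; rewrite ltrBrDr addrC {1}(splitr (f y)) addrK => /(lt_trans h4); rewrite ltxx.
Qed.

End Compactness.
End Completion.

Lemma ler_ltXz2l (R : realType) (t : R) (m k : int) : 0 < t -> t < 1 ->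
  (t ^ m <= t ^ k) = (k <= m).
Proof.
move=> t0 t1; have e (j : int) : t ^ j = t^-1 ^ (- j) by rewrite exprz_inv opprK.
by rewrite (e m) (e k) ler_eXz2l ?lerN2 // invf_gt1.
Qed.

(** * Local heights compared with an element of F *)

Section LocalHeight.
Variables (R : realType) (F : fieldType) (v : place R F) (Fv : completion v).
Variables (n : nat) (a : 'I_n -> nat).
Hypothesis a_gt0 : forall j, (0 < a j)%N.

Let hv : is_absval v. Proof. exact: place_absval. Qed.
Let hc : is_absval (cabs Fv). Proof. exact: cabsP. Qed.

(** Take h = t^(-r) with r the least integer such that |x_j| <= |t|^(-r a_j) for all j. Acting by
    t^r puts x in the shell: by minimality some coordinate of the result exceeds |t|^a_j, hence
    |t|^|a|, the [eta] used. Homogeneity carries the bound of [shell_lower_bound] back to x. *)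
Lemma local_lower_bound (d : R) (f : 'rV[Fv]_n -> R) (t : F) :
  homogeneous a d f -> continuous_off0 f -> (forall x, x != 0 -> 0 < f x) ->
  0 < v t -> v t < 1 ->
  exists2 c : R, 0 < c & forall x : 'rV[Fv]_n, x != 0 -> exists2 h : F, h != 0 &
    (forall j, cabs Fv (x 0 j) <= v h ^+ a j) /\ c * v h `^ d <= f x.
Proof.
move=> [_ fhom] fcont f0 t0 t1.
have tn0 : t != 0 by rewrite -(absval_gt0 hv).
have tz k : 0 < v t ^ k by rewrite exprz_gt0.
have [c c0 Hc] := shell_lower_bound fcont f0 (exprn_gt0 (wsize a) t0).
exists c => // x x0.
pose P (r : int) := forall j, cabs Fv (x 0 j) <= (v t ^ (- r)) ^+ a j.
have [K PK] : exists K : nat, P K%:Z.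
  have [K HK] : exists K, forall j, j \in enum 'I_n -> forall k, (K <= k)%N ->
      cabs Fv (x 0 j) <= ((v t)^-1 ^+ k) ^+ a j.
    apply: (@eventually_all _ (enum 'I_n) (fun j k => cabs Fv (x 0 j) <= ((v t)^-1 ^+ k) ^+ a j)) => j _.
    have vtV : 1 < (v t)^-1 by rewrite invf_gt1.
    have [K HK] := @expr_gt_bound R (v t)^-1 (cabs Fv (x 0 j)) vtV.
    exists K => k /HK h; rewrite (le_trans (ltW h)) // -exprM ler_weXn2l ?(ltW vtV) //.
    by rewrite leq_pmulr.
  exists K => j; rewrite -exprz_inv -exprnP; apply: HK => //; exact: mem_enum.
have [j0 xj0] : exists j, x 0 j != 0.
  apply: contrapT => hno; move/eqP: x0; apply; apply/rowP => j; rewrite mxE.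
  by apply/eqP; apply: contraT => xj; case: hno; exists j.
have [K' nPK'] : exists K' : nat, ~ P (- K'%:Z).
  have xj : 0 < cabs Fv (x 0 j0) by rewrite absval_gt0.
  have [K' HK'] := expr_lt_eps (ltW t0) t1 xj.
  exists K' => /(_ j0); rewrite opprK -exprnP -exprM leNgt => /negP; apply.
  by apply: HK'; rewrite leq_pmulr.
(* The search for the least r is shifted by K' so as to run over the naturals; at k = 0 the property
   fails. *)
have ex : exists k : nat, `[< P (k%:Z - K'%:Z) >].
  exists (K + K')%N; apply/asboolP; rewrite PoszD addrK; exact: PK.
case: (ex_minnP ex) => -[|k] /asboolP Pk kmin; first by case: nPK'; rewrite sub0r in Pk.
have nPk : ~ P (k%:Z - K'%:Z).
  by move=> h; have := kmin k; rewrite ltnn => /(_ (asboolT h)).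
set r := k.+1%:Z - K'%:Z in Pk.
have rE : k%:Z - K'%:Z = r - 1 by rewrite /r -addn1 PoszD addrAC addrK.
rewrite rE in nPk.
have tr0 : t ^ r != 0 by rewrite expfz_neq0.
exists (t ^ (- r)); first by rewrite expfz_neq0.
have vh : v (t ^ (- r)) = v t ^ (- r) by rewrite absvalZ.
rewrite vh; split; first exact: Pk.
set u := cemb Fv (t ^ r).
have u0 : u != 0 by rewrite fmorph_eq0.
have cu : cabs Fv u = v t ^ r by rewrite cabs_emb absvalZ.
have xE j : cabs Fv (wact a u x 0 j) = (v t ^ r) ^+ a j * cabs Fv (x 0 j).
  by rewrite mxE (absvalM hc) absvalX // cu.
have trV : v t ^ (- r) = (v t ^ r)^-1 by rewrite invr_expz.
have cf : c <= f (wact a u x).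
  apply: Hc => [j|].
    rewrite xE -ler_pdivlMl ?exprn_gt0 // mulr1 -exprVn -trV; exact: Pk.
  apply: contrapT => hno; apply: nPk => j; apply: contrapT => /negP; rewrite -ltNge => hj.
  apply: hno; exists j; rewrite xE -ler_pdivrMl ?exprn_gt0 // (le_trans _ (ltW hj)) //.
  have -> : v t ^ (- (r - 1)) = (v t ^ r)^-1 * v t.
    by rewrite opprB addrC expfzDr ?gt_eqF // expr1z trV.
  rewrite exprMn exprVn ler_wpM2l ?invr_ge0 ?exprn_ge0 ?(ltW (tz r)) //.
  rewrite ler_wiXn2l ?(ltW t0) ?(ltW t1) //.
  by rewrite /wsize (bigD1 j) //= leq_addr.
rewrite (fhom u x u0 x0) cu in cf.
have : c * (v t ^ (- r)) `^ d <= (v t ^ r) `^ d * f x * (v t ^ (- r)) `^ d.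
  by rewrite ler_wpM2r ?powR_ge0.
move=> h; apply: le_trans h _; rewrite mulrAC -powRM ?exprz_ge0 ?(ltW t0) //.
by rewrite trV divff ?powR1 ?mul1r // gt_eqF.
Qed.

Section Toric.
Variable p : F.
Hypotheses (fv : finite_absval v) (up : uniformizer v p).

Let p0 : p != 0. Proof. by case: up. Qed.
Let vp1 : v p < 1. Proof. by case: up. Qed.
Let vp0 : 0 < v p. Proof. by rewrite absval_gt0. Qed.

Lemma cabs_expn_near1 (C : R) : 1 <= C ->
    (forall x y, cabs Fv (x + y) <= C * Num.max (cabs Fv x) (cabs Fv y)) ->
  forall k (e : R), 0 < e -> exists2 d : R, 0 < d &
    forall z : Fv, cabs Fv (z - 1) < d -> cabs Fv (z ^+ k - 1) <= e.
Proof.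
move=> C1 HC; have C0 : 0 < C by apply: lt_le_trans C1.
elim=> [|k IH] e e0; first by exists 1 => // z _; rewrite expr0 subrr absval0 // ltW.
have [|d1 d10 H1] := IH (Num.min 1 (e / C)); first by rewrite lt_min ltr01 divr_gt0.
exists (Num.min d1 (e / C / C)) => [|z]; first by rewrite lt_min d10 !divr_gt0.
rewrite lt_min => /andP[/H1]; rewrite le_min => /andP[h1 h2] h3.
rewrite (_ : _ - 1 = z ^+ k * (z - 1) + (z ^+ k - 1)); last by rewrite exprS; ring.
apply: le_trans (HC _ _) _; rewrite [e in leRHS](_ : e = C * (e / C)); last by rewrite mulrC divfK ?gt_eqF.
rewrite ler_pM2l // ge_max h2 andbT (absvalM hc).
have zk : cabs Fv (z ^+ k) <= C.
  rewrite -[z ^+ k](subrK 1) (le_trans (HC _ _)) // ger_pMr // ge_max h1 absval1 //=.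
rewrite -[leRHS](divfK (lt0r_neq0 C0)) mulrC ler_pM ?(absval_ge0 hc) //; exact: ltW.
Qed.

(* The absolute value of a completion is only known to satisfy |x + y| <= C max(|x|, |y|), so
   approximating x by y in F does not give |x| = |y|; but k-th powers turn C into C^(1/k). *)
Lemma completion_value x : x != 0 -> exists k : int, cabs Fv x = v p ^ k.
Proof.
have [C C1 HC] := absvalD_ge1 hc; have C0 : 0 < C by apply: lt_le_trans C1.
(* No value lies strictly between v p and 1. For y in F close to u, the k-th power of v y / |u| lies
   between 1/C and C; but v y is at least 1 or at most v p, so for k large this power is above C or
   below 1/C. *)
have gap u : v p < cabs Fv u -> cabs Fv u < 1 -> False.
  move=> pu u1; have u0 : 0 < cabs Fv u by apply: lt_trans pu.
  have un0 : u != 0 by rewrite -(absval_gt0 hc).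
  have up1 : 1 < cabs Fv u / v p by rewrite ltr_pdivlMr ?mul1r.
  have uV1 : 1 < (cabs Fv u)^-1 by rewrite invf_gt1.
  have [k1 Hk1] := expr_gt_bound C up1.
  have [k2 Hk2] := expr_gt_bound C uV1.
  pose k := maxn k1 k2.
  (* With this precision C |z^k - 1| is at most 1/2, so in the bound for |1| the maximum has to come
     from z^k. *)
  have e0 : 0 < (2 * C)^-1 by rewrite invr_gt0 mulr_gt0.
  have e1 : (2 * C)^-1 <= 1 by rewrite invf_le1 ?mulr_gt0 //; lra.
  have [d d0 Hd] := cabs_expn_near1 C1 HC k e0.
  have [y Hy] := cemb_dense u (mulr_gt0 d0 u0).
  pose z := cemb Fv y / u.
  have zd : cabs Fv (z - 1) < d.
    rewrite (_ : z - 1 = (cemb Fv y - u) / u); last by rewrite mulrBl divff.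
    by rewrite absval_div // ltr_pdivrMr // absvalB.
  have zk1 := Hd z zd.
  have zkC : cabs Fv (z ^+ k) <= C.
    rewrite -[z ^+ k](subrK 1) (le_trans (HC _ _)) // ger_pMr // ge_max absval1 // lexx andbT.
    exact: le_trans zk1 e1.
  have Czk : 1 <= C * cabs Fv (z ^+ k).
    have := HC (z ^+ k) (1 - z ^+ k); rewrite addrC subrK absval1 // [cabs Fv (1 - _)]absvalB //.
    rewrite maxr_pMr ?(ltW C0) // le_max => /orP[//|].
    move=> h; have := le_trans h (ler_wpM2l (ltW C0) zk1).
    rewrite invfM mulrCA divff ?gt_eqF // mulr1 => h2.
    by exfalso; lra.
  have vyz : cabs Fv (z ^+ k) = (v y / cabs Fv u) ^+ k.
    by rewrite absvalX // absval_div // cabs_emb.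
  have y0 : y != 0.
    apply/eqP => y0; move: Czk; rewrite vyz y0 absval0 // mul0r.
    have k0 : (0 < k)%N.
      rewrite lt0n; apply/eqP => k0; have := Hk2 0%N; move: k0; rewrite /k => /eqP.
      rewrite -leqn0 geq_max => /andP[_]; rewrite leqn0 => /eqP ->.
      move=> /(_ isT); rewrite expr0 ltNge C1 //.
    by rewrite expr0n; case: (k) k0 => // k' _; rewrite mulr0 ler10.
  have [hvv uv _] := fv.
  have [i vyi] := uniformizer_exp hv up y0.
  have [i0|i0] := leP i 0.
    have vy1 : 1 <= v y by rewrite vyi -(expr0z (v p)) ler_ltXz2l.
    have := zkC; rewrite vyz leNgt => /negP; apply.
    apply: lt_le_trans (Hk2 k (leq_maxr _ _)) _.
    rewrite lerXn2r ?nnegrE ?invr_ge0 ?divr_ge0 ?(ltW u0) ?(absval_ge0 hv) //.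
    by rewrite ler_peMl // invr_ge0 ltW.
  have vyp : v y <= v p by rewrite vyi -{2}(expr1z (v p)) ler_ltXz2l // -gtz0_ge1.
  have := Czk; rewrite vyz leNgt => /negP; apply.
  have : C < (cabs Fv u / v y) ^+ k.
    apply: lt_le_trans (Hk1 k (leq_maxl _ _)) _.
    rewrite lerXn2r ?nnegrE ?divr_ge0 ?(ltW u0) ?(absval_ge0 hv) //.
    by rewrite ler_pM2l // lef_pV2 ?posrE // absval_gt0.
  rewrite -[_ / v y]invf_div exprVn -[C < _](@ltr_pM2r _ ((v y / cabs Fv u) ^+ k)).
    by rewrite mulVf // gt_eqF // exprn_gt0 // divr_gt0 // absval_gt0.
  by rewrite exprn_gt0 // divr_gt0 // absval_gt0.
have main y : y != 0 -> cabs Fv y <= 1 -> exists k : nat, cabs Fv y = v p ^+ k.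
  move=> y0 Ny; have Ny0 : 0 < cabs Fv y by rewrite absval_gt0.
  have [m Hm] := expr_lt_eps (ltW vp0) vp1 Ny0.
  have ex : exists k, v p ^+ k < cabs Fv y by exists m; apply: Hm.
  case: (ex_minnP ex) => -[|k] hk kmin; first by move: hk; rewrite expr0 ltNge Ny.
  have Nyk : cabs Fv y <= v p ^+ k by rewrite leNgt; apply/negP => /kmin; rewrite ltnn.
  exists k; apply/eqP; rewrite eq_le Nyk /= leNgt; apply/negP => lt.
  apply: (gap (y / cemb Fv (p ^+ k))); rewrite absval_div // cabs_emb absvalX //.
    by rewrite ltr_pdivlMr ?exprn_gt0 // -exprS.
  by rewrite ltr_pdivrMr ?exprn_gt0 // mul1r.
move=> x0; have [Nx|/ltW Nx] := leP (cabs Fv x) 1.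
  by have [k ->] := main x x0 Nx; exists k.
have [||k hk] := main x^-1; first by rewrite invr_eq0.
  by rewrite absvalV // invf_le1 // absval_gt0.
by exists (- k%:Z); rewrite -invr_expz -exprnP -hk absvalV // invrK.
Qed.

(** [unif] is an arbitrary choice, but each of two uniformizers is a multiple of the other in the
    valuation ring, and p remains one in the completion because [completion_value] allows no new
    values. *)
Lemma cabs_unif : cabs Fv (unif Fv) = v p.
Proof.
have cp : uniformizer (cabs Fv) (cemb Fv p).
  split; [by rewrite fmorph_eq0|by rewrite cabs_emb|] => x x1.
  exists (x / cemb Fv p); last by rewrite mulrC divfK // fmorph_eq0.
  rewrite /valring /= absval_div // cabs_emb ler_pdivrMr // mul1r.
  have [->|x0] := eqVneq x 0; first by rewrite absval0 // ltW.
  have [k xk] := completion_value x0; rewrite xk -{2}(expr1z (v p)) ler_ltXz2l //.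
  rewrite -gtz0_ge1 ltNge; apply/negP => k0; move: x1; rewrite xk ltNge => /negP; apply.
  by rewrite -(expr0z (v p)) ler_ltXz2l.
have [u0 u1 uH] : uniformizer (cabs Fv) (unif Fv) by exact: (xgetI 0 cp).
have [_ p1 pH] := cp.
apply/eqP; rewrite eq_le; apply/andP; split.
  have [y Vy ->] := pH _ u1; rewrite (absvalM hc) cabs_emb ler_piMr // ltW //.
have [y Vy e] := uH _ p1; rewrite -(cabs_emb Fv) e (absvalM hc) ler_piMr //.
exact: absval_ge0.
Qed.

Lemma cabs_valuation x : x != 0 -> cabs Fv x = v p ^ (valuation x).
Proof.
move=> x0; rewrite /valuation cabs_unif.
by case: xgetP => [k _ //|no]; have [k hk] := completion_value x0; case: (no k).
Qed.

(** h = p^(-r), with r the toric exponent of x, attained since there are finitely many coordinates;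
    the ceiling makes r the least integer with |x_j| <= |h|^a_j for all j. The last clause makes |h|
    = 1 at almost all places. *)
Lemma toric_lift (d : R) (x : 'rV[Fv]_n) : x != 0 -> exists2 h : F, h != 0 &
  [/\ forall j, cabs Fv (x 0 j) <= v h ^+ a j, toric a d x = v h `^ d &
   (forall j, x 0 j != 0 -> cabs Fv (x 0 j) = 1) -> v h = 1].
Proof.
move=> x0; have [j0 xj0] : exists j, x 0 j != 0.
  apply: contrapT => hno; move/eqP: x0; apply; apply/rowP => j; rewrite mxE.
  by apply/eqP; apply: contraT => xj; case: hno; exists j.
pose c j : int := Num.ceil (- (valuation (x 0 j))%:~R / (a j)%:R : R).
have [j xj cmax] : exists2 j, x 0 j != 0 & forall i, x 0 i != 0 -> c i <= c j.
  by case: (@Order.TotalTheory.arg_maxP _ _ _ j0 (fun j => x 0 j != 0) c xj0) => j xj cj; exists j.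
have rE : toric_exponent a x = (c j)%:~R.
  apply/eqP; rewrite eq_le; apply/andP; split.
    apply: ge_sup; first by exists (c j)%:~R; exists j.
    by move=> _ [i xi <-]; rewrite ler_int; apply: cmax.
  apply: ub_le_sup; last by exists j.
  by exists (c j)%:~R => _ [i xi <-]; rewrite ler_int; apply: cmax.
have vh : v (p ^ (- c j)) = v p ^ (- c j) by rewrite absvalZ.
exists (p ^ (- c j)); first by rewrite expfz_neq0.
split.
- move=> i; have [->|xi] := eqVneq (x 0 i) 0.
    by rewrite absval0 // exprn_ge0 // (absval_ge0 hv).
  rewrite cabs_valuation // vh [_ ^+ a i]exprnP exprz_exp ler_ltXz2l //.
  have := cmax i xi; rewrite /c ceil_le_int ler_pdivrMr ?ltr0n //.
  rewrite lerNl => h; rewrite -(ler_int R) intrM mulrNz mulNr; exact: h.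
- rewrite /toric cabs_unif rE vh -powR_intmul ?(ltW vp0) // -powRrM mulrNz.
  by rewrite mulNr mulNr mulrC.
move=> H; rewrite vh (_ : c j = 0) ?oppr0 ?expr0z // /c.
have : valuation (x 0 j) = 0.
  apply: (@ieexprIz _ (v p)); rewrite ?lt_eqF // expr0z -cabs_valuation //; exact: H.
by move=> ->; rewrite oppr0 mul0r ceil0.
Qed.

End Toric.
End LocalHeight.

Lemma size_le_prod_coords (T : choiceType) n (X : seq 'rV[T]_n) (L : 'I_n -> seq T) :
  uniq X -> (forall j, uniq (L j)) -> (forall x j, x \in X -> x 0 j \in L j) ->
  (size X <= \prod_j size (L j))%N.
Proof.
move=> uX uL XL.
pose g (x : seq_sub X) : {dffun forall j : 'I_n, seq_sub (L j)} :=
  [ffun j => SeqSub (XL (ssval x) j (ssvalP x))].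
have gi : injective g.
  move=> x y /ffunP e; apply/val_inj/rowP => j.
  by have := congr1 (@ssval _ _) (e j); rewrite !ffunE.
have := leq_card g gi; rewrite card_seq_sub // card_dep_ffun => /leq_trans; apply.
rewrite foldrE big_image /= leq_eqVlt; apply/orP; left; apply/eqP.
by apply: eq_bigr => j _; rewrite card_seq_sub.
Qed.

Lemma prod_powR (R : realType) (I : eqType) (s : seq I) (G : I -> R) (d : R) :
  (forall i, i \in s -> 0 <= G i) -> \prod_(i <- s) G i `^ d = (\prod_(i <- s) G i) `^ d.
Proof.
elim: s => [|i s IH] Gs; first by rewrite !big_nil powR1.
rewrite !big_cons IH => [|j js]; last by apply: Gs; rewrite inE js orbT.
rewrite powRM ?Gs ?mem_head // big_seq; apply: prodr_ge0 => j js.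
by apply: Gs; rewrite inE js orbT.
Qed.

Section Weights.
Variables (n : nat) (a : 'I_n -> nat).

Lemma wmin_le j : (wmin a <= a j)%N.
Proof.
rewrite /wmin; have : j \in index_enum 'I_n by rewrite mem_index_enum.
elim: (index_enum _) => [//|i s IH]; rewrite inE big_cons geq_min => /predU1P[->|/IH ->].
  by rewrite leqnn.
by rewrite orbT.
Qed.

Lemma le_wsize j : (a j <= wsize a)%N.
Proof. by rewrite /wsize (bigD1 j) //= leq_addr. Qed.

Variable F : fieldType.

Lemma lift_pt_neq0 (x : wpoints a F) : lift_pt x != 0.
Proof. exact: (valP (repr x)). Qed.

Lemma lift_pt_inj (x y : wpoints a F) (t u : F) : t != 0 -> u != 0 ->
  wact a t (lift_pt x) = wact a u (lift_pt y) -> x = y.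
Proof.
move=> t0 u0 e; rewrite -(reprK x) -(reprK y); apply/eqquotP; apply/asboolP.
exists (t / u); first by rewrite mulf_neq0 ?invr_eq0.
apply/rowP => j; have := congr1 (fun z : 'rV[F]_n => z 0 j) e; rewrite !mxE /lift_pt.
by rewrite exprMn exprVn mulrAC => ->; rewrite mulrAC mulfV ?expf_neq0 // mul1r.
Qed.

End Weights.

(** * Counting lifts *)

Section Counting.
Variables (R : realType) (F : fieldExtType rat).
Variable Fv : forall v : place R F, completion v.
Variables (n : nat) (a : 'I_n -> nat).
Hypothesis a_gt0 : forall j, (0 < a j)%N.
Hypothesis n_ge1 : (1 <= n)%N.
Variable f : forall v : place R F, 'rV[Fv v]_n -> R.
Hypothesis f_gt0 : forall v (x : 'rV[Fv v]_n), x != 0 -> 0 < f x.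
Hypothesis f_qt : quasi_toric a (wsize a)%:R f.
Variable Inf : seq (place R F).
Hypotheses (uInf : uniq Inf) (InfP : forall v, v \in Inf <-> real_absval v \/ complex_absval v).
Implicit Types (v : place R F) (B : R).

Let d : R := (wsize a)%:R.
Let D := \dim {:F}.

Lemma wsize_gt0 : (0 < wsize a)%N.
Proof. by apply: leq_trans (le_wsize a (Ordinal n_ge1)). Qed.

Let d0 : 0 < d. Proof. by rewrite ltr0n wsize_gt0. Qed.

Let hv v : is_absval v. Proof. exact: place_absval (Fv v). Qed.

Lemma not_Inf_finite v : v \notin Inf -> finite_absval v.
Proof.
by move=> vI; case: (placeP v) => // h; case/negP: vI; apply/InfP; [left|right].
Qed.

Lemma finite_not_Inf v : finite_absval v -> v \notin Inf.
Proof.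
move=> [_ uv _]; apply/negP => /InfP vI; have := infinite_place_nat 2 vI.
have := ultra_nat (hv v) uv 2 => + e; rewrite e leNgt => /negP; apply.
by rewrite exprn_egt1 ?ltr1n // /place_degree; case: ifP.
Qed.

Lemma exists_contraction v : exists t : F, 0 < v t /\ v t < 1.
Proof.
have [vI|/not_Inf_finite[_ _ [p [q [[p0 p1 _] _ _]]]]] := boolP (v \in Inf); last first.
  by exists p; rewrite absval_gt0.
exists (2%:R^-1); rewrite absval_gt0 // absvalV // infinite_place_nat; last exact/InfP.
rewrite invr_eq0 natF_eq0; split=> //; rewrite invf_lt1 ?exprn_gt0 // exprn_egt1 ?ltr1n //.
by rewrite /place_degree; case: ifP.
Qed.

(** [bad] gathers the infinite places and those where f is not toric. The last clause confines the
    product defining the height to finitely many places. *)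
Lemma local_data : exists (c : place R F -> R) (bad : seq (place R F)),
  [/\ uniq bad, {subset Inf <= bad}, forall v, 0 < c v & forall v, v \notin bad -> c v = 1] /\
  forall v (x : 'rV[Fv v]_n), x != 0 -> exists2 h : F, h != 0 &
    [/\ forall j, cabs (Fv v) (x 0 j) <= v h ^+ a j, c v * v h `^ d <= f x &
        v \notin bad -> (forall j, x 0 j != 0 -> cabs (Fv v) (x 0 j) = 1) ->
          v h = 1 /\ f x = 1].
Proof.
have [f_cont f_hom /finite_seqP[s sE]] := f_qt.
pose bad := undup (s ++ Inf).
have badP v : v \notin bad -> finite_absval v /\ forall x : 'rV[Fv v]_n, x != 0 -> f x = toric a d x.
  rewrite mem_undup mem_cat negb_or => /andP[vs /not_Inf_finite fv]; split=> // x x0.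
  apply: contrapT => hf; move/negP: vs; apply.
  have : [set` s] v by rewrite -sE; split=> // H; apply: hf; apply: H.
  by [].
have /choice[c Hc] v : exists c : R, [/\ 0 < c, v \notin bad -> c = 1 &
    forall x : 'rV[Fv v]_n, x != 0 -> exists2 h : F, h != 0 &
    [/\ forall j, cabs (Fv v) (x 0 j) <= v h ^+ a j, c * v h `^ d <= f x &
        v \notin bad -> (forall j, x 0 j != 0 -> cabs (Fv v) (x 0 j) = 1) ->
          v h = 1 /\ f x = 1]].
  have [vb|vb] := boolP (v \in bad).
    have [t [t0 t1]] := exists_contraction v.
    have [c c0 H] := local_lower_bound a_gt0 (f_hom v) (f_cont v) (@f_gt0 v) t0 t1.
    by exists c; split=> // x /H[h h0 [h1 h2]]; exists h.
  have [fv ft] := badP v vb; exists 1; split=> // x x0.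
  have [_ _ [p [q [up _ _]]]] := fv.
  have [h h0 [h1 h2 h3]] := toric_lift a_gt0 fv up d x0.
  exists h => //; split=> //; first by rewrite mul1r ft // h2.
  by move=> _ /h3 vh; rewrite ft // h2 vh powR1.
exists c, bad; split; first split; rewrite ?undup_uniq //.
- by move=> v vI; rewrite mem_undup mem_cat vI orbT.
- by move=> v; case: (Hc v).
- by move=> v vb; have [_ H _] := Hc v; apply: H.
by move=> v; case: (Hc v).
Qed.

Definition small_rep (T : R) (x : wpoints a F) (z : 'rV[F]_n) :=
  [/\ exists2 t, t != 0 & z = wact a t (lift_pt x),
      forall j v, finite_absval v -> v (z 0 j) <= 1 &
      forall j v, v \in Inf -> v (z 0 j) <= (T ^+ place_degree v) ^+ a j].

(** [exists_small_element] is applied to g_v = h_v^-1 and l_v = T^(deg v) / |h_v|. Its hypothesis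
    reads C P <= T^D, where P is the product of the |h_v|; the height is at least cb P^d, so P <= (B
    / cb)^(1/d). This dictates T. *)
Lemma exists_small_rep : exists2 C : R, 0 < C & forall B (x : wpoints a F), 0 < B ->
  height f x <= B -> exists z, small_rep ((C * B `^ d^-1) `^ (D%:R)^-1) x z.
Proof.
have [c [bad [[ubad Ibad c0 c1] Hloc]]] := local_data.
have [C C0 Hmink] := exists_small_element uInf InfP.
pose cb := \prod_(v <- bad) c v.
have cb0 : 0 < cb by apply: prodr_gt0.
exists (C * (cb^-1) `^ d^-1); first by rewrite mulr_gt0 ?powR_gt0 ?invr_gt0.
move=> B x B0 HB; set y := lift_pt x.
have yn0 : y != 0 by apply: lift_pt_neq0.
pose Y v : 'rV[Fv v]_n := map_mx (cemb (Fv v)) y.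
have Yn0 v : Y v != 0.
  apply/eqP => Y0; move/eqP: yn0; apply; apply/rowP => j.
  have := congr1 (fun z : 'rV[Fv v]_n => z 0 j) Y0; rewrite !mxE => /eqP.
  by rewrite fmorph_eq0 => /eqP.
have /choice[h Hh] v : exists h : F, h != 0 /\
    [/\ forall j, v (y 0 j) <= v h ^+ a j, c v * v h `^ d <= f (Y v) &
        v \notin bad -> (forall j, y 0 j != 0 -> v (y 0 j) = 1) -> v h = 1 /\ f (Y v) = 1].
  have [h h0 [h1 h2 h3]] := Hloc v (Y v) (Yn0 v); exists h; split=> //; split=> //.
    by move=> j; have := h1 j; rewrite mxE cabs_emb.
  move=> vb H; apply: h3 => // j; rewrite mxE cabs_emb fmorph_eq0; exact: H.
have h0 v : h v != 0 by case: (Hh v).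
have vh0 v : 0 < v (h v) by rewrite absval_gt0.
have [T0 HT0] : exists T0 : seq (place R F), forall v, finite_absval v ->
    (exists j, y 0 j != 0 /\ v (y 0 j) != 1) -> v \in T0.
  have /choice[s Hs] (j : 'I_n) : exists s : seq (place R F), y 0 j != 0 ->
      forall v, finite_absval v -> v (y 0 j) != 1 -> v \in s.
    have [yj|//] := boolP (y 0 j != 0); last by exists [::].
    have /finite_seqP[s sE] := @finite_places_neq1 R F _ yj.
    exists s => _ v fv vy; have : [set` s] v by rewrite -sE.
    by [].
  exists (flatten [seq s j | j <- enum 'I_n]) => v fv [j [yj vy]].
  by apply/flatten_mapP; exists j; rewrite ?mem_enum //; apply: Hs.
(* Outside this finite list the nonzero coordinates of y are units, so |h v| = 1 and f = 1 there. *)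
pose Sx := undup (T0 ++ bad).
have badS v : v \in bad -> v \in Sx by move=> vb; rewrite mem_undup mem_cat vb orbT.
have outS v : v \notin Sx -> [/\ finite_absval v, v \notin bad & forall j, y 0 j != 0 -> v (y 0 j) = 1].
  rewrite mem_undup mem_cat negb_or => /andP[vT vb].
  have fv : finite_absval v by apply: not_Inf_finite; apply: contra vb => /Ibad.
  split=> // j yj; apply/eqP; apply: contraT => vy; case/negP: vT.
  by apply: HT0 => //; exists j.
have outS1 v : v \notin Sx -> v (h v) = 1 /\ f (Y v) = 1.
  by move=> /outS[fv vb H]; have [_ [_ _ H3]] := Hh v; apply: H3.
have heightE : height f x = \prod_(v <- Sx) f (Y v).
  rewrite /height (@fsbigE _ _ _ _ _ Sx) ?undup_uniq //; last first.
    by move=> v _ /outS1[].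
  by under eq_bigl => v do rewrite in_setT.
have cS : \prod_(v <- Sx) c v = cb.
  rewrite (bigID (fun v => v \in bad)) /= [X in _ * X]big1 ?mulr1; last by move=> v /c1.
  rewrite -big_filter; apply: perm_big; apply: uniq_perm; rewrite ?filter_uniq ?undup_uniq // => v.
  by rewrite mem_filter; case vb : (v \in bad) => //=; apply: badS.
pose P := \prod_(v <- Sx) v (h v).
have P0 : 0 < P by apply: prodr_gt0 => v _; exact: vh0.
have PB : P `^ d <= B / cb.
  rewrite ler_pdivlMr // mulrC -cS /P -prod_powR; last by move=> v _; exact: ltW.
  rewrite -big_split /= (le_trans _ HB) // heightE; apply: ler_prod => v _.
  by have [_ [_ -> _]] := Hh v; rewrite andbT mulr_ge0 ?powR_ge0 // ltW.
have PB' : P <= (cb^-1) `^ d^-1 * B `^ d^-1.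
  rewrite -powRM ?invr_ge0 ?(ltW cb0) ?(ltW B0) // mulrC.
  have := @ge0_ler_powR R d^-1 _ _ _ _ _ PB.
  rewrite !nnegrE invr_ge0 !(ltW d0) powR_ge0 divr_ge0 ?(ltW B0) ?(ltW cb0) // => /(_ isT isT isT).
  by rewrite -powRrM mulfV ?gt_eqF // powRr1 // ltW.
set T := (_ `^ (D%:R)^-1).
have D0 : (0 < D)%N by apply: dim_gt0.
have TD : T ^+ D = C * (cb^-1) `^ d^-1 * B `^ d^-1.
  rewrite -powR_mulrn ?powR_ge0 // -powRrM mulVf ?pnatr_eq0 -?lt0n // powRr1 //.
  by rewrite !mulr_ge0 ?powR_ge0 // ltW.
have T0' : 0 < T by rewrite powR_gt0 // !mulr_gt0 ?powR_gt0 ?invr_gt0.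
pose Sf := [seq v <- Sx | v \notin Inf].
have SfP v : v \in Sf -> finite_absval v.
  by rewrite mem_filter => /andP[/not_Inf_finite].
have PE : P = \prod_(v <- Inf) v (h v) * \prod_(v <- Sf) v (h v).
  rewrite /P (bigID (fun v => v \in Inf)) /= -big_filter -[X in _ * X]big_filter; congr (_ * _).
  apply: perm_big; apply: uniq_perm; rewrite ?filter_uniq ?undup_uniq // => v.
  rewrite mem_filter; case vI : (v \in Inf) => //=; exact/badS/Ibad.
have [|v|v vI||t t0 [t1 t2 t3]] := Hmink Sf (fun v => (h v)^-1) (fun v => T ^+ place_degree v / v (h v)).
- by rewrite filter_uniq ?undup_uniq.
- by move=> /SfP fv; rewrite invr_eq0 h0.
- by rewrite /= divr_gt0 ?exprn_gt0.
- rewrite big_split /= prodfV prodrXr sum_place_degree // -/D.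
  under [X in _ * X]eq_bigr => v _ do rewrite absvalV //.
  rewrite prodfV -mulrA -invfM [X in _ / X]mulrC [_ * \prod_(v <- Inf) _]mulrC -PE TD.
  by rewrite ler_pdivlMr // -mulrA ler_pM2l.
exists (wact a t y); split; first by exists t.
- move=> j v fv; rewrite mxE (absvalM (hv v)) absvalX //.
  have [vS|vS] := boolP (v \in Sf).
    have [_ [hy _ _]] := Hh v.
    apply: le_trans (ler_pM _ _ (lerXn2r (a j) _ _ (t1 v vS)) (hy j)) _;
      rewrite ?nnegrE ?exprn_ge0 ?(absval_ge0 (hv v)) //.
    by rewrite -exprMn -(absvalM (hv v)) mulVf // absval1 // expr1n.
  have vSx : v \notin Sx.
    by apply: contra vS => vSx; rewrite mem_filter vSx andbT finite_not_Inf.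
  have [_ _ yu] := outS v vSx.
  apply: mulr_ile1; rewrite ?exprn_ge0 ?(absval_ge0 (hv v)) //.
    by rewrite exprn_ile1 ?(absval_ge0 (hv v)) // t2.
  have [->|yj] := eqVneq (y 0 j) 0; first by rewrite absval0 // ler01.
  by rewrite yu.
move=> j v vI; rewrite mxE (absvalM (hv v)) absvalX //.
have [_ [hy _ _]] := Hh v.
apply: le_trans (ler_pM _ _ (lerXn2r (a j) _ _ (t3 v vI)) (hy j)) _;
  rewrite ?nnegrE ?exprn_ge0 ?divr_ge0 ?(absval_ge0 (hv v)) //.
- by rewrite exprn_ge0 // ltW.
by rewrite -exprMn divfK // gt_eqF.
Qed.

(** For a nonzero coordinate z_j, the product over the infinite places is at least 1 and at most
    T^(D a_j). So no point occurs when T < 1, and otherwise the boxes meet the condition [1 <= A v]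
    of [count_integral]. *)
Lemma small_rep_ge1 (T : R) (x : wpoints a F) z : 0 < T -> small_rep T x z -> 1 <= T.
Proof.
move=> T0 [[t t0 zE] zfin zinf].
have [j zj] : exists j, z 0 j != 0.
  apply: contrapT => hno; have /eqP := lift_pt_neq0 x; apply; apply/rowP => j; rewrite mxE.
  have zj : z 0 j = 0 by apply/eqP; apply: contraT => zj; case: hno; exists j.
  by move: zj; rewrite zE mxE => /eqP; rewrite mulf_eq0 expf_eq0 (negbTE t0) andbF => /eqP.
have /(_ (zfin j)) := prod_infinite_ge1 uInf InfP zj.
move=> h; have : 1 <= (T ^+ D) ^+ a j.
  have -> : D = (\sum_(v <- Inf) place_degree v)%N by rewrite sum_place_degree.
  apply: le_trans h _; rewrite -prodrXr -prodrXl.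
  rewrite !big_seq; apply: ler_prod => v vI; rewrite (absval_ge0 (hv v)) /=; exact: zinf.
rewrite -exprM => h2; rewrite leNgt; apply/negP => T1; move: h2; rewrite leNgt => /negP; apply.
by rewrite exprn_ilt1 ?(ltW T0) // muln_eq0 negb_or -!lt0n dim_gt0 a_gt0.
Qed.

(** The lift determines the point, so the count is at most the product over j of the numbers of
    values of z_j, and a coordinate in J only takes the value 0. *)
Lemma size_small_reps (T : R) (X : seq (wpoints a F)) (Z : wpoints a F -> 'rV[F]_n) (J : pred 'I_n) :
  1 <= T -> uniq X -> (forall x, x \in X -> small_rep T x (Z x)) ->
  (forall x j, x \in X -> J j -> Z x 0 j = 0) ->
  (size X)%:R <= \prod_(j | ~~ J j) (72 ^+ size Inf * (T ^+ D) ^+ a j).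
Proof.
move=> T1 uX XZ XJ.
have Zinj : {in X &, injective Z}.
  move=> x y xX yX e; have [[t t0 tE] _ _] := XZ x xX; have [[u u0 uE] _ _] := XZ y yX.
  by apply: (lift_pt_inj t0 u0); rewrite -tE -uE.
pose L j := undup [seq Z x 0 j | x <- X].
have := @size_le_prod_coords F n (map Z X) L.
rewrite size_map map_inj_in_uniq // => /(_ uX (fun j => undup_uniq _)) hX.
have {hX} : (size X <= \prod_j size (L j))%N.
  by apply: hX => _ j /mapP[x xX ->]; rewrite mem_undup; apply: map_f.
rewrite -(ler_nat R) => /le_trans; apply; rewrite natr_prod.
rewrite [leRHS]big_mkcond /=; apply: ler_prod => j _; rewrite ler0n /=.
case: ifPn => [nJ|/negPn Jj]; last first.
  have sL : {subset L j <= [:: 0]}.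
    by move=> _ /[!mem_undup] /mapP[x xX ->]; rewrite XJ // inE.
  by have := uniq_leq_size (undup_uniq _) sL; rewrite -(ler_nat R).
apply: le_trans (@count_integral _ _ _ uInf InfP (fun v => (T ^+ place_degree v) ^+ a j) (L j) _ _ _ _) _.
- by move=> v _; rewrite !exprn_ege1.
- exact: undup_uniq.
- by move=> _ v /[!mem_undup] /mapP[x xX ->] fv; have [_ h _] := XZ x xX; apply: h.
- by move=> _ v /[!mem_undup] /mapP[x xX ->] fv; have [_ _ h] := XZ x xX; apply: h.
rewrite big_split /= prodrXl prodrXr sum_place_degree // big_const_seq count_predT iter_mulr_1; exact: lexx.
Qed.

(** Raising the exponents to n and m needs [1 <= T], which any element of X provides. *)
Lemma size_small_reps_le (T : R) (X : seq (wpoints a F)) (Z : wpoints a F -> 'rV[F]_n) (J : pred 'I_n) m :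
  0 < T -> uniq X -> (forall x, x \in X -> small_rep T x (Z x)) ->
  (forall x j, x \in X -> J j -> Z x 0 j = 0) -> (\sum_(j | ~~ J j) a j <= m)%N ->
  (size X)%:R <= (72 ^+ size Inf) ^+ n * (T ^+ D) ^+ m.
Proof.
move=> T0 uX XZ XJ am.
have K1 : 1 <= (72 : R) ^+ size Inf by rewrite exprn_ege1 // ler1n.
have [->|[x xX]] : X = [::] \/ exists x, x \in X.
  by case: (X) => [|x X']; [left|right; exists x; rewrite mem_head].
  by rewrite mulr_ge0 // ?exprn_ge0 // ?(ltW T0) ?ler0n // (le_trans ler01).
have T1 : 1 <= T := small_rep_ge1 T0 (XZ x xX).
apply: le_trans (size_small_reps T1 uX XZ XJ) _.
have -> : \prod_(j | ~~ J j) (72 ^+ size Inf * (T ^+ D) ^+ a j) =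
    (72 ^+ size Inf) ^+ #|predC J| * (T ^+ D) ^+ (\sum_(j | ~~ J j) a j).
  rewrite big_split /=; congr (_ * _); last exact: prodrXr.
  by rewrite -prodr_const; apply: eq_bigl.
apply: ler_pM.
- by rewrite exprn_ge0 // (le_trans ler01).
- by rewrite exprn_ge0 // exprn_ge0 // ltW.
- by apply: ler_weXn2l => //; rewrite -[leqRHS]card_ord max_card.
by apply: ler_weXn2l => //; rewrite exprn_ege1.
Qed.

End Counting.

(** * From bounds on finite lists to the theorem *)

Lemma finite_of_size_bound (R : realType) (T : choiceType) (S : set T) (K : R) :
  (forall X : seq T, uniq X -> (forall x, x \in X -> S x) -> (size X)%:R <= K) ->
  finite_set S /\ (#|` fset_set S|)%:R <= K.
Proof.
move=> H.
have fS : finite_set S.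
  apply: contrapT => inf.
  have [Y YS Ysize] := infinite_set_fset (Num.truncn `|K|).+1 inf.
  have := H (enum_fset Y) (fset_uniq Y) (fun x xY => YS x xY).
  have /andP[_ h] := truncn_itv (normr_ge0 K).
  rewrite leNgt => /negP; apply; apply: le_lt_trans (ler_norm K) _; apply: lt_le_trans h _.
  by rewrite ler_nat.
split=> //; apply: H; first exact: fset_uniq.
by move=> x; rewrite in_fset_set // inE.
Qed.

(** ln (2 + B) is at least ln 2 > 0, so a power of it is absorbed in the constant; K + 1 instead of
    K makes the inequality strict and C positive. *)
Lemma lt_log_factor (R : realType) (K : R) (k : nat) : 0 <= K ->
  exists2 C : R, 0 < C & forall B : R, 0 < B -> K * B < C * B * ln (2 + B) ^+ k.
Proof.
move=> K0; have l2 : 0 < ln (2 : R) by rewrite ln_gt0 // ltr1n.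
have lk : 0 < ln (2 : R) ^+ k by rewrite exprn_gt0.
exists ((K + 1) / ln 2 ^+ k); first by rewrite divr_gt0 // ltr_wpDl.
move=> B B0; apply: (@lt_le_trans _ _ ((K + 1) * B)); first by rewrite ltr_pM2r // ltrDl.
rewrite (_ : _ * _ * _ = (K + 1) * B * (ln (2 + B) ^+ k / ln 2 ^+ k)); last by ring.
rewrite ler_peMr ?mulr_ge0 ?addr_ge0 // ?(ltW B0) // ler_pdivlMr // mul1r.
rewrite lerXn2r ?nnegrE ?(ltW l2) //; last by rewrite ler_ln ?posrE ?addr_gt0 // lerDl ltW.
by rewrite ln_ge0 // (le_trans (ltW (ltr1n R 2))) // lerDl ltW.
Qed.

Lemma size_le_sum_count (T : eqType) (I : finType) (P : T -> pred I) (X : seq T) :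
  (forall x, x \in X -> exists i, P x i) -> (size X <= \sum_i count (P^~ i) X)%N.
Proof.
elim: X => [//|x X IH] H /=; rewrite big_split /= -add1n leq_add //.
  have [i Pi] := H x (mem_head _ _); by rewrite (bigD1 i) //= Pi leq_addr.
by apply: IH => y yX; apply: H; rewrite inE yX orbT.
Qed.

Theorem theorem3p6p8p2 (R : realType) (F : fieldExtType rat) (r1 r2 : nat)
    (r1P : [set v : place R F | real_absval v] #= `I_r1)
    (r2P : [set v : place R F | complex_absval v] #= `I_r2)
    (Fv : forall v : place R F, completion v)
    (n : nat) (n_ge1 : (1 <= n)%N)
    (a : 'I_n -> nat) (a_gt0 : forall j, (0 < a j)%N)
    (f : forall v : place R F, 'rV[Fv v]_n -> R)
    (f_gt0 : forall v (x : 'rV[Fv v]_n), x != 0 -> 0 < f v x)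
    (f_qt : quasi_toric a (wsize a)%:R f) :
  (exists2 C : R, 0 < C & forall B : R, 0 < B ->
    let S := [set x : wpoints a F | ~ torus_points x /\ height f x <= B] in
    let Be := B `^ (((wsize a)%:R - (wmin a)%:R) / (wsize a)%:R) in
    finite_set S /\
    (#|` fset_set S |)%:R
      < C * Be * ln (2 + Be) ^+ (n ^ 2 * (r1 + r2) + n - 1)%N) /\
  (exists2 C : R, 0 < C & forall B : R, 0 < B ->
    let S := [set x : wpoints a F | height f x <= B] in
    finite_set S /\
    (#|` fset_set S |)%:R
      < C * B * ln (2 + B) ^+ (n ^ 2 * (r1 + r2) + n - 1)%N).
Proof.
have /finite_seqP[s1 s1E] : finite_set [set v : place R F | real_absval v].
  by apply/finite_setP; exists r1.
have /finite_seqP[s2 s2E] : finite_set [set v : place R F | complex_absval v].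
  by apply/finite_setP; exists r2.
pose Inf := undup (s1 ++ s2).
have uInf : uniq Inf by apply: undup_uniq.
have InfP v : v \in Inf <-> real_absval v \/ complex_absval v.
  rewrite mem_undup mem_cat.
  have -> : real_absval v = (v \in s1) :> Prop by have := congr1 (fun A => A v) s1E.
  have -> : complex_absval v = (v \in s2) :> Prop by have := congr1 (fun A => A v) s2E.
  by split=> [/orP|/orP].
have [C1 C10 Hrep] := exists_small_rep a_gt0 n_ge1 f_gt0 f_qt uInf InfP.
set d := wsize a in Hrep *; set D := \dim {:F} in Hrep.
have d0 : (0 < d)%N by apply: wsize_gt0.
have D0 : (0 < D)%N by apply: dim_gt0.
pose T B : R := (C1 * B `^ d%:R^-1) `^ D%:R^-1.
have T0 B : 0 < B -> 0 < T B by move=> B0; rewrite powR_gt0 // mulr_gt0 ?powR_gt0.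
have TD B m : 0 < B -> (T B ^+ D) ^+ m = C1 ^+ m * B `^ (m%:R / d%:R).
  move=> B0; have C1B : 0 <= C1 * B `^ d%:R^-1 by rewrite mulr_ge0 ?powR_ge0 // ltW.
  have -> : T B ^+ D = C1 * B `^ d%:R^-1.
    by rewrite -powR_mulrn ?powR_ge0 // -powRrM mulVf ?pnatr_eq0 -?lt0n // powRr1.
  by rewrite exprMn -[(B `^ _) ^+ m]powR_mulrn ?powR_ge0 // -powRrM [d%:R^-1 * _]mulrC.
pose K0 : R := (72 ^+ size Inf) ^+ n.
have K00 : 0 <= K0 by rewrite !exprn_ge0.
have /choice[Z HZ] (Bx : R * wpoints a F) : exists z, 0 < Bx.1 -> height f Bx.2 <= Bx.1 ->
    small_rep Inf (T Bx.1) Bx.2 z.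
  have [[Bx0 HB]|no] := pselect (0 < Bx.1 /\ height f Bx.2 <= Bx.1); last first.
    by exists 0 => Bx0 HB; case: no.
  by have [z hz] := Hrep _ _ Bx0 HB; exists z.
split.
  (* A vanishing coordinate j leaves weights of sum |a| - a_j, which is at most m whatever j is. *)
  set m := (d - wmin a)%N.
  have K1 : 0 <= n%:R * K0 * C1 ^+ m by rewrite !mulr_ge0 // ?ler0n // exprn_ge0 // ltW.
  have [C C0 HC] := lt_log_factor (n ^ 2 * (r1 + r2) + n - 1)%N K1.
  exists C => // B B0 S Be.
  have wd : (wmin a <= d)%N := leq_trans (wmin_le a (Ordinal n_ge1)) (le_wsize a _).
  have BeE : Be = B `^ (m%:R / d%:R) by rewrite /Be natrB.
  have [|fS le] := @finite_of_size_bound R _ S (n%:R * K0 * C1 ^+ m * Be).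
    move=> X uX XS.
    (* Points off the torus are sorted by a vanishing coordinate, at the cost of the factor n. *)
    have /size_le_sum_count : forall x, x \in X -> exists j, (fun x j => lift_pt x 0 j == 0) x j.
      move=> x /XS[nt _]; apply: contrapT => hno; apply: nt => j; apply/negP => xj.
      by apply: hno; exists j.
    rewrite -(ler_nat R) => /le_trans; apply; rewrite natr_sum.
    rewrite -mulrA -mulrA mulr_natl -[X in _ *+ X]card_ord -sumr_const.
    apply: ler_sum => j _; rewrite -size_filter BeE -TD //.
    apply: (size_small_reps_le Fv a_gt0 uInf InfP (Z := fun x => Z (B, x)) (J := pred1 j) (T0 B B0)).
    - exact: filter_uniq.
    - by move=> x; rewrite mem_filter => /andP[_ /XS[_ HB]]; apply: (HZ (B, x)).
    - move=> x i; rewrite mem_filter => /andP[xj /XS[_ HB]] /eqP ->.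
      have [[t t0 ->] _ _] := HZ (B, x) B0 HB; by rewrite mxE (eqP xj) mulr0.
    rewrite -(leq_add2l (a j)) -[leqLHS](bigD1 j (P := predT)) //=.
    by rewrite -/(wsize a) -/d /m addnBA // addnC -addnBA ?leq_addr // wmin_le.
  by split=> //; apply: le_lt_trans le _; apply: HC; rewrite powR_gt0.
have K2 : 0 <= K0 * C1 ^+ d by rewrite mulr_ge0 // exprn_ge0 // ltW.
have [C C0 HC] := lt_log_factor (n ^ 2 * (r1 + r2) + n - 1)%N K2.
exists C => // B B0 S.
have [|fS le] := @finite_of_size_bound R _ S (K0 * C1 ^+ d * B).
  move=> X uX XS.
  have -> : K0 * C1 ^+ d * B = K0 * (T B ^+ D) ^+ d.
    by rewrite TD // divff ?powRr1 ?(ltW B0) ?mulrA // pnatr_eq0 -lt0n.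
  apply: (size_small_reps_le Fv a_gt0 uInf InfP (Z := fun x => Z (B, x)) (J := pred0) (T0 B B0)) => //.
  by move=> x /XS HB; apply: (HZ (B, x)).
by split=> //; apply: le_lt_trans le _; apply: HC.
Qed.
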